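(* Let $n\ge1$, $\gamma>0$, and let $M$ be a real skew-symmetric $n\times n$ matrix. Define, for $0\le t<\frac{\pi}{4\gamma}$ and $x\in\mathbb R^n$, $$u(t,x)=\frac{1}{\cos^{\frac n2}(2\gamma t)}\,e^{-i\frac\gamma2|x|^2\tan(2\gamma t)}\,e^{i\frac{\tan(2\gamma t)}{2\gamma}}\,Q\Big(\frac{e^{tM}x}{\cos(2\gamma t)}\Big).$$ Then $u$ is a solution of $$i u_t=-\Delta u+\gamma^2|x|^2u-|u|^{\frac4n}u+i(Mx)\cdot\nabla u$$ with $u(0,\cdot)=Q$ (so $|u(0)|_2=|Q|_2$), and $u$ blows up at time $T=\frac{\pi}{4\gamma}$ with $$|\nabla u(t)|_2\approx\frac{1}{\frac\pi2-2\gamma t}\,|\nabla Q|_2\qquad\text{as }t\to T=\frac{\pi}{4\gamma},$$ that is, the ratio of the two sides tends to $1$.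
   Context: $|\cdot|_2$ denotes the $L^2(\mathbb R^n)$ norm. $Q\in H^1(\mathbb R^n)$ is the unique positive radial solution of $-Q=-\Delta Q-Q^{1+\frac4n}$. Solutions are understood in $C([0,T);\mathscr H^1)$, where $\mathscr H^1=\{f\in L^2:\nabla f\in L^2,\ xf\in L^2\}$ with norm $|\nabla f|_2+|xf|_2+|f|_2$; blowing up at time $T$ means $[0,T)$ is the maximal interval of existence and $|\nabla u(t)|_2\to\infty$ as $t\to T$. *)

(* Defs.v *)
From HB Require Import structures.
From mathcomp Require Import all_boot all_order all_algebra.
From mathcomp Require Import all_classical all_reals all_analysis.
From mathcomp Require Import complex.
Set Implicit Arguments.
Unset Strict Implicit.
Unset Printing Implicit Defensive.
Import Order.TTheory GRing.Theory Num.Theory.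
Import numFieldNormedType.Exports.

Local Open Scope classical_set_scope.
Local Open Scope ring_scope.
Local Open Scope complex_scope.

Section LebesgueRn.
Variable R : realType.

Definition cons_pair n (p : R * n.-tuple R) : n.+1.-tuple R :=
  [the n.+1.-tuple R of p.1 :: p.2].

Lemma measurable_cons_pair n :
  measurable_fun [set: R * n.-tuple R] (@cons_pair n).
Proof. exact: measurable_cons. Qed.

Definition uncons_pair n (t : n.+1.-tuple R) : R * n.-tuple R :=
  (thead t, [tuple of behead t]).

Lemma measurable_uncons_pair n :
  measurable_fun [set: n.+1.-tuple R] (@uncons_pair n).
Proof.
apply/measurable_fun_pairP; split; first exact: measurable_tnth.
exact: measurable_behead.
Qed.

Lemma cons_pairK n : cancel (@cons_pair n) (@uncons_pair n).
Proof. by move=> [x t]; congr pair; exact: val_inj. Qed.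

Lemma uncons_pairK n : cancel (@uncons_pair n) (@cons_pair n).
Proof. by move=> t; rewrite [RHS]tuple_eta. Qed.

Section step.
Variables (n : nat) (m : {sigma_finite_measure set (n.-tuple R) -> \bar R}).

Definition lebesgueS : set (n.+1.-tuple R) -> \bar R :=
  pushforward (@lebesgue_measure R \x m)%E (@cons_pair n).

Let mpre (A : set (n.+1.-tuple R)) :
  measurable A -> measurable (@cons_pair n @^-1` A).
Proof. by move=> mA; rewrite -[_ @^-1` _]setTI; exact: measurable_cons_pair. Qed.

Let lebesgueS0 : lebesgueS set0 = 0%E.
Proof. by rewrite /lebesgueS /pushforward preimage_set0 measure0. Qed.

Let lebesgueS_ge0 A : (0 <= lebesgueS A)%E.
Proof. by rewrite /lebesgueS /pushforward; apply: measure_ge0. Qed.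

Let lebesgueS_sigma_additive : semi_sigma_additive lebesgueS.
Proof.
move=> F mF tF mUF; rewrite /lebesgueS /pushforward preimage_bigcup.
apply: measure_semi_sigma_additive.
- by move=> k; exact: mpre.
- apply/trivIsetP => /= i j _ _ ij; rewrite -preimage_setI.
  by move/trivIsetP : tF => /(_ _ _ _ _ ij) ->//; rewrite preimage_set0.
- by rewrite -preimage_bigcup; exact: mpre.
Qed.

HB.instance Definition _ := isMeasure.Build _ _ _ lebesgueS
  lebesgueS0 lebesgueS_ge0 lebesgueS_sigma_additive.

Let lebesgueS_sigma_finite : sigma_finite setT lebesgueS.
Proof.
have /sigma_finiteP[F [TF ndF Foo]] := sigma_finiteT (@lebesgue_measure R).
have /sigma_finiteP[G [TG ndG Goo]] := sigma_finiteT m.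
exists (fun k => @uncons_pair n @^-1` (F k `*` G k)).
  rewrite -preimage_bigcup [X in _ @^-1` X](_ : _ = setT) ?preimage_setT//.
  apply/seteqP; split => // -[x t] _.
  have [i _ Fx] : (\bigcup_i F i) x by rewrite -TF.
  have [j _ Gt] : (\bigcup_i G i) t by rewrite -TG.
  exists (maxn i j) => //; split => /=.
    by move: x Fx; exact/subsetPset/ndF/leq_maxl.
  by move: t Gt; exact/subsetPset/ndG/leq_maxr.
move=> k; have [mF Fk] := Foo k; have [mG Gk] := Goo k.
have mFG : measurable (F k `*` G k) by exact: measurableX.
split; first by rewrite -[_ @^-1` _]setTI; exact: measurable_uncons_pair.
rewrite /lebesgueS /pushforward -comp_preimage.
rewrite (_ : _ \o _ = id) ?preimage_id.
  by rewrite product_measure1E// lte_mul_pinfty// ge0_fin_numE.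
by apply/funext => p /=; rewrite cons_pairK.
Qed.

HB.instance Definition _ := Measure_isSigmaFinite.Build _ _ _
  lebesgueS lebesgueS_sigma_finite.

End step.

(* Lebesgue measure on R^n, carried by n-tuples with the product (i.e. Borel)
   sigma-algebra: the n-fold product of the one-dimensional Lebesgue measure. *)
Fixpoint lebesgueRn n : {sigma_finite_measure set (n.-tuple R) -> \bar R} :=
  match n with
  | 0 => \d_([tuple] : 0.-tuple R)
  | k.+1 => lebesgueS (lebesgueRn k)
  end.

Lemma lebesgueRn_box n (A : 'I_n -> set R) : (forall i, measurable (A i)) ->
  lebesgueRn n [set t | forall i, A i (tnth t i)] =
  (\prod_(i < n) @lebesgue_measure R (A i))%E.
Proof.
elim: n A => [|n IHn] A mA.
  rewrite big_ord0 /= diracE mem_set//.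
  by case.
rewrite big_ord_recl /= /lebesgueS /pushforward.
rewrite -IHn; last by move=> i; exact: mA.
set B := [set t : n.-tuple R | _].
have mB : measurable B.
  rewrite (_ : B = \bigcap_i [set t : n.-tuple R | A (lift ord0 i) (tnth t i)]).
    apply: fin_bigcap_measurable => // i _.
    by rewrite -[X in measurable X]setTI; exact: measurable_tnth.
  by apply/seteqP; split => [t Bt i _|t Bt i] /=; [exact: Bt|exact: (Bt i I)].
rewrite -(@product_measure1E _ _ _ _ _ (@lebesgue_measure R) (lebesgueRn n))//;
last exact: mA.
congr (product_measure1 _ _ _).
apply/seteqP; split => -[x t] /=.
  move=> H; split; first exact: (H ord0).
  by move=> i; have := H (lift ord0 i); rewrite /cons_pair /= tnthS.
move=> [Ax Bt] i; case: (unliftP ord0 i) => [j ->|->//].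
rewrite /cons_pair /= tnthS; exact: Bt.
Qed.

End LebesgueRn.

(* R^n is the space of column vectors, so that matrices act by [*m]; note that
   the library norm on 'cV[R]_n is the sup norm. *)
Definition enorm (R : realType) n (x : 'cV[R]_n) : R :=
  Num.sqrt (\sum_i x i 0 ^+ 2).

Definition vec (R : realType) n (t : n.-tuple R) : 'cV[R]_n :=
  \col_i tnth t i.

Definition expi (R : realType) (a : R) : R[i] := cos a +i* sin a.

(* Entrywise limit of the partial sums of the exponential series. *)
Definition expmx (R : realType) n (A : 'M[R]_n) : 'M[R]_n :=
  \matrix_(i, j) limn (series (fun k => (k`!%:R^-1 *: A ^+ k) i j)).

Section Calculus.
Variables (R : realType) (n : nat).
Implicit Types (f : 'cV[R]_n -> R) (j : 'I_n).

Definition partial j f : 'cV[R]_n -> R := fun x => 'D_(delta_mx j 0) f x.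

Definition partials (s : seq 'I_n) f : 'cV[R]_n -> R := foldr partial f s.

Definition laplacian f : 'cV[R]_n -> R :=
  fun x => \sum_j partials [:: j; j] f x.

Definition Ck k f : Prop :=
  (forall s j x, (size s < k)%N -> derivable (partials s f) x (delta_mx j 0)) /\
  (forall s, (size s <= k)%N -> continuous (partials s f)).

(* Real-valued functions in C_c^infty(R^n); testing against them is the same
   as testing against complex-valued ones. *)
Definition test_function f : Prop :=
  (forall k, Ck k f) /\
  exists2 K : set 'cV[R]_n, compact K & forall x, ~ K x -> f x = 0.

End Calculus.

Section FunctionSpaces.
Variables (R : realType) (n : nat).
Implicit Types (f g : 'cV[R]_n -> R[i]) (G : 'cV[R]_n -> 'cV[R[i]]_n).

Definition integralC f : R[i] :=
  (\int[lebesgueRn R n]_t complex.Re (f (vec t)))%R +i*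
  (\int[lebesgueRn R n]_t complex.Im (f (vec t)))%R.

Definition L2enorm (h : 'cV[R]_n -> R) : \bar R :=
  ('N[lebesgueRn R n]_2[(fun t => (h (vec t))%:E)])%E.

Definition inL2 f : Prop :=
  [/\ measurable_fun setT (fun t : n.-tuple R => complex.Re (f (vec t))),
      measurable_fun setT (fun t : n.-tuple R => complex.Im (f (vec t))) &
      (L2enorm (fun x => Normc.normc (f x)) < +oo)%E].

Definition L2norm f : R := fine (L2enorm (fun x => Normc.normc (f x))).

Definition is_weak_gradient f G : Prop :=
  (forall j, inL2 (fun x => G x j 0)) /\
  (forall phi, test_function phi -> forall j,
     integralC (fun x => f x * (partial j phi x)%:C) =
     - integralC (fun x => G x j 0 * (phi x)%:C)).

(* The distributional gradient when it is in L^2 (it is then unique up to a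
   null set), and 0 otherwise. *)
Definition weak_gradient f : 'cV[R]_n -> 'cV[R[i]]_n :=
  xget (fun _ => 0) [set G | is_weak_gradient f G].

Definition gradL2norm f : R :=
  fine (L2enorm (fun x =>
    Num.sqrt (\sum_j Normc.normc (weak_gradient f x j 0) ^+ 2))).

Definition inH1 f : Prop := inL2 f /\ exists G, is_weak_gradient f G.

Definition weighted f : 'cV[R]_n -> R[i] := fun x => (enorm x)%:C * f x.

(* The space {f in L^2 : nabla f in L^2, x f in L^2} and its norm. *)
Definition inSigma f : Prop := inH1 f /\ inL2 (weighted f).

Definition Sigma_norm f : R :=
  gradL2norm f + L2norm (weighted f) + L2norm f.

End FunctionSpaces.

(* Q is a positive radial H^1 solution of - Q = - Delta Q - Q^(1 + 4/n), taken
   to be classical, as such solutions are by elliptic regularity; there is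
   exactly one. *)
Definition ground_state (R : realType) n (Q : 'cV[R]_n -> R) : Prop :=
  [/\ Ck 2 Q /\ inH1 (fun x => (Q x)%:C),
      forall x, 0 < Q x,
      forall x y, enorm x = enorm y -> Q x = Q y &
      forall x, - Q x = - laplacian Q x - Q x `^ (1 + 4 / n%:R)].

Section RotatingNLS.
Variables (R : realType) (n : nat) (gamma : R) (M : 'M[R]_n).
Implicit Types (u v : R -> 'cV[R]_n -> R[i]) (phi : 'cV[R]_n -> R).

(* Pairing of the right-hand side
     - Delta f + gamma^2 |x|^2 f - |f|^(4/n) f + i (M x) . nabla f
   with phi. All the integrals converge for f in Sigma, since H^1 is contained
   in L^(2 + 4/n). *)
Definition rhs_pairing (f : 'cV[R]_n -> R[i]) phi : R[i] :=
  let df := weak_gradient f in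
  integralC (fun x => \sum_j df x j 0 * (partial j phi x)%:C)
  + integralC (fun x => (gamma ^+ 2 * enorm x ^+ 2)%:C * f x * (phi x)%:C)
  - integralC (fun x =>
      (Normc.normc (f x) `^ (4 / n%:R))%:C * f x * (phi x)%:C)
  + 'i * integralC (fun x =>
      (\sum_j ((M *m x) j 0)%:C * df x j 0) * (phi x)%:C).

(* u belongs to C([0, T); Sigma) and satisfies
     i u_t = - Delta u + gamma^2 |x|^2 u - |u|^(4/n) u + i (M x) . nabla u
   in the sense of distributions in x, at every time: as the right-hand side is
   continuous in time with values in the dual of Sigma, this is the same as the
   equation in the sense of distributions on (0, T) x R^n. *)
Definition solution (T : R) u : Prop :=
  [/\ forall t : R, 0 <= t < T -> inSigma (u t),
      forall t : R, 0 <= t < T ->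
        Sigma_norm (u s \- u t) @[s --> within `[0, T[ (nbhs t)] --> 0 &
      forall t : R, 0 < t < T -> forall phi, test_function phi ->
        exists d : R[i],
        [/\ is_derive t 1 (fun s : R =>
              complex.Re (integralC (fun x => u s x * (phi x)%:C)))
              (complex.Re d),
            is_derive t 1 (fun s : R =>
              complex.Im (integralC (fun x => u s x * (phi x)%:C)))
              (complex.Im d) &
            'i * d = rhs_pairing (u t) phi]].

Definition maximal_solution (T : R) u : Prop :=
  solution T u /\
  forall (T' : R) v, T < T' -> solution T' v ->
    ~ (forall t : R, 0 <= t < T ->
         {ae lebesgueRn R n, forall x, v t (vec x) = u t (vec x)}).

Definition blows_up_at (T : R) u : Prop :=
  maximal_solution T u /\ gradL2norm (u t) @[t --> T^'-] --> +oo.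

End RotatingNLS.

(* Main.v *)
(** Since M is skew, exp(tM) is orthogonal, and Q is radial: u(t) does not see M, the term
    (Mx).nabla u vanishes, and u is the lens transform of the standing wave e^{is} Q.  Its real
    and imaginary parts are waves a cos(w + b|x|^2) Q(kx) with
      a' = -2nab,  b' = -gamma^2 k^2,  w' = k^2,  k' = -4bk,
      4b^2 + gamma^2 = gamma^2 k^2,  a^(4/n) = k^2,
    and these relations turn the equation of Q into the pointwise equation for u.
    Membership in Sigma and passage to the limit under the integrals rest on the exponential
    decay of Q and nabla Q: the energy of the radial ODE is nonincreasing, so Q and Q' are
    bounded; Q being uniformly continuous and in L^2, Q tends to 0; then Q'' >= Q/2 and Q' < 0
    far out give Q' <= -Q/2.
    Finally |nabla u(t)|^2 = gamma^2 sin^2(2 gamma t) |xQ|^2 + |nabla Q|^2 / cos^2(2 gamma t),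
    which gives the rate; an extension beyond T would be continuous in Sigma at T, hence have a
    bounded gradient near T. *)
Require Import Defs.
From mathcomp Require Import all_boot all_order all_algebra.
From mathcomp Require Import all_classical all_reals all_analysis.
From mathcomp Require Import measurable_realfun complex ring lra.
Set Implicit Arguments.
Unset Strict Implicit.
Unset Printing Implicit Defensive.
Import Order.TTheory GRing.Theory Num.Theory.
Import numFieldNormedType.Exports.

Local Open Scope classical_set_scope.
Local Open Scope ring_scope.
Local Open Scope complex_scope.

(** * The matrix exponential *)

Section MatrixExponential.
Variable R : realType.

(** Two features of the setting shape the work. Integrals are taken over tuples with an iterated
    product measure, while derivatives are taken over column vectors; everything integrated passes
    through [vec] and is handled one coordinate at a time. Hence the common majorant is a product of
    one-variable functions, and the regions used far out are boxes. Moreover [weak_gradient] is an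
    arbitrary choice among the weak gradients, so no gradient norm or pairing can be computed before
    weak gradients are known to agree almost everywhere; this calls for enough explicit test
    functions to detect every box. Multiplication by i is a phase shift by pi/2. One real family of
    cosine waves therefore serves for the real part, the imaginary part and the right-hand side of
    the equation, and a single scalar identity covers both components. The rotation is removed by
    radiality before any integration, so the only change of variables in space is a dilation, whose
    Jacobian is cancelled by the amplitude. *)

Definition exp_bounded (C K : R) (c : R^nat) := forall k, `|c k| <= C * (K ^+ k / k`!%:R).

Lemma exp_bounded_cvg C K (c : R^nat) x : 0 <= K -> exp_bounded C K c -> cvgn (pseries c x).
Proof.
move=> K0 cb; apply: normed_cvg.
apply: (@series_le_cvg _ _ (fun k => C * exp_coeff (K * `|x|) k)).
- by move=> k; rewrite normr_ge0.
- move=> k; rewrite /exp_coeff/= mulr_ge0//; last by rewrite divr_ge0// exprn_ge0// mulr_ge0.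
  by have := cb 0%N; rewrite expr0 fact0 divr1 mulr1; exact: le_trans.
- move=> k /=; rewrite normrM normrX /exp_coeff/= exprMn.
  rewrite (_ : C * _ = C * (K ^+ k / k`!%:R) * `|x| ^+ k); last by ring.
  by apply: ler_wpM2r (cb k); rewrite exprn_ge0.
- exact: is_cvg_seriesZ (is_cvg_series_exp_coeff _).
Qed.

Lemma exp_bounded_diffs C K (c : R^nat) : exp_bounded C K c -> exp_bounded (C * K) K (pseries_diffs c).
Proof.
move=> cb k; rewrite /pseries_diffs normrM ger0_norm ?ler0n//.
have := ler_wpM2l (ler0n R k.+1) (cb k.+1); move=> /le_trans; apply.
rewrite factS natrM exprS.
have k0 : k`!%:R != 0 :> R by rewrite pnatr_eq0 -lt0n fact_gt0.
have k1 : k.+1%:R != 0 :> R by rewrite pnatr_eq0.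
rewrite le_eqVlt; apply/orP; left; apply/eqP.
by field; rewrite k0 addrC natr1 k1.
Qed.

(** Termwise differentiation asks for convergence of the series and of its first two derived series
    at a point of larger modulus, here [|x| + 1]; the class [exp_bounded] is stable under derivation
    and forces convergence everywhere. *)
Lemma is_derive_pseries (C K : R) (c : R^nat) (x : R) : 0 <= K -> exp_bounded C K c ->
  is_derive x 1 (fun x => limn (pseries c x)) (limn (pseries (pseries_diffs c) x)).
Proof.
move=> K0 cb; apply: (@pseries_snd_diffs _ _ (`|x| + 1)).
- exact: exp_bounded_cvg cb.
- exact: exp_bounded_cvg (exp_bounded_diffs cb).
- exact: exp_bounded_cvg (exp_bounded_diffs (exp_bounded_diffs cb)).
- by rewrite [X in _ < X]ger0_norm ?addr_ge0// ltrDl.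
Qed.

Variables (n : nat) (M : 'M[R]_n).

Let c i j : R^nat := fun k => k`!%:R^-1 * (M ^+ k) i j.
(** [K] dominates every absolute row sum of [M], so induction bounds the entries of [M ^+ k] by
    [K ^+ k]; the summand 1 keeps [K] positive. *)
Let K := 1 + \sum_i \sum_j `|M i j|.

Let K1 : 1 <= K.
Proof. by rewrite /K lerDl; apply: sumr_ge0 => i _; apply: sumr_ge0. Qed.

Let mulmx_expr k : M ^+ k.+1 = M *m M ^+ k.
Proof. by rewrite exprS. Qed.

Let expr_bound k i j : `|(M ^+ k) i j| <= K ^+ k.
Proof.
elim: k i j => [|k IH] i j.
  by rewrite expr0 expr0 mxE; case: (_ == _); rewrite ?normr1// normr0.
rewrite mulmx_expr mxE exprS (le_trans (ler_norm_sum _ _ _))//.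
apply: (@le_trans _ _ (\sum_l `|M i l| * K ^+ k)).
  by apply: ler_sum => l _; rewrite normrM ler_wpM2l.
rewrite -mulr_suml; apply: ler_wpM2r; first by rewrite exprn_ge0 // (le_trans ler01 K1).
rewrite /K [X in _ <= _ + X](bigD1 i)//= addrCA lerDl addr_ge0//.
by apply: sumr_ge0 => ? _; apply: sumr_ge0.
Qed.

Let cb i j : exp_bounded 1 K (c i j).
Proof.
move=> k; rewrite mul1r /c normrM mulrC ler_pM//.
by rewrite ger0_norm// invr_ge0 ler0n.
Qed.

Let exprZmx (t : R) k : (t *: M) ^+ k = t ^+ k *: M ^+ k.
Proof.
elim: k => [|k IH]; first by rewrite !expr0 scale1r.
have -> : (t *: M) ^+ k.+1 = (t *: M) *m (t *: M) ^+ k by rewrite exprS.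
by rewrite IH mulmx_expr -scalemxAl -scalemxAr scalerA exprS.
Qed.

Let expmxE (t : R) i j : expmx (t *: M) i j = limn (pseries (c i j) t).
Proof.
rewrite mxE; congr (limn (series _)); apply/funext => k.
rewrite exprZmx mxE mxE /c. by rewrite /= mulrCA [RHS]mulrC.
Qed.

(** The derived series has general term [M *m M ^+ k / k!]; the product with [M] is a finite sum
    over [l], which commutes with the limit. *)
Lemma is_derive_expmx (t : R) i j :
  is_derive t 1 (fun t => expmx (t *: M) i j) ((M *m expmx (t *: M)) i j).
Proof.
have := is_derive_pseries t (le_trans ler01 K1) (cb i j).
rewrite (_ : (fun x => limn _) = (fun t => expmx (t *: M) i j)); last first.
  by apply/funext => x; rewrite expmxE.
move=> /is_derive_eq; apply.
rewrite mxE; under [RHS]eq_bigr do rewrite expmxE.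
rewrite (_ : pseries _ t = fun N => \sum_l M i l * pseries (c l j) t N); last first.
  apply/funext => N; rewrite /pseries /series/=.
  under [RHS]eq_bigr do rewrite mulr_sumr.
  rewrite exchange_big/=; apply: eq_bigr => k _.
  rewrite /pseries_diffs /c mulmx_expr mxE factS natrM.
  rewrite mulrA (mulrC _ (\sum_i0 _)) mulr_suml mulr_suml; apply: eq_bigr => l _.
  have k0 : k`!%:R != 0 :> R by rewrite pnatr_eq0 -lt0n fact_gt0.
  have k1 : k.+1%:R != 0 :> R by rewrite pnatr_eq0.
  by field; rewrite k0 addrC natr1 k1.
apply/cvg_lim => //.
apply: cvg_big => [|l _]; first exact: add_continuous.
by apply: cvgMr; apply: exp_bounded_cvg (cb l j); rewrite (le_trans _ K1).
Qed.

Lemma expmx0 : expmx (0 *: M) = 1%:M.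
Proof.
apply/matrixP => i j; rewrite expmxE.
(* The empty partial sum is 0; from index 1 on the partial sums at [t = 0] are constant, hence the
   shift. *)
apply/cvg_lim => //; rewrite -cvg_shiftS.
rewrite (_ : (fun n => _) = cst ((1%:M : 'M[R]_n) i j)); first exact: cvg_cst.
apply/funext => k /=; rewrite /pseries /series/= big_nat_recl//=.
rewrite big1 ?addr0 => [|l _]; last by rewrite expr0n/= mulr0.
by rewrite /c fact0 invr1 mul1r expr0 mulr1.
Qed.

(** The curve [y t = expmx (t *: M) *m x] solves [y' = M y], so the derivative of its squared length
    is twice [y . M y], which is 0 for skew [M]; the length is that at [t = 0]. *)
Lemma enorm_expmx (t : R) (x : 'cV[R]_n) : M^T = - M -> enorm (expmx (t *: M) *m x) = enorm x.
Proof.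
move=> skM; pose y t := expmx (t *: M) *m x.
have dy (s : R) i : is_derive s 1 (fun s => y s i 0) ((M *m y s) i 0).
  rewrite (_ : (fun s => _) = \sum_j (fun s => x j 0 *: expmx (s *: M) i j)); last first.
    by apply/funext => r; rewrite fct_sumE mxE; apply: eq_bigr => j _; rewrite mulrC.
  have := is_derive_sum (fun j => is_deriveZ (x j 0) (is_derive_expmx s i j)).
  move=> /is_derive_eq; apply; rewrite mulmxA [RHS]mxE.
  by apply: eq_bigr => j _; rewrite mulrC.
have dN (s : R) : is_derive s 1 (fun s => \sum_i y s i 0 ^+ 2) 0.
  rewrite (_ : (fun s => _) = \sum_i (fun s => y s i 0) ^+ 2); last first.
    by apply/funext => r; rewrite fct_sumE.
  have := is_derive_sum (fun i => is_deriveX 2 (dy s i)).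
  move=> /is_derive_eq; apply.
  have -> : \sum_i (2%:R * y s i 0 ^+ 2.-1) *: (M *m y s) i 0 =
            2 * ((y s)^T *m (M *m y s)) 0 0.
    rewrite mxE mulr_sumr; apply: eq_bigr => i _.
    by rewrite [_^T _ _]mxE expr1 [LHS]/GRing.scale/= mulrA.
  (* A 1 by 1 matrix equals its transpose, while transposing this one changes its sign. *)
  move: (y s) => z; have : (z^T *m (M *m z)) = - (z^T *m (M *m z)).
    have E : z^T *m (M *m z) = (z^T *m (M *m z))^T.
      by apply/matrixP => a b; rewrite [RHS]mxE !ord1.
    by rewrite {1}E !trmx_mul trmxK skM mulmxN mulNmx mulmxA.
  move=> /matrixP/(_ 0 0); rewrite [in X in _ = X]mxE => /eqP.
  by rewrite -addr_eq0 -mulr2n mulrn_eq0/= => /eqP ->; rewrite mulr0.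
rewrite /enorm; congr (Num.sqrt _).
have := @is_derive_0_is_cst _ _ t 0 dN; rewrite /= => ->.
by apply: eq_bigr => i _; rewrite /y expmx0 mul1mx.
Qed.

End MatrixExponential.

(** * Column vectors: norms, limits, splitting off a coordinate, measurability *)

Section ColumnVectors.
Variable R : realType.

Lemma ler_coord_norm n (x : 'cV[R]_n) i : `|x i 0| <= `|x|.
Proof.
rewrite [leRHS]/Num.norm/= mx_normrE; apply/bigmax_geP; right => /=.
by exists (i, 0).
Qed.

Lemma norm_cV_le n (x : 'cV[R]_n) e : 0 <= e -> (forall i, `|x i 0| <= e) -> `|x| <= e.
Proof.
move=> e0 xe; rewrite /Num.norm/= mx_normrE; apply/bigmax_leP; split => // -[i j] _ /=.
by rewrite ord1.
Qed.

Lemma cvg_cV (T : Type) (F : set_system T) (FF : Filter F) n (f : T -> 'cV[R]_n) (l : 'cV[R]_n) :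
  (forall i, f x i 0 @[x --> F] --> l i 0) -> f x @[x --> F] --> l.
Proof.
move=> fl; apply/cvgrPdist_le => e e0.
have H : \forall x \near F, forall i, `|l i 0 - f x i 0| <= e.
  by apply: filter_forall => i; move/cvgrPdist_le : (fl i) => /(_ _ e0).
near=> x; apply: norm_cV_le; first exact: ltW.
move=> i; rewrite mxE mxE; move: i; near: x; exact: H.
Unshelve. all: by end_near. Qed.

(** The counterpart of [cons_pair] on column vectors, through which continuous functions enter
    iterated integrals. *)
Definition cV_cons n (a : R) (v : 'cV[R]_n) : 'cV[R]_n.+1 :=
  \col_i (if unlift ord0 i is Some j then v j 0 else a).

Lemma cV_cons0 n a (v : 'cV[R]_n) : cV_cons a v ord0 0 = a.
Proof. by rewrite mxE unlift_none. Qed.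

Lemma cV_consS n a (v : 'cV[R]_n) i : cV_cons a v (lift ord0 i) 0 = v i 0.
Proof. by rewrite mxE liftK. Qed.

Lemma vec_cons_pair n (p : R * n.-tuple R) : vec (cons_pair p) = cV_cons p.1 (vec p.2).
Proof.
apply/matrixP => i j; rewrite ord1 mxE; case: (unliftP ord0 i) => [k ->|->].
  by rewrite cV_consS mxE /cons_pair tnthS.
by rewrite cV_cons0.
Qed.

Lemma cV_cons_continuous1 n (v : 'cV[R]_n) : continuous (fun a => cV_cons a v).
Proof.
move=> a; apply: cvg_cV => i; case: (unliftP ord0 i) => [k ->|->].
  rewrite cV_consS; under eq_fun do rewrite cV_consS; exact: cvg_cst.
by rewrite cV_cons0; under eq_fun do rewrite cV_cons0; exact: cvg_id.
Qed.

Lemma cV_cons_continuous2 n (a : R) : continuous (@cV_cons n a).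
Proof.
move=> v; apply: (@cvg_cV _ (nbhs v)) => i; case: (unliftP ord0 i) => [k ->|->].
  by rewrite cV_consS; under eq_fun do rewrite cV_consS; exact: coord_continuous.
by rewrite cV_cons0; under eq_fun do rewrite cV_cons0; exact: cvg_cst.
Qed.

(** The topology is that of column vectors, the sigma-algebra is the product one on tuples. Rounding
    each coordinate down to the grid of mesh [1 / (k + 1)] takes countably many values, each on a
    product of intervals, so any function of the rounded point is measurable; by continuity these
    functions converge pointwise to [f]. *)
Lemma continuous_measurable_vec n (f : 'cV[R]_n -> R) : continuous f ->
  measurable_fun setT (fun t : n.-tuple R => f (vec t)).
Proof.
move=> cf.
pose g k (t : n.-tuple R) : n.-tuple int := [tuple Num.floor (tnth t i * k.+1%:R) | i < n].
pose h k (z : n.-tuple int) : 'cV[R]_n := \col_i ((tnth z i)%:~R / k.+1%:R).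
have mg k (A : set (n.-tuple int)) : measurable (g k @^-1` A).
  rewrite (_ : g k @^-1` A = \bigcup_(z : n.-tuple int) (if z \in A then g k @^-1` [set z] else set0)); last first.
    apply/seteqP; split => t /=.
      by move=> Agt; exists (g k t) => //; rewrite mem_set.
    by move=> [z _]; case: ifPn => // /set_mem Az /= ->.
  apply: countable_bigcupT_measurable => [|z]; first exact: countableP.
  case: ifPn => // _.
  rewrite (_ : g k @^-1` _ = \bigcap_i [set t : n.-tuple R | `[(tnth z i)%:~R / k.+1%:R, (tnth z i + 1)%:~R / k.+1%:R[%classic (tnth t i)]).
    apply: fin_bigcap_measurable => // i _.
    by rewrite -[X in measurable X]setTI; apply: measurable_tnth.
  have E (t : n.-tuple R) i : (`[(tnth z i)%:~R / k.+1%:R, (tnth z i + 1)%:~R / k.+1%:R[%classic (tnth t i) : Prop) <-> Num.floor (tnth t i * k.+1%:R) = tnth z i.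
    rewrite /= in_itv/= ler_pdivrMr ?ltr0n// ltr_pdivlMr ?ltr0n//.
    split; first exact: floor_def.
    by move=> <-; exact: floor_itv.
  apply/seteqP; split => t /=.
    by move=> gz i _; apply/E; rewrite -gz tnth_mktuple.
  by move=> tz; apply: eq_from_tnth => i; rewrite tnth_mktuple; apply/E/tz.
apply: (@measurable_fun_cvg _ _ _ _ (fun k => f \o h k \o g k)).
  by move=> k _ Y mY; rewrite setTI comp_preimage; exact: mg.
move=> t _ /=; apply: (@cvg_comp _ _ _ (fun k => h k (g k t)) f _ (nbhs (vec t))); last exact: cf.
apply: cvg_cV => i; rewrite mxE.
under eq_fun do rewrite mxE tnth_mktuple.
apply/cvgrPdist_le => e e0.
have [N _ HN] : \forall k \near \oo, k.+1%:R^-1 < e :> R.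
  exact: (near_infty_natSinv_lt (PosNum e0)).
exists N => // k /HN/ltW; apply: le_trans.
have k0 : 0 < k.+1%:R :> R by rewrite ltr0n.
have /andP[f1 f2] := floor_itv (tnth t i * k.+1%:R).
rewrite ger0_norm; last by rewrite subr_ge0 ler_pdivrMr.
rewrite lerBlDr -[X in X + _]mul1r -mulrDl ler_pdivlMr// addrC.
by move: f2; rewrite intrD => /ltW.
Qed.

End ColumnVectors.

(** * Derivatives and continuity *)

(** Both sides have literally the same difference quotient; this is the passage from directional
    derivatives to functions of one real variable. *)
Lemma is_derive_lineP (R : realType) (V : normedModType R) (f : V -> R) (x v : V) (a df : R) :
  is_derive (a *: v + x) v f df <-> is_derive a 1 (fun h => f (h *: v + x)) df.
Proof.
have E : (fun h : R => h^-1 *: ((f \o shift (a *: v + x)) (h *: v) - f (a *: v + x))) =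
         (fun h : R => h^-1 *: (((fun h => f (h *: v + x)) \o shift a) (h *: (1 : R)) - f (a *: v + x))).
  apply/funext => h /=; congr (_ *: (f _ - _)).
  by rewrite addrA -scalerDl [h *: 1]mulr1.
split => -[df1 df2]; split.
- by move: df1; rewrite /derivable E.
- by move: df2; rewrite /derive E.
- by move: df1; rewrite /derivable E.
- by move: df2; rewrite /derive E.
Qed.

Section PointwiseDerive.
Variables (R : realType) (V : normedModType R).
Implicit Types (f g : V -> R) (x v : V).

Lemma is_derive_add f g x v (df dg : R) : is_derive x v f df -> is_derive x v g dg ->
  is_derive x v (fun y => f y + g y) (df + dg).
Proof. by move=> f' g'; exact: is_deriveD. Qed.

Lemma is_derive_opp f x v (df : R) : is_derive x v f df -> is_derive x v (fun y => - f y) (- df).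
Proof. by move=> f'; exact: is_deriveN. Qed.

Lemma is_derive_mul f g x v (df dg : R) : is_derive x v f df -> is_derive x v g dg ->
  is_derive x v (fun y => f y * g y) (df * g x + f x * dg).
Proof.
move=> f' g'; have := is_deriveM f' g'.
by move=> /is_derive_eq; apply; rewrite addrC [X in X + _]mulrC.
Qed.

Lemma is_derive_cstr (c : R) x v : is_derive x v (fun _ => c) 0.
Proof. exact: is_derive_cst. Qed.

Lemma is_derive_scale (c : R) f x v (df : R) : is_derive x v f df ->
  is_derive x v (fun y => c * f y) (c * df).
Proof. by move=> f'; exact: is_deriveZ. Qed.

Lemma is_derive_pow n f x v (df : R) : is_derive x v f df ->
  is_derive x v (fun y => f y ^+ n) (n%:R * f x ^+ n.-1 * df).
Proof.
move=> f'; rewrite (_ : (fun y => _) = f ^+ n); first exact: is_deriveX.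
apply/funext => y; elim: n => [|n IH]; first by rewrite !expr0.
by rewrite !exprS [RHS]/GRing.mul/= IH.
Qed.

Lemma is_derive_bigsum (I : finType) (f : I -> V -> R) x v (df : I -> R) :
  (forall i, is_derive x v (f i) (df i)) ->
  is_derive x v (fun y => \sum_i f i y) (\sum_i df i).
Proof.
move=> f'; rewrite (_ : (fun y => _) = \sum_i f i); last by apply/funext => y; rewrite fct_sumE.
by elim/big_ind2 : _ => // [|g dg h dh]; [exact: is_derive_cst|exact: is_deriveD].
Qed.

Lemma is_derive_inv f x v (df : R) : f x != 0 -> is_derive x v f df ->
  is_derive x v (fun y => (f y)^-1) (- df / f x ^+ 2).
Proof.
move=> fx0 f'.
apply/DeriveDef.
  by apply: derivableV => //; exact: ex_derive.
by rewrite deriveV// ?derive_val /GRing.scale/= mulrC mulrN mulNr.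
Qed.

(** Restriction to the line through [x] along [v] reduces this to the chain rule in one variable,
    with [f] derivable only in the direction [v]. *)
Lemma is_derive_comp1 (h : R -> R) f x v (dh df : R) : is_derive (f x) 1 h dh -> is_derive x v f df ->
  is_derive x v (fun y => h (f y)) (dh * df).
Proof.
move=> h' f'.
have x0 : 0 *: v + x = x by rewrite scale0r add0r.
have f0 : is_derive (0 : R) 1 (fun a => f (a *: v + x)) df.
  by apply: (is_derive_lineP f x v 0 df).1; rewrite x0.
have h0 : is_derive (f (0 *: v + x)) 1 h dh by rewrite x0.
have := (is_derive_lineP (fun y => h (f y)) x v 0 (dh * df)).2 (is_derive1_comp h0 f0).
by rewrite x0.
Qed.

Lemma is_derive_cont1 (f : R -> R) (df : R -> R) : (forall x : R, is_derive x 1 f (df x)) -> continuous f.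
Proof.
move=> f' x; apply: differentiable_continuous; apply/derivable1_diffP.
by have [] := f' x.
Qed.

End PointwiseDerive.

Section ContinuousOps.
Variables (R : realType) (T : topologicalType).
Implicit Types f g : T -> R.

Lemma contM f g : continuous f -> continuous g -> continuous (fun x => f x * g x).
Proof. by move=> cf cg x; apply: cvgM; [exact: cf|exact: cg]. Qed.

Lemma contD f g : continuous f -> continuous g -> continuous (fun x => f x + g x).
Proof. by move=> cf cg x; apply: cvgD; [exact: cf|exact: cg]. Qed.

Lemma contN f : continuous f -> continuous (fun x => - f x).
Proof. by move=> cf x; apply: cvgN; exact: cf. Qed.

Lemma contB f g : continuous f -> continuous g -> continuous (fun x => f x - g x).
Proof. by move=> cf cg; exact: contD (contN cg). Qed.

Lemma cont_sum (I : finType) (f : I -> T -> R) : (forall i, continuous (f i)) ->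
  continuous (fun x => \sum_i f i x).
Proof. by move=> cf; apply: continuous_big => [|i _]; [exact: add_continuous|exact: cf]. Qed.

Lemma cont_cst (c : R) : continuous (fun _ : T => c).
Proof. by move=> x; exact: cvg_cst. Qed.

Lemma contX f k : continuous f -> continuous (fun x => f x ^+ k).
Proof.
move=> cf; elim: k => [|k IH]; first exact: cont_cst.
by under eq_fun do rewrite exprS; exact: contM.
Qed.

Lemma cont_norm f : continuous f -> continuous (fun x => `|f x|).
Proof. by move=> cf x; apply: cvg_norm; exact: cf. Qed.

Lemma cont_comp (h : R -> R) f : continuous h -> continuous f -> continuous (fun x => h (f x)).
Proof. by move=> ch cf x; apply: continuous_comp; [exact: cf|exact: ch]. Qed.

End ContinuousOps.

Lemma cont_comp2 (T U : topologicalType) (V : topologicalType) (f : U -> V) (g : T -> U) :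
  continuous g -> continuous f -> continuous (fun x => f (g x)).
Proof. by move=> cg cf x; apply: continuous_comp; [exact: cg|exact: cf]. Qed.

Lemma cont_cV (R : realType) (T : topologicalType) n (f : T -> 'cV[R]_n) :
  (forall i, continuous (fun x => f x i 0)) -> continuous f.
Proof. by move=> cf x; apply: (@cvg_cV _ _ (nbhs x)) => i; exact: cf. Qed.

Lemma cont_coord (R : realType) n (i : 'I_n) : continuous (fun x : 'cV[R]_n => x i 0).
Proof. exact: coord_continuous. Qed.

(** * Continuous functions with support in a box, and test functions *)

Section CompactSupport.
Variables (R : realType).

(** Supports are measured by coordinates, so that freezing some coordinates of a function preserves
    the condition inside iterated integrals. *)
Definition vanishes_outside n (f : 'cV[R]_n -> R) (r : R) := forall (x : 'cV[R]_n) i, r < `|x i 0| -> f x = 0.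

Definition Cc n (f : 'cV[R]_n -> R) := continuous f /\ exists r, vanishes_outside f r.

Lemma cV_box_compact n (r : R) : compact [set x : 'cV[R]_n | forall i, `|x i 0| <= r].
Proof.
rewrite (_ : [set _ | _] = trmx @` [set v : 'rV[R]_n | forall i, v ord0 i \in `[- r, r]]); last first.
  apply/seteqP; split => x /=.
    by move=> xr; exists (x^T); [move=> i; rewrite in_itv/= mxE -ler_norml ord1 | rewrite trmxK].
  by move=> [v vr <-] i; have := vr i; rewrite in_itv/= mxE -ler_norml ord1.
apply: continuous_compact.
  apply: continuous_subspaceT => x; apply: (@cvg_cV _ _ (nbhs x)) => i.
  by under eq_fun do rewrite mxE; rewrite mxE; exact: coord_continuous.
apply: (@rV_compact _  _ (fun=> `[- r, r]%classic)) => _; exact: segment_compact.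
Qed.

Lemma continuous_bounded_box n (f : 'cV[R]_n -> R) (r : R) : continuous f ->
  exists2 C, 0 <= C & forall x : 'cV[R]_n, (forall i, `|x i 0| <= r) -> `|f x| <= C.
Proof.
move=> cf; have /compact_bounded[M [_ HM]] :
    compact (f @` [set x : 'cV[R]_n | forall i, `|x i 0| <= r]).
  by apply: continuous_compact (@cV_box_compact n r); exact: continuous_subspaceT.
exists (`|M| + 1) => [|x xr]; first by rewrite addr_ge0.
by apply: HM; [rewrite ltr_pwDr// ler_norm|exists x].
Qed.

Lemma Cc_bounded n (f : 'cV[R]_n -> R) : Cc f -> exists2 C, 0 <= C & forall x, `|f x| <= C.
Proof.
move=> [cf [r fr]]; have [C C0 fC] := continuous_bounded_box r cf.
exists C => // x; have [/fC//|/existsNP[i /negP]] := pselect (forall i, `|x i 0| <= r).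
by rewrite -ltNge => /fr ->; rewrite normr0.
Qed.

Definition tbox n (r : R) : set (n.-tuple R) := [set t | forall i, `[- r, r]%classic (tnth t i)].

Lemma measurable_tbox n r : measurable (@tbox n r).
Proof.
rewrite (_ : tbox r = \bigcap_i [set t : n.-tuple R | `[- r, r]%classic (tnth t i)]).
  apply: fin_bigcap_measurable => // i _.
  by rewrite -[X in measurable X]setTI; apply: measurable_tnth.
by apply/seteqP; split => [t Bt i _|t Bt i] /=; [exact: Bt|exact: (Bt i I)].
Qed.

Lemma tbox_lty n r : (lebesgueRn R n (@tbox n r) < +oo)%E.
Proof.
rewrite -ge0_fin_numE//; rewrite /tbox (lebesgueRn_box (A := fun=> `[- r, r]%classic))//.
elim/big_ind : _ => //[x y|i _]; first exact: fin_numM.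
by rewrite lebesgue_measure_itv/=; case: ifP.
Qed.

Lemma Cc_integrable n (f : 'cV[R]_n -> R) : Cc f ->
  (lebesgueRn R n).-integrable setT (fun t => (f (vec t))%:E).
Proof.
move=> cf; have [C C0 fC] := Cc_bounded cf; have [r fr] := cf.2.
apply: (@le_integrable _ _ _ _ _ measurableT _ (fun t => (C * \1_(tbox r) t)%:E)).
- by apply/measurable_EFinP; apply: continuous_measurable_vec cf.1.
- move=> t _; rewrite lee_fin normrM (ger0_norm C0) indicE.
  have [tr|/existsNP[i /negP]] := pselect (tbox r t).
    by rewrite mem_set//= normr1 mulr1.
  rewrite in_itv/= -ler_norml -ltNge => ir.
  by rewrite (fr _ i) ?normr0 ?mulr_ge0// mxE.
- under eq_fun do rewrite EFinM; apply: integrableZl => //.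
  apply/integrableP; split.
    by apply/measurable_EFinP; apply: measurable_indic; exact: measurable_tbox.
  under eq_integral do rewrite /= ger0_norm//.
  by rewrite integral_indic ?setIT; [exact: tbox_lty|exact: measurableT|exact: measurable_tbox].
Qed.

Lemma CcMl n (f g : 'cV[R]_n -> R) : continuous g -> Cc f -> Cc (fun x => g x * f x).
Proof.
move=> cg [cf [r fr]]; split; first exact: contM.
by exists r => x i /fr ->; rewrite mulr0.
Qed.

Lemma CcD n (f g : 'cV[R]_n -> R) : Cc f -> Cc g -> Cc (fun x => f x + g x).
Proof.
move=> [cf [r fr]] [cg [s gs]]; split; first exact: contD.
exists (Num.max r s) => x i; rewrite gt_max => /andP[/fr -> /gs ->].
by rewrite addr0.
Qed.

Lemma Cc_sum n (I : finType) (f : I -> 'cV[R]_n -> R) : (forall i, Cc (f i)) -> Cc (fun x => \sum_i f i x).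
Proof.
move=> cf; rewrite (_ : (fun x => _) = \sum_i f i); last by apply/funext => x; rewrite fct_sumE.
elim/big_ind : _ => //; last by move=> g h; exact: CcD.
by split; [exact: cst_continuous|exists 0].
Qed.

(** The condition [r < |x_i|] is open, so [f] is identically 0 near such an [x]. *)
Lemma partial_vanishes n (f : 'cV[R]_n -> R) r j : vanishes_outside f r -> vanishes_outside (partial j f) r.
Proof.
move=> fr x i xr; rewrite /partial (_ : 'D_(delta_mx j 0) f x = 'D_(delta_mx j 0) (cst 0) x).
  exact: derive_cst.
apply: near_eq_derive.
have H : \forall y \near x, r < `|(y : 'cV[R]_n) i 0|.
  exact: (cvgr_gt _ (@cont_norm _ _ _ (@coord_continuous R n 1 i 0) x) _ xr).
by near=> y; apply: (fr y i); near: y.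
Unshelve. all: by end_near. Qed.

Lemma partials_vanishes n (f : 'cV[R]_n -> R) r s : vanishes_outside f r -> vanishes_outside (partials s f) r.
Proof. by move=> fr; elim: s => //= j s; exact: partial_vanishes. Qed.

Lemma compact_box n (K : set 'cV[R]_n) : compact K -> exists r, K `<=` [set x : 'cV[R]_n | forall i, `|x i 0| <= r].
Proof.
move=> /compact_bounded[M [_ HM]]; exists (`|M| + 1) => x Kx i.
apply: le_trans (ler_coord_norm x i) _.
by apply: HM => //; rewrite ltr_pwDr// ler_norm.
Qed.

Lemma test_function_vanishes n (f : 'cV[R]_n -> R) : test_function f -> exists r, vanishes_outside f r.
Proof.
move=> [_ [K /compact_box[r Kr] f0]]; exists r => x i; rewrite ltNge => /negP xi.
by apply: f0 => /Kr /(_ i).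
Qed.

Lemma test_function_Cc n (f : 'cV[R]_n -> R) s : test_function f -> Cc (partials s f).
Proof.
move=> tf; have [r fr] := test_function_vanishes tf; split.
  by apply: (tf.1 (size s)).2.
by exists r; exact: partials_vanishes.
Qed.

Lemma test_function_is_derive n (f : 'cV[R]_n -> R) x j : test_function f ->
  is_derive x (delta_mx j 0) f (partial j f x).
Proof. by move=> tf; apply: derivableP; exact: ((tf.1 1%N).1 [::]). Qed.

End CompactSupport.

(** * Integration on R^n *)

Section IteratedIntegral.
Variable R : realType.
Local Notation leb := (@lebesgue_measure R).

Lemma measurable_comp_cons n (f : n.+1.-tuple R -> \bar R) : measurable_fun setT f ->
  measurable_fun setT (f \o @cons_pair R n).
Proof. by move=> mf; apply: measurableT_comp => //; exact: measurable_cons_pair. Qed.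

(** The measure in dimension [n + 1] is by construction the image of a product measure under
    [cons_pair]: a change of variables followed by Tonelli. *)
Lemma ge0_integral_lebesgueRnS n (f : n.+1.-tuple R -> \bar R) :
  measurable_fun setT f -> (forall t, 0 <= f t)%E ->
  (\int[lebesgueRn R n.+1]_t f t =
   \int[lebesgueRn R n]_t \int[leb]_x f (cons_pair (x, t)))%E.
Proof.
move=> mf f0; have mfc := measurable_comp_cons mf.
transitivity (\int[leb \x lebesgueRn R n]_p (f \o @cons_pair R n) p)%E.
  rewrite -[in RHS](preimage_setT (@cons_pair R n)).
  by rewrite -ge0_integral_pushforward//; exact: measurable_cons_pair.
by rewrite fubini_tonelli2//= => p; exact: f0.
Qed.

Lemma ge0_integral_lebesgueRnS' n (f : n.+1.-tuple R -> \bar R) :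
  measurable_fun setT f -> (forall t, 0 <= f t)%E ->
  (\int[lebesgueRn R n.+1]_t f t =
   \int[leb]_x \int[lebesgueRn R n]_t f (cons_pair (x, t)))%E.
Proof.
move=> mf f0; have mfc := measurable_comp_cons mf.
rewrite ge0_integral_lebesgueRnS//.
have := @fubini_tonelli _ _ _ _ _ leb (lebesgueRn R n) _ mfc (fun p => f0 _).
by move=> /= ->.
Qed.

Lemma integrable_lebesgueRnS n (f : n.+1.-tuple R -> \bar R) :
  (lebesgueRn R n.+1).-integrable setT f ->
  (leb \x lebesgueRn R n)%E.-integrable setT (f \o @cons_pair R n).
Proof.
move=> /integrableP[mf foo]; apply/integrableP; split; first exact: measurable_comp_cons.
suff <- : (\int[lebesgueRn R n.+1]_t `|f t| = \int[leb \x lebesgueRn R n]_p ((abse \o f) \o @cons_pair R n) p)%E by [].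
rewrite -[in RHS](preimage_setT (@cons_pair R n)).
rewrite -ge0_integral_pushforward//; [exact: measurable_cons_pair|exact: measurableT_comp|].
by move=> ? _; exact: abse_ge0.
Qed.

Lemma integral_lebesgueRnS n (f : n.+1.-tuple R -> \bar R) :
  (lebesgueRn R n.+1).-integrable setT f ->
  (\int[lebesgueRn R n.+1]_t f t =
   \int[lebesgueRn R n]_t \int[leb]_x f (cons_pair (x, t)))%E.
Proof.
move=> intf; have /= intfc := integrable_lebesgueRnS intf.
transitivity (\int[leb \x lebesgueRn R n]_p (f \o @cons_pair R n) p)%E.
  rewrite -[in RHS](preimage_setT (@cons_pair R n)).
  rewrite -[LHS]/(\int[pushforward (leb \x lebesgueRn R n)%E (@cons_pair R n)]_t f t)%E.
  rewrite integral_pushforward//; [exact: measurable_cons_pair|exact: measurable_int intf].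
by rewrite -integral21_prod_meas1.
Qed.

Lemma integral_lebesgueRnS' n (f : n.+1.-tuple R -> \bar R) :
  (lebesgueRn R n.+1).-integrable setT f ->
  (\int[lebesgueRn R n.+1]_t f t =
   \int[leb]_x \int[lebesgueRn R n]_t f (cons_pair (x, t)))%E.
Proof.
move=> intf; have /= intfc := integrable_lebesgueRnS intf.
rewrite integral_lebesgueRnS//.
have := @integral21_prod_meas1 _ _ _ _ _ leb (lebesgueRn R n) _ intfc.
have := @integral12_prod_meas1 _ _ _ _ _ leb (lebesgueRn R n) _ intfc.
by rewrite /fubini_F /fubini_G/= => -> ->.
Qed.

End IteratedIntegral.

(** * The integral of a derivative with compact support *)

Section IntegrationByParts.
Variable R : realType.
Local Notation leb := (@lebesgue_measure R).

Lemma cV_cons_line n (h a : R) (v : 'cV[R]_n) :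
  h *: delta_mx ord0 0 + cV_cons a v = cV_cons (h + a) v.
Proof.
apply/matrixP => i j; rewrite ord1 !mxE eqxx andbT.
case: (unliftP ord0 i) => [k ->|->]; first by rewrite mulr0 add0r.
by rewrite eqxx mulr1.
Qed.

Lemma cV_cons_lift n (h a : R) (v : 'cV[R]_n) j :
  h *: delta_mx (lift ord0 j) 0 + cV_cons a v = cV_cons a (h *: delta_mx j 0 + v).
Proof.
apply/matrixP => i k; rewrite ord1 !mxE eqxx andbT.
case: (unliftP ord0 i) => [l ->|->]; last by rewrite mulr0 add0r.
by rewrite (inj_eq lift_inj) !mxE eqxx andbT.
Qed.

Lemma integral_derive1_eq0 (g dg : R -> R) (r : R) : continuous dg ->
  (forall a : R, is_derive a 1 g (dg a)) -> (forall a, r < `|a| -> g a = 0) ->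
  (forall a, r < `|a| -> dg a = 0) -> (\int[leb]_a (dg a)%:E = 0)%E.
Proof.
move=> cdg g' g0 dg0.
have cg : continuous g.
  by move=> a; apply: differentiable_continuous; apply/derivable1_diffP; exact: ex_derive.
(* [s] lies strictly beyond [r], so that [g] vanishes at the endpoints [- s] and [s] themselves. *)
pose s : R := `|r| + 1.
have rs (a : R) : s <= `|a| -> r < `|a|.
  by apply: lt_le_trans; rewrite ltr_pwDr// ler_norm.
have s0 : 0 < s by rewrite ltr_pwDr.
transitivity (\int[leb]_(a in `[(- s)%R, s]) (dg a)%:E)%E.
  rewrite [RHS]integral_mkcond; apply: eq_integral => a _; rewrite patchE.
  case: ifPn => //; rewrite notin_setE/= in_itv/= -ler_norml => /negP.
  by rewrite -ltNge => /ltW/rs/dg0 ->.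
rewrite (@continuous_FTC2 _ dg g).
- have -> : g s = 0 by apply/g0/rs; rewrite ger0_norm// ltW.
  have -> : g (- s) = 0 by apply/g0/rs; rewrite normrN ger0_norm// ltW.
  by rewrite subee.
- by rewrite (lt_trans _ s0)// oppr_lt0.
- exact: continuous_subspaceT.
- split; first by move=> x _; exact: ex_derive.
  + exact/cvg_at_right_filter/cg.
  + exact/cvg_at_left_filter/cg.
- by move=> x _; rewrite derive1E; exact: derive_val.
Qed.

(** The order of integration is chosen so that the direction [j] belongs to the inner integral,
    which is then 0: by the fundamental theorem of calculus if [j] is the first coordinate, by
    induction on the dimension otherwise. *)
Lemma integral_partial_eq0 n j (g dg : 'cV[R]_n -> R) : Cc g -> Cc dg ->
  (forall x, is_derive x (delta_mx j 0) g (dg x)) ->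
  (\int[lebesgueRn R n]_t (dg (vec t))%:E = 0)%E.
Proof.
elim: n j g dg => [[]//|n IH] j g dg [cg [r gr]] Cdg g'.
have [cdg [s ds]] := Cdg.
case: (unliftP ord0 j) => [k jE|jE]; subst j.
- rewrite integral_lebesgueRnS'; last exact: Cc_integrable.
  apply: integral0_eq => a _.
  under eq_integral do rewrite vec_cons_pair/=.
  apply: (IH k (fun v => g (cV_cons a v)) (fun v => dg (cV_cons a v))).
  + split; first by move=> v; apply: continuous_comp; [exact: cV_cons_continuous2|exact: cg].
    by exists r => v i vi; apply: (gr _ (lift ord0 i)); rewrite cV_consS.
  + split; first by move=> v; apply: continuous_comp; [exact: cV_cons_continuous2|exact: cdg].
    by exists s => v i vi; apply: (ds _ (lift ord0 i)); rewrite cV_consS.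
  + move=> v; rewrite -[X in is_derive X](add0r v) -(scale0r (delta_mx k 0)).
    apply/is_derive_lineP; under eq_fun do rewrite -cV_cons_lift.
    apply/(is_derive_lineP g (cV_cons a v) (delta_mx (lift ord0 k) 0) 0).
    by rewrite scale0r add0r; exact: g'.
- rewrite integral_lebesgueRnS; last exact: Cc_integrable.
  apply: integral0_eq => t _.
  under eq_integral do rewrite vec_cons_pair/=.
  apply: (@integral_derive1_eq0 (fun a => g (cV_cons a (vec t))) (fun a => dg (cV_cons a (vec t))) (Num.max r s)).
  + by move=> a; apply: continuous_comp; [exact: cV_cons_continuous1|exact: cdg].
  + move=> a; have /is_derive_lineP := g' (a *: delta_mx ord0 0 + cV_cons 0 (vec t)).
    rewrite cV_cons_line addr0 (_ : (fun h => _) = (fun a => g (cV_cons a (vec t))))//.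
    by apply/funext => h; rewrite cV_cons_line addr0.
  + by move=> a; rewrite gt_max => /andP[ra _]; apply: (gr _ ord0); rewrite cV_cons0.
  + by move=> a; rewrite gt_max => /andP[_ ra]; apply: (ds _ ord0); rewrite cV_cons0.
Qed.

End IntegrationByParts.

(** * Change of variables under dilations *)

Section Dilation.
Variable R : realType.
Local Notation leb := (@lebesgue_measure R).

Lemma lebesgue_dilation (g : R -> R) (c : R) : 0 < c -> continuous g -> (forall x, 0 <= g x) ->
  (\int[leb]_x (g x)%:E = c%:E * \int[leb]_x (g (c * x)%R)%:E)%E.
Proof.
move=> c0 cg g0.
have dF (x : R) : is_derive x 1 (fun x : R => c * x) c.
  by have := is_deriveZ c (is_derive_id x (1:R)); move=> /is_derive_eq; apply; rewrite [LHS]mulr1.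
have dFE : (fun x : R => c * x)^`()%classic = cst c.
  by apply/funext => x; rewrite derive1E; exact: derive_val.
rewrite (@increasing_ge0_integration_by_substitutionT _ (fun x => c * x) g)//.
- rewrite -ge0_integralZl_EFin//; last 3 first.
  + by move=> x _; rewrite lee_fin.
  + apply/measurable_EFinP; apply: continuous_measurable_fun; apply: (@cont_comp _ _ g (fun x : R => c * x)) => //.
    by apply: contM; [exact: cont_cst|move=> x; exact: cvg_id].
  + exact: ltW.
  by apply: eq_integral => x _; rewrite dFE /= -EFinM mulrC.
- by move=> x y xy; rewrite ltr_pM2l.
- by rewrite dFE; exact: cont_cst.
- by rewrite dFE; exact: is_cvg_cst.
- by rewrite dFE; exact: is_cvg_cst.
- by apply: gt0_cvgMrNy => //; exact: cvg_id.
- by apply: gt0_cvgMry => //; exact: cvg_id.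
Qed.

Lemma cV_cons_scale n (c a : R) (v : 'cV[R]_n) : c *: cV_cons a v = cV_cons (c * a) (c *: v).
Proof.
by apply/matrixP => i j; rewrite !mxE; case: (unlift ord0 i) => [k|]; rewrite ?mxE.
Qed.

Lemma continuous_scale n (c : R) : continuous (fun v : 'cV[R]_n => c *: v).
Proof. by move=> v; exact: scaler_continuous. Qed.

Lemma measurable_vec_EFin n (f : 'cV[R]_n -> R) : continuous f ->
  measurable_fun setT (fun t => (f (vec t))%:E).
Proof. by move=> cf; apply/measurable_EFinP; exact: continuous_measurable_vec. Qed.

Lemma ge0_integral_vecS n (f : 'cV[R]_n.+1 -> R) : continuous f -> (forall x, 0 <= f x) ->
  (\int[lebesgueRn R n.+1]_t (f (vec t))%:E =
   \int[lebesgueRn R n]_t \int[leb]_x (f (cV_cons x (vec t)))%:E)%E.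
Proof.
move=> cf f0; rewrite ge0_integral_lebesgueRnS//; [|exact: measurable_vec_EFin|].
- by apply: eq_integral => t _; apply: eq_integral => x _; rewrite vec_cons_pair.
- by move=> t; rewrite lee_fin.
Qed.

Lemma ge0_integral_vecS' n (f : 'cV[R]_n.+1 -> R) : continuous f -> (forall x, 0 <= f x) ->
  (\int[lebesgueRn R n.+1]_t (f (vec t))%:E =
   \int[leb]_x \int[lebesgueRn R n]_t (f (cV_cons x (vec t)))%:E)%E.
Proof.
move=> cf f0; rewrite ge0_integral_lebesgueRnS'//; [|exact: measurable_vec_EFin|].
- by apply: eq_integral => t _; apply: eq_integral => x _; rewrite vec_cons_pair.
- by move=> t; rewrite lee_fin.
Qed.

Lemma measurable_integral_vecS n (f : 'cV[R]_n.+1 -> R) : continuous f -> (forall x, 0 <= f x) ->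
  measurable_fun setT (fun t : n.-tuple R => \int[leb]_x (f (cV_cons x (vec t)))%:E)%E.
Proof.
move=> cf f0; have mF := measurable_comp_cons (measurable_vec_EFin cf).
rewrite (_ : (fun t => _) = fubini_G leb ((fun t => (f (vec t))%:E) \o @cons_pair R n)).
  by apply: measurable_fun_fubini_tonelli_G => [|p]; [exact: mF|rewrite lee_fin].
by apply/funext => t; apply: eq_integral => x _; rewrite /= vec_cons_pair.
Qed.

Lemma measurable_integral_vecS' n (f : 'cV[R]_n.+1 -> R) : continuous f -> (forall x, 0 <= f x) ->
  measurable_fun setT (fun x : R => \int[lebesgueRn R n]_t (f (cV_cons x (vec t)))%:E)%E.
Proof.
move=> cf f0; have mF := measurable_comp_cons (measurable_vec_EFin cf).
rewrite (_ : (fun t => _) = fubini_F (lebesgueRn R n) ((fun t => (f (vec t))%:E) \o @cons_pair R n)).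
  by apply: measurable_fun_fubini_tonelli_F => [|p]; [exact: mF|rewrite lee_fin].
by apply/funext => x; apply: eq_integral => t _; rewrite /= vec_cons_pair.
Qed.

(** The first coordinate is dilated alone, which yields [F]; the order of integration is then
    exchanged so that the induction hypothesis dilates the others at a fixed first coordinate. *)
Lemma ge0_integral_dilation n (f : 'cV[R]_n -> R) (c : R) : 0 < c -> continuous f -> (forall x, 0 <= f x) ->
  (\int[lebesgueRn R n]_t (f (vec t))%:E =
   (c ^+ n)%:E * \int[lebesgueRn R n]_t (f (c *: vec t))%:E)%E.
Proof.
move=> c0; elim: n f => [|n IH] f cf f0.
  rewrite expr0 mul1e; apply: eq_integral => t _; congr (f _)%:E.
  by apply/matrixP => -[].
pose F (v : 'cV[R]_n.+1) := f (cV_cons (c * v ord0 0) (\col_i v (lift ord0 i) 0)).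
have FE a (v : 'cV[R]_n) : F (cV_cons a v) = f (cV_cons (c * a) v).
  rewrite /F cV_cons0; congr (f (cV_cons _ _)); apply/matrixP => i j.
  by rewrite ord1 mxE cV_consS.
have cF : continuous F.
  apply: (cont_comp2 _ cf); apply: cont_cV => i; case: (unliftP ord0 i) => [k ->|->].
    by under eq_fun do rewrite cV_consS mxE; exact: cont_coord.
  by under eq_fun do rewrite cV_cons0; apply: contM; [exact: cont_cst|exact: cont_coord].
have F0 v : 0 <= F v by exact: f0.
have E1 : (\int[lebesgueRn R n.+1]_t (f (vec t))%:E = c%:E * \int[lebesgueRn R n.+1]_t (F (vec t))%:E)%E.
  rewrite !ge0_integral_vecS// -ge0_integralZl_EFin//; last 3 first.
  - by move=> t _; apply: integral_ge0 => x _; rewrite lee_fin.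
  - exact: measurable_integral_vecS.
  - exact: ltW.
  apply: eq_integral => t _.
  rewrite (@lebesgue_dilation (fun x => f (cV_cons x (vec t))) c)//.
    by congr (_ * _)%E; apply: eq_integral => x _; rewrite FE.
  exact: cont_comp2 (@cV_cons_continuous1 _ _ _) cf.
rewrite E1 exprS EFinM -muleA; congr (_ * _)%E.
have cf' : continuous (fun v : 'cV[R]_n.+1 => f (c *: v)) by exact: cont_comp2 (@continuous_scale _ _) cf.
rewrite (ge0_integral_vecS' cF F0) (ge0_integral_vecS' cf' (fun v => f0 _)) -ge0_integralZl_EFin//; last 3 first.
- by move=> x _; apply: integral_ge0 => t _; rewrite lee_fin.
- exact: (measurable_integral_vecS' cf').
- by rewrite exprn_ge0// ltW.
apply: eq_integral => x _; under eq_integral do rewrite FE.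
rewrite (IH (fun v => f (cV_cons (c * x) v)))//.
  by congr (_ * _)%E; apply: eq_integral => t _; rewrite cV_cons_scale.
exact: cont_comp2 (@cV_cons_continuous2 _ _ _) cf.
Qed.

End Dilation.

(** * An integrable majorant *)

Section Weight.
Variable R : realType.
Local Notation leb := (@lebesgue_measure R).

(** A product of the densities [1 / (1 + x_i ^ 2)]: its integral factors into one-variable integrals
    given by the arctangent, and it decays only polynomially, so every exponentially decaying
    function lies below a multiple of it. *)
Definition weight n (x : 'cV[R]_n) : R := \prod_i (oneDsqr (x i 0))^-1.

Lemma weight_gt0 n (x : 'cV[R]_n) : 0 < weight x.
Proof. by apply: prodr_gt0 => i _; rewrite invr_gt0 (lt_le_trans ltr01)// oneDsqr_ge1. Qed.

Lemma weight_continuous n : continuous (@weight n).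
Proof.
apply: continuous_big => [|i _]; first exact: mul_continuous.
exact: cont_comp2 (@cont_coord _ _ _) (@continuous_oneDsqrV R).
Qed.

Lemma integral_oneDsqrV_lty : (\int[leb]_x ((oneDsqr x)^-1)%:E < +oo)%E.
Proof.
have c1 := @continuous_oneDsqrV R.
rewrite ge0_symfun_integralT//; last by move=> x; rewrite /oneDsqr/= sqrrN.
rewrite (_ : [set x | _] = `[0, +oo[%classic); last first.
  by apply/seteqP; split => x /=; rewrite in_itv/= andbT.
rewrite (@ge0_continuous_FTC2y _ _ atan 0 (pi / 2))//.
- by rewrite -EFinB -EFinM ltry.
- exact: continuous_subspaceT.
- exact: cvgy_atan.
- by apply: cvg_at_right_filter; exact: continuous_atan.
- by move=> x _; rewrite derive1E; exact: derive_val.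
Qed.

Lemma weight_integrable n : (lebesgueRn R n).-integrable setT (fun t => (weight (vec t))%:E).
Proof.
have m n' := measurable_vec_EFin (@weight_continuous n').
have W0 n' x : 0 <= @weight n' x by exact: ltW (weight_gt0 _).
apply/integrableP; split; first exact: m.
under eq_integral do rewrite gee0_abs ?lee_fin//.
elim: n => [|n IH].
  rewrite [lebesgueRn R 0]/= integral_dirac; [|exact: measurableT|exact: m]. rewrite diracE mem_set// mul1e ltry. by [].
rewrite (ge0_integral_vecS (@weight_continuous _) (@W0 _)).
rewrite (eq_integral (fun t => (\int[leb]_x ((oneDsqr x)^-1)%:E * (weight (vec t))%:E)%E)); last first.
  move=> t _; rewrite muleC -ge0_integralZl//; last first.
  - by rewrite lee_fin.
  - by apply/measurable_EFinP; apply: continuous_measurable_fun; exact: continuous_oneDsqrV.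
  apply: eq_integral => x _; rewrite -EFinM; congr (_ %:E).
  rewrite /weight big_ord_recl cV_cons0 mulrC; congr (_ * _).
  by apply: eq_bigr => i _; rewrite cV_consS.
rewrite ge0_integralZl//; last first.
  by apply: integral_ge0 => x _; rewrite lee_fin.
- by move=> t _; rewrite lee_fin.
- exact: m.
apply: lte_mul_pinfty => //.
- by apply: integral_ge0 => x _; rewrite lee_fin.
- rewrite ge0_fin_numE; first exact: integral_oneDsqrV_lty.
  by apply: integral_ge0 => x _; rewrite lee_fin.
Qed.

End Weight.

(** * Test functions and the fundamental lemma *)

Section Bump.
Variable R : realType.

Lemma is_derive_quadratic (f : R -> R) C : (forall x, `|f x| <= C * x ^+ 2) -> is_derive (0 : R) 1 f 0.
Proof.
move=> fC; have f0 : f 0 = 0.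
  by apply/eqP; rewrite -normr_le0; have := fC 0; rewrite expr0n/= mulr0.
have H : h^-1 *: ((f \o shift 0) (h *: (1 : R)) - f 0) @[h --> 0^'] --> (0 : R).
  apply: norm_cvg0; apply: (@squeeze_cvgr _ _ _ _ (cst 0) (fun h => `|C| * `|h|)).
  - near=> h; rewrite f0 subr0 /= addr0 [h *: 1]mulr1 normr_ge0/= /GRing.scale/= normrM normfV.
    have h0 : h != 0 by near: h; exact: nbhs_dnbhs_neq.
    rewrite mulrC ler_pdivrMr ?normr_gt0// -mulrA -expr2 -normrX (ger0_norm (sqr_ge0 h)).
    by apply: le_trans (fC h) _; rewrite ler_wpM2r ?sqr_ge0 ?ler_norm.
  - exact: cvg_cst.
  - rewrite -[X in _ --> X](mulr0 `|C|) -[X in _ * X](normr0 R).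
    apply: cvgMr; apply: cvg_norm; exact: cvg_within.
by split; [exact: cvgP H|exact/cvg_lim].
Unshelve. all: by end_near. Qed.

(** [flat 0] is the classical smooth function [exp (- 1 / x)] extended by 0; the powers of [1 / x]
    make the family span a space closed under derivation. *)
Definition flat (k : nat) (x : R) : R := if 0 < x then x^-1 ^+ k * expR (- x^-1) else 0.

Lemma flat_ge0 k x : 0 <= flat k x.
Proof. by rewrite /flat; case: ifPn => // x0; rewrite mulr_ge0 ?expR_ge0// exprn_ge0// invr_ge0 ltW. Qed.

(** One term of the exponential series gives [exp (1 / x) >= x ^ -(k + 2) / (k + 2)!]; the two extra
    powers leave [x ^ 2], which yields the derivative 0 at the origin. *)
Lemma flat_quadratic k x : `|flat k x| <= k.+2`!%:R * x ^+ 2.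
Proof.
rewrite ger0_norm ?flat_ge0// /flat; case: ifPn => [x0|_]; last by rewrite mulr_ge0// sqr_ge0.
have xi0 : 0 <= x^-1 by rewrite invr_ge0 ltW.
have f0 : 0 < (k.+2)`!%:R :> R by rewrite ltr0n fact_gt0.
have := expR_ge1Dxn k.+1 xi0 => H.
have {}H : x^-1 ^+ k.+2 / k.+2`!%:R <= expR x^-1 by apply: le_trans H; rewrite lerDr.
have xn0 : x != 0 by rewrite gt_eqF.
rewrite expRN ler_pdivrMr ?expR_gt0//.
apply: (@le_trans _ _ (k.+2`!%:R * x ^+ 2 * (x^-1 ^+ k.+2 / k.+2`!%:R))).
  have -> : k.+2`!%:R * x ^+ 2 * (x^-1 ^+ k.+2 / k.+2`!%:R) =
    (k.+2`!%:R / k.+2`!%:R) * (x ^+2 * (x^-1 ^+ 2)) * x^-1 ^+ k.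
    by rewrite -addn2 exprD; ring.
  by rewrite divff ?gt_eqF// -exprMn divff// expr1n !mul1r.
by apply: ler_wpM2l H; rewrite mulr_ge0 ?sqr_ge0// ltW.
Qed.

Lemma is_derive_flat k (x : R) : is_derive x 1 (flat k) (- k%:R * flat k.+1 x + flat k.+2 x).
Proof.
have [x0|x0|->] := ltgtP x 0.
- rewrite /flat !(lt_gtF x0) mulr0 addr0.
  apply: (@near_eq_is_derive _ _ _ (cst 0)).
  near=> y; rewrite ltNge ltW//; near: y; exact: lt_nbhsl.
- rewrite /flat x0.
  apply: (@near_eq_is_derive _ _ _ (fun x : R => x^-1 ^+ k * expR (- x^-1))).
    near=> y; rewrite ifT//; near: y; exact: lt_nbhsr.
  have xn0 : x != 0 by rewrite gt_eqF.
  have dV : is_derive x 1 (fun x : R => x^-1) (- 1 / x ^+ 2).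
    exact: is_derive_inv (is_derive_id x 1).
  have dE : is_derive x 1 (fun x : R => expR (- x^-1)) (expR (- x^-1) * - (- 1 / x ^+ 2)).
    exact: is_derive_comp1 (is_derive_expR _) (is_derive_opp dV).
  have := is_derive_mul (is_derive_pow k dV) dE.
  move=> /is_derive_eq; apply.
  case: k => [|k]; first by rewrite !expr0; field.
  by rewrite /= !exprS; field.
- rewrite {2 3}/flat ltxx mulr0 addr0.
  exact: is_derive_quadratic (@flat_quadratic k).
Unshelve. all: by end_near. Qed.

Lemma flat_lt1 x : flat 0 x < 1.
Proof.
rewrite /flat; case: ifPn => // x0.
by rewrite expr0 mul1r -[ltRHS]expR0 ltr_expR oppr_lt0 invr_gt0.
Qed.

Lemma flat_gt0 k x : (0 < flat k x) = (0 < x).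
Proof.
rewrite /flat; case: ifPn => x0; last by rewrite ltxx.
by rewrite mulr_gt0 ?expR_gt0// exprn_gt0// invr_gt0.
Qed.

(* A class closed under differentiation, so that smoothness of its members needs no induction on the order. *)
Inductive smooth1 : (R -> R) -> Prop :=
| smooth1_cst c : smooth1 (fun _ => c)
| smooth1_flat k a b : smooth1 (fun x => flat k (a * x + b))
| smooth1_add f g : smooth1 f -> smooth1 g -> smooth1 (fun x => f x + g x)
| smooth1_mul f g : smooth1 f -> smooth1 g -> smooth1 (fun x => f x * g x).

Lemma smooth1_derive f : smooth1 f ->
  exists2 g, smooth1 g & forall x : R, is_derive x 1 f (g x).
Proof.
elim=> {f} [c|k a b|f g _ [f' sf' df] _ [g' sg' dg]|f g sf [f' sf' df] sg [g' sg' dg]].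
- by exists (fun _ => 0); [exact: smooth1_cst|move=> x; exact: is_derive_cstr].
- exists (fun x => (- k%:R * flat k.+1 (a * x + b) + flat k.+2 (a * x + b)) * a).
    apply: smooth1_mul; last exact: smooth1_cst.
    apply: smooth1_add (smooth1_flat _ _ _).
    by apply: smooth1_mul; [exact: smooth1_cst|exact: smooth1_flat].
  move=> x; apply: is_derive_comp1 (is_derive_flat _ _) _.
  have := is_derive_add (is_derive_scale a (is_derive_id x (1 : R))) (is_derive_cstr b x (1 : R)).
  by rewrite mulr1 addr0.
- exists (fun x => f' x + g' x); first exact: smooth1_add.
  by move=> x; exact: is_derive_add.
- exists (fun x => f' x * g x + f x * g' x).
    by apply: smooth1_add; exact: smooth1_mul.
  by move=> x; exact: is_derive_mul.
Qed.

Lemma smooth1_continuous f : smooth1 f -> continuous f.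
Proof. by move=> /smooth1_derive[g _ dg]; exact: is_derive_cont1 dg. Qed.

(* Tends pointwise to the indicator function of ]a, b[ as [k] goes to infinity. *)
Definition cutoff (a b : R) (k : nat) (x : R) : R :=
  1 + -1 * (1 + -1 * (flat 0 (1 * x + - a) * flat 0 (-1 * x + b))) ^+ k.

(** The explicit coefficients [1] and [-1] in [cutoff] are there so that its body matches the
    constructors of [smooth1]. *)
Lemma cutoff_smooth1 a b k : smooth1 (cutoff a b k).
Proof.
have sX f : smooth1 f -> smooth1 (fun x => f x ^+ k).
  move=> sf; elim: k => [|k IH]; first exact: smooth1_cst.
  rewrite (_ : (fun x => _) = fun x => f x * f x ^+ k); first exact: smooth1_mul.
  by apply/funext => x; rewrite exprS.
apply: smooth1_add; first exact: smooth1_cst.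
apply: smooth1_mul; first exact: smooth1_cst.
apply: sX; apply: smooth1_add; first exact: smooth1_cst.
apply: smooth1_mul; first exact: smooth1_cst.
by apply: smooth1_mul; exact: smooth1_flat.
Qed.

Let bump a b x := flat 0 (1 * x + - a) * flat 0 (-1 * x + b).

Let bump_itv a b x : 0 <= bump a b x < 1.
Proof.
rewrite /bump mulr_ge0 ?flat_ge0//=.
apply: le_lt_trans (flat_lt1 (1 * x + - a)).
by rewrite ler_piMr ?flat_ge0// ltW// flat_lt1.
Qed.

Let bump_gt0 a b x : (0 < bump a b x) = (a < x < b).
Proof.
apply/idP/andP.
  rewrite /bump => H.
  have p1 : flat 0 (1 * x + - a) != 0 by apply: contraTN H => /eqP ->; rewrite mul0r ltxx.
  have p2 : flat 0 (-1 * x + b) != 0 by apply: contraTN H => /eqP ->; rewrite mulr0 ltxx.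
  have : 0 < flat 0 (1 * x + - a) by rewrite lt_neqAle eq_sym p1 flat_ge0.
  have : 0 < flat 0 (-1 * x + b) by rewrite lt_neqAle eq_sym p2 flat_ge0.
  by rewrite !flat_gt0 mul1r mulN1r subr_gt0 addrC subr_gt0.
by case=> ax xb; rewrite mulr_gt0// flat_gt0 ?mul1r ?mulN1r ?subr_gt0// addrC subr_gt0.
Qed.

Lemma cutoff_out a b k x : ~~ (a < x < b) -> cutoff a b k x = 0.
Proof.
rewrite -bump_gt0 -leNgt => H; rewrite /cutoff.
have -> : flat 0 (1 * x + - a) * flat 0 (-1 * x + b) = 0.
  by apply/le_anti; rewrite H/=; have /andP[] := bump_itv a b x.
by rewrite mulr0 addr0 expr1n mulr1 subrr.
Qed.

Lemma cutoff_itv a b k x : 0 <= cutoff a b k x <= 1.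
Proof.
rewrite /cutoff -/(bump a b x) !mulN1r subr_ge0 gerBl.
have /andP[b0 b1] := bump_itv a b x.
have b2 : 0 <= 1 - bump a b x by rewrite subr_ge0 ltW.
by rewrite exprn_ile1 ?exprn_ge0// gerBl.
Qed.

(** Inside the interval the bump lies strictly between 0 and 1, so the powers of its complement to 1
    tend to 0. *)
Lemma cutoff_cvg a b x : a < x < b -> cutoff a b k x @[k --> \oo] --> (1 : R).
Proof.
rewrite -bump_gt0 => b0; rewrite -[X in _ --> X]addr0 -(mulr0 (-1)).
apply: cvgD; first exact: cvg_cst.
apply: cvgMr; apply: cvg_expr.
have /andP[_ b1] := bump_itv a b x.
by rewrite -/(bump a b x) mulN1r ger0_norm ?subr_ge0 ?ltW// gtrBl.
Qed.

End Bump.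

(** * Test functions that are products over the coordinates *)

Section ProductTestFunction.
Variables (R : realType) (n : nat).
Implicit Types (f : 'I_n -> R -> R).

Definition tensor f (x : 'cV[R]_n) : R := \prod_i f i (x i 0).

Lemma tensor_continuous f : (forall i, continuous (f i)) -> continuous (tensor f).
Proof.
move=> cf; apply: continuous_big => [|i _]; first exact: mul_continuous.
exact: cont_comp2 (@cont_coord _ _ _) (cf i).
Qed.

Lemma is_derive_tensor f j g (x : 'cV[R]_n) : is_derive (x j 0 : R) 1 (f j) g ->
  is_derive x (delta_mx j 0) (tensor f) (g * \prod_(i | i != j) f i (x i 0)).
Proof.
move=> dg; have x0 : 0 *: delta_mx j 0 + x = x by rewrite scale0r add0r.
rewrite -{1}x0; apply/(is_derive_lineP (tensor f) x (delta_mx j 0) 0).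
rewrite (_ : (fun h : R => _) = fun h : R => f j (h + x j 0) * \prod_(i | i != j) f i (x i 0)); last first.
  apply/funext => h; rewrite /tensor (bigD1 j)//= !mxE !eqxx mulr1; congr (_ * _).
  by apply: eq_bigr => i /negbTE ij; rewrite !mxE ij mulr0 add0r.
have d1 : is_derive (0 : R) 1 (fun h : R => f j (h + x j 0)) g.
  have := @is_derive_comp1 R R (f j) (fun h => h + x j 0) 0 1 g (1 + 0).
  rewrite add0r addr0 mulr1; apply => //.
  by have := is_derive_add (is_derive_id (0 : R) (1 : R)) (is_derive_cstr (x j 0) (0 : R) (1 : R)); rewrite addr0.
have := is_derive_mul d1 (is_derive_cstr (\prod_(i | i != j) f i (x i 0)) (0 : R) (1 : R)).
by rewrite mulr0 addr0.
Qed.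

(** Only the factor [j] is differentiated, so tensors of [smooth1] functions are stable under
    partial derivatives of every order. *)
Lemma partial_tensor f j : (forall i, smooth1 (f i)) ->
  exists2 g, (forall i, smooth1 (g i)) & forall x, is_derive x (delta_mx j 0) (tensor f) (tensor g x).
Proof.
move=> sf; have [g sg fg] := smooth1_derive (sf j).
exists (fun i => if i == j then g else f i); first by move=> i; case: ifP.
move=> x; have := is_derive_tensor (fg (x j 0)).
rewrite /tensor [X in _ -> is_derive _ _ _ X](bigD1 j)//= eqxx.
rewrite (eq_bigr (fun i => (if i == j then g else f i) (x i 0)))//.
by move=> i /negbTE ->.
Qed.

Lemma Ck_tensor k f : (forall i, smooth1 (f i)) -> Ck k (tensor f).
Proof.
have H s h : (forall i, smooth1 (h i)) -> exists2 g, (forall i, smooth1 (g i)) & partials s (tensor h) = tensor g.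
  move=> sh; elim: s => [|j s [g sg gE]]; first by exists h.
  have [g' sg' gg'] := partial_tensor j sg; exists g' => //=.
  by rewrite gE; apply/funext => x; exact: derive_val.
move=> sf; split=> [s j x _|s _]; have [g sg ->] := H s f sf.
  by have [g' _ gg'] := partial_tensor j sg; exact: ex_derive.
by apply: tensor_continuous => i; exact: smooth1_continuous.
Qed.

Lemma tensor_test_function f r : (forall i, smooth1 (f i)) ->
  (forall i (x : R), r < `|x| -> f i x = 0) -> test_function (tensor f).
Proof.
move=> sf f0; split; first by move=> k; exact: Ck_tensor.
exists [set x : 'cV[R]_n | forall i, `|x i 0| <= r]; first exact: cV_box_compact.
move=> x /existsNP[i /negP]; rewrite -ltNge => xr.
by rewrite /tensor (bigD1 i)//= f0 ?mul0r.
Qed.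

End ProductTestFunction.

(** * A function orthogonal to all test functions vanishes almost everywhere *)

Section FundamentalLemma.
Variables (R : realType) (n : nat).
Local Notation mu := (lebesgueRn R n).
Local Notation T := (n.-tuple R).

Definition obox (a b : 'I_n -> R) : set T := [set t | forall i, `]a i, b i[%classic (tnth t i)].

Lemma measurable_obox a b : measurable (obox a b).
Proof.
rewrite (_ : obox a b = \bigcap_i [set t : n.-tuple R | `]a i, b i[%classic (tnth t i)]).
  apply: fin_bigcap_measurable => // i _.
  by rewrite -[X in measurable X]setTI; apply: measurable_tnth.
by apply/seteqP; split => [t Bt i _|t Bt i] /=; [exact: Bt|exact: (Bt i I)].
Qed.

Lemma oboxI a b c d : obox a b `&` obox c d =
  obox (fun i => Num.max (a i) (c i)) (fun i => Num.min (b i) (d i)).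
Proof.
apply/seteqP; split => t /=.
  move=> [h1 h2] i; have := h1 i; have := h2 i; rewrite /= !in_itv/= gt_max lt_min.
  by move=> /andP[-> ->] /andP[-> ->].
by move=> h; split=> i; have := h i; rewrite /= !in_itv/= gt_max lt_min =>
  /andP[/andP[h1 h2] /andP[h3 h4]]; apply/andP.
Qed.

Definition oboxes : set (set T) := [set B | exists a b, B = obox a b].

(** Open boxes form a system stable under intersection; generating the sigma-algebra with them
    prepares the Dynkin argument of [fundamental_lemma]. *)
Lemma measurable_oboxes : @measurable _ T = <<s oboxes >>.
Proof.
apply/seteqP; split; last first.
  by apply: smallest_sub; [exact: sigma_algebra_measurable|move=> _ [a [b ->]]; exact: measurable_obox].
have H i (B : set R) : measurable B -> <<s oboxes >> ((fun t : T => tnth t i) @^-1` B).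
  rewrite [measurable]RGenOInfty.measurableE.
  pose C := image_set_system [set: T] (fun t : T => tnth t i) <<s oboxes >>.
  suff : <<s @RGenOInfty.G R >> `<=` C by move=> /[apply]; rewrite /C /image_set_system/= setTI.
  apply: smallest_sub.
    by apply: sigma_algebra_image; exact: smallest_sigma_algebra.
  move=> _ [x ->]; rewrite /C /image_set_system/= setTI.
  (* The half-space [x < t_i] is a countable union of boxes, bounded below by [x] in coordinate [i]
     and growing to everything in the others. *)
  pose F (k : nat) := obox (fun j => if j == i then x else - k%:R) (fun=> k%:R).
  rewrite (_ : _ @^-1` _ = \bigcup_k F k).
    have [_ _ U] := @smallest_sigma_algebra _ [set: T] oboxes; apply: U.
    by move=> k; apply: sub_sigma_algebra; eexists; eexists.
  apply/seteqP; split => t /=; rewrite in_itv/= andbT.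
    move=> xt; pose k := (Num.truncn (\sum_j `|tnth t j|)).+1.
    have kt j : `|tnth t j| < k%:R.
      have : \sum_j `|tnth t j| < k%:R by exact: truncnS_gt.
      by apply: le_lt_trans; rewrite (bigD1 j)//= lerDl sumr_ge0.
    exists k => // j; rewrite /= in_itv/=.
    by have := kt j; rewrite ltr_norml => /andP[k1 ->]; case: eqP => [->|_]; rewrite ?xt ?k1.
  by move=> [k _ /(_ i)]; rewrite /= eqxx in_itv/= => /andP[].
apply: smallest_sub; first exact: smallest_sigma_algebra.
elim/big_ind : _ => [//|A B sA sB X [/sA|/sB]//|i _ _ [B mB <-]].
by rewrite setTI; exact: H.
Qed.

(** Products of cutoffs tend to the indicator of an open box, so by dominated convergence [h] has
    integral 0 over each box, then by Dynkin over each measurable part of a cube. Taking the parts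
    where [h >= 0] and [h < 0] gives integral 0 for the absolute value. *)
Lemma fundamental_lemma (h : T -> R) : measurable_fun setT h ->
  (forall r, mu.-integrable (tbox r) (EFin \o h)) ->
  (forall phi, test_function phi -> (\int[mu]_t (h t * phi (vec t))%:E = 0)%E) ->
  {ae mu, forall t, h t = 0}.
Proof.
move=> mh ih hphi.
have mEh D : measurable_fun D (EFin \o h) by apply/measurable_EFinP; exact: measurable_funTS.
have box0 a b : (\int[mu]_(t in obox a b) (h t)%:E = 0)%E.
  pose r := \sum_i (`|a i| + `|b i|).
  pose phi k := tensor (fun i => cutoff (a i) (b i) k).
  have ab_r i (x : R) : a i < x < b i -> `|x| <= r.
    move=> /andP[ax xb]; apply: (@le_trans _ _ (`|a i| + `|b i|)).
      have := ler_norm (- a i); have := ler_norm (b i); have := normr_ge0 (a i); have := normr_ge0 (b i).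
      by rewrite normrN ler_norml; lra.
    by rewrite /r (bigD1 i)//= lerDl sumr_ge0// => j _; rewrite addr_ge0.
  have phi_out k t : ~ obox a b t -> phi k (vec t) = 0.
    move=> /existsNP[i /negP]; rewrite in_itv/= => H.
    by rewrite /phi /tensor (bigD1 i)//= mxE cutoff_out ?mul0r.
  have box_r : obox a b `<=` tbox r.
    by move=> t bt i; have := bt i; rewrite /= !in_itv/= -ler_norml; exact: ab_r.
  have phi_test k : test_function (phi k).
    apply: (@tensor_test_function _ _ _ r) => [i|i x]; first exact: cutoff_smooth1.
    by rewrite ltNge => /negP xr; apply: cutoff_out; apply/negP => /ab_r.
  have phi01 k x : 0 <= phi k x <= 1.
    rewrite /phi /tensor; elim/big_ind : _ => [|u v /andP[u0 u1] /andP[v0 v1]|i _].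
    - by rewrite ler01 lexx.
    - by rewrite mulr_ge0// mulr_ile1.
    - exact: cutoff_itv.
  have L : (\int[mu]_(t in obox a b) (h t * phi k (vec t))%:E)%E @[k --> \oo] --> (\int[mu]_(t in obox a b) (h t)%:E)%E.
    apply: (@dominated_cvg _ _ _ mu _ (measurable_obox a b) _ _ (fun t => `|(h t)%:E|)%E) => //.
    - move=> k; apply/measurable_EFinP; apply: measurable_funM; first exact: measurable_funTS.
      apply: measurable_funTS; apply: continuous_measurable_vec.
      by apply: tensor_continuous => i; exact/smooth1_continuous/cutoff_smooth1.
    - move=> t bt; apply: cvg_EFin; first exact: nearW.
      rewrite /comp/= -[X in _ --> X]mulr1; apply: cvgMr.
      rewrite (_ : 1 = \prod_(i < n) (1 : R)); last by rewrite big1.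
      apply: cvg_big => [|i _]; first exact: mul_continuous.
      rewrite mxE; apply: cutoff_cvg.
      by have := bt i; rewrite /= in_itv.
    - apply: integrable_abse; apply: integrableS (ih r) => //; first exact: measurable_tbox.
      exact: measurable_obox.
    - move=> k t _; rewrite /= lee_fin normrM ler_piMr//.
      by have /andP[p0 p1] := phi01 k (vec t); rewrite ger0_norm.
  move: L; rewrite (_ : (fun k => _) = cst 0%E); last first.
    apply/funext => k; rewrite -[RHS](hphi _ (phi_test k)) integral_mkcond.
    apply: eq_integral => t _; rewrite patchE; case: ifPn => //.
    by rewrite notin_setE => /phi_out ->; rewrite mulr0.
  by move=> /(cvg_lim (@ereal_hausdorff R)) <-; rewrite lim_cst.
(* Countable additivity uses integrability, which [h] has on bounded sets: the Dynkin argument runs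
   inside a fixed cube. *)
pose K (N : nat) := obox (fun=> - N%:R) (fun=> N%:R).
have mK N : measurable (K N) by exact: measurable_obox.
have iK N : mu.-integrable (K N) (EFin \o h).
  apply: integrableS (ih N%:R) => //; first exact: measurable_tbox.
  by move=> t Kt i; have := Kt i; rewrite /= !in_itv/= => /andP[/ltW -> /ltW ->].
have iKI N A : measurable A -> mu.-integrable (A `&` K N) (EFin \o h).
  by move=> mA; exact: (integrableS (mK N) (measurableI _ _ mA (mK N)) (@subIsetr _ _ _) (iK N)).
have all0 N A : measurable A -> (\int[mu]_(t in A `&` K N) (h t)%:E = 0)%E.
  rewrite measurable_oboxes.
  apply: (@dynkin_induction _ _ oboxes (fun A => \int[mu]_(t in A `&` K N) (h t)%:E = 0)%E).
  - exact: measurable_oboxes.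
  - by move=> _ _ [a [b ->]] [c [d ->]]; rewrite oboxI; eexists; eexists.
  - by rewrite setTI; exact: box0.
  - by move=> _ [a [b ->]]; rewrite /K oboxI; exact: box0.
  - move=> S mS S0; have := box0 (fun=> - N%:R) (fun=> N%:R); rewrite -/(K N).
    rewrite {1}(_ : K N = (S `&` K N) `|` (~` S `&` K N)); last first.
      by rewrite -setIUl setUv setTI.
    rewrite integral_setU ?S0 ?add0e//.
    + exact: measurableI.
    + by apply: measurableI => //; exact: measurableC.
    + by apply/disj_setPRL => t [nS _] [].
  - move=> F mF tF F0; rewrite setI_bigcupl integral_bigcup.
    + by apply: eseries0 => k _ _; exact: F0.
    + exact: trivIset_setIr.
    + by move=> k; exact: measurableI.
    + by rewrite -setI_bigcupl; apply: iKI; exact: bigcup_measurable.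
have H N : {ae mu, forall t, K N t -> h t = 0}.
  have : (\int[mu]_(t in K N) `|(h t)%:E| = 0)%E.
    pose S := [set t | 0 <= h t].
    have mS : measurable S.
      rewrite -[S]setTI; have := mh measurableT _ (measurable_itv `[0, +oo[).
      by congr (measurable (_ `&` _)); apply/seteqP; split => t /=; rewrite in_itv/= andbT.
    have mS' := measurableC mS.
    rewrite {1}(_ : K N = (S `&` K N) `|` (~` S `&` K N)); last first.
      by rewrite -setIUl setUv setTI.
    rewrite integral_setU//; last 4 first.
    - exact: measurableI.
    - exact: measurableI.
    - by apply: measurableT_comp => //; exact: mEh.
    - by apply/disj_setPRL => t [nS _] [].
    rewrite (eq_integral (fun t => (h t)%:E)) ?all0 ?add0e//; last first.
      by move=> t /set_mem[St _]; rewrite gee0_abs ?lee_fin.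
    rewrite (eq_integral (fun t => - (h t)%:E)%E); last first.
      move=> t /set_mem[/negP St _]; rewrite lee0_abs// lee_fin ltW//.
      by rewrite ltNge.
    rewrite integralN/= ?all0 ?oppe0//; apply: integrable_add_def; first exact: measurableI.
    by apply: iKI.
  move=> /(ae_eq_integral_abs mu (mK N) (mEh _)) [Z [mZ Z0 HZ]].
  by exists Z; split => // t Ht; apply: HZ => ht; apply: Ht => /ht [].
have : {ae mu, forall t, forall N, K N t -> h t = 0}.
  exact/ae_foralln.
move=> [Z [mZ Z0 HZ]]; exists Z; split => // t Ht; apply: HZ => ht; apply: Ht.
pose k := (Num.truncn (\sum_j `|tnth t j|)).+1.
apply: (ht k) => j; rewrite /= in_itv/= -ltr_norml.
have : \sum_j `|tnth t j| < k%:R by exact: truncnS_gt.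
by apply: le_lt_trans; rewrite (bigD1 j)//= lerDl sumr_ge0.
Qed.

End FundamentalLemma.

(** * Weak gradients *)

Section SquareIntegrable.
Variables (R : realType) (n : nat).
Local Notation mu := (lebesgueRn R n).
Implicit Types (h g phi : 'cV[R]_n -> R).

Definition sqint h : \bar R := (\int[mu]_t (h (vec t) ^+ 2)%:E)%E.

Definition L2r h := measurable_fun setT (fun t : n.-tuple R => h (vec t)) /\ (sqint h < +oo)%E.

Lemma L2enormE h : L2enorm h = poweR (sqint h) 2^-1.
Proof.
rewrite /L2enorm unlock /sqint; congr (poweR _ _); apply: eq_integral => t _.
by rewrite abse_EFin poweR_EFin powR_mulrn// real_normK// num_real.
Qed.

Lemma sqint_ge0 h : (0 <= sqint h)%E.
Proof. by apply: integral_ge0 => t _; rewrite lee_fin sqr_ge0. Qed.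

Lemma L2enorm_lty h : (L2enorm h < +oo)%E <-> (sqint h < +oo)%E.
Proof.
rewrite L2enormE; have := sqint_ge0 h; case: (sqint h) => [r|_|//].
  by rewrite poweR_EFin !ltry.
by rewrite poweRyr// invr_eq0 pnatr_eq0.
Qed.

Lemma fine_L2enorm h : fine (L2enorm h) = Num.sqrt (fine (sqint h)).
Proof.
rewrite L2enormE; have := sqint_ge0 h; case: (sqint h) => [r|_|//].
  by rewrite poweR_EFin /= lee_fin => r0; rewrite powR12_sqrt.
by rewrite poweRyr/= ?invr_eq0 ?pnatr_eq0// sqrtr0.
Qed.

Lemma L2r_integrable_sqr h : L2r h -> mu.-integrable setT (fun t => (h (vec t) ^+ 2)%:E).
Proof.
move=> [mh hoo]; apply/integrableP; split.
  by apply/measurable_EFinP; exact: measurable_funX.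
by under eq_integral do rewrite gee0_abs ?lee_fin ?sqr_ge0//.
Qed.

Lemma L2r_mul_integrable h g : L2r h -> L2r g ->
  mu.-integrable setT (fun t => (h (vec t) * g (vec t))%:E).
Proof.
move=> Lh Lg; have := integrableD measurableT (L2r_integrable_sqr Lh) (L2r_integrable_sqr Lg).
apply: le_integrable => //.
  by apply/measurable_EFinP; apply: measurable_funM; [exact: Lh.1|exact: Lg.1].
move=> t _ /=; rewrite lee_fin [leRHS]ger0_norm ?addr_ge0 ?sqr_ge0// normrM.
rewrite -[X in _ <= X + _]real_normK ?num_real// -[X in _ <= _ + X]real_normK ?num_real//.
set a := `|h _|; set b := `|g _|.
have := sqr_ge0 (a - b); have := mulr_ge0 (normr_ge0 (h (vec t))) (normr_ge0 (g (vec t))).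
by rewrite -/a -/b sqrrB; lra.
Qed.

Lemma L2rD h g : L2r h -> L2r g -> L2r (fun x => h x + g x).
Proof.
move=> Lh Lg; split; first by apply: measurable_funD; [exact: Lh.1|exact: Lg.1].
have I : mu.-integrable setT (fun t => ((2 * h (vec t) ^+ 2)%:E + (2 * g (vec t) ^+ 2)%:E))%E.
  apply: integrableD => //; under eq_fun do rewrite EFinM; apply: integrableZl => //;
  exact: L2r_integrable_sqr.
have /integrableP[_] := I; apply: le_lt_trans.
apply: ge0_le_integral => //.
- by move=> t _; rewrite lee_fin sqr_ge0.
- by apply/measurable_EFinP; apply: measurable_funX; apply: measurable_funD; [exact: Lh.1|exact: Lg.1].
- by apply: measurableT_comp => //; exact: measurable_int I.
- move=> t _; rewrite /= lee_fin ger0_norm; last by apply: addr_ge0; apply: mulr_ge0 => //; exact: sqr_ge0.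
  by have := sqr_ge0 (h (vec t) - g (vec t)); rewrite sqrrB sqrrD; lra.
Qed.

Lemma L2rN h : L2r h -> L2r (fun x => - h x).
Proof.
move=> [mh hoo]; split; first exact: measurable_funN.
by rewrite /sqint; under eq_integral do rewrite sqrrN.
Qed.

Lemma L2rB h g : L2r h -> L2r g -> L2r (fun x => h x - g x).
Proof. by move=> Lh /L2rN; exact: L2rD. Qed.

Lemma Cc_L2r h : Cc h -> L2r h.
Proof.
move=> ch; split; first exact: continuous_measurable_vec ch.1.
have := Cc_integrable (CcMl ch.1 ch) => /integrableP[_].
by under eq_integral do rewrite gee0_abs ?lee_fin -?expr2 ?sqr_ge0//.
Qed.

Lemma L2r_Cc_integrable h g : L2r h -> Cc g ->
  mu.-integrable setT (fun t => (h (vec t) * g (vec t))%:E).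
Proof. by move=> Lh /Cc_L2r; exact: L2r_mul_integrable. Qed.

(** From [|h| <= 1 + h ^ 2] and the finite measure of the box. *)
Lemma L2r_tbox h r : L2r h -> mu.-integrable (tbox r) (fun t => (h (vec t))%:E).
Proof.
move=> Lh.
have I1 : mu.-integrable (tbox r) (fun t => (1 + h (vec t) ^+ 2)%:E).
  under eq_fun do rewrite EFinD; apply: integrableD; first exact: measurable_tbox.
    apply/integrableP; split; first exact: measurable_cst.
    by rewrite /= integral_cst ?normr1 ?mul1e; [exact: tbox_lty|exact: measurable_tbox].
  apply: integrableS (L2r_integrable_sqr Lh) => //; exact: measurable_tbox.
apply: le_integrable I1; first exact: measurable_tbox.
  by apply/measurable_EFinP; apply: measurable_funTS; exact: Lh.1.
move=> t _ /=; rewrite lee_fin [leRHS]ger0_norm ?addr_ge0 ?sqr_ge0//.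
rewrite -real_normK ?num_real//; set a := `|_|.
by have := sqr_ge0 (a - 1); rewrite sqrrB mulr1 expr1n; have := normr_ge0 (h (vec t)); rewrite -/a; lra.
Qed.

Definition wderiv j f g := forall phi, test_function phi ->
  \int[mu]_t (f (vec t) * partial j phi (vec t)) = - \int[mu]_t (g (vec t) * phi (vec t)).

Lemma wderiv_unique j f g g' : L2r g -> L2r g' -> wderiv j f g -> wderiv j f g' ->
  {ae mu, forall t, g (vec t) = g' (vec t)}.
Proof.
move=> Lg Lg' fg fg'.
have Lh := L2rB Lg Lg'.
have : {ae mu, forall t, g (vec t) - g' (vec t) = 0}.
  apply: fundamental_lemma; first exact: Lh.1.
    by move=> r; exact: L2r_tbox Lh.
  move=> phi tphi; have Cphi : Cc phi := test_function_Cc [::] tphi.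
  have := L2r_Cc_integrable Lg Cphi; have := L2r_Cc_integrable Lg' Cphi => I' I.
  have : \int[mu]_t ((g (vec t) - g' (vec t)) * phi (vec t)) = 0.
    under eq_Rintegral do rewrite mulrBl.
    by rewrite RintegralB//; apply/eqP; rewrite subr_eq0 -eqr_opp -fg// -fg'.
  rewrite /Rintegral => H; rewrite -[LHS]fineK ?H//.
  by apply: integrable_fin_num => //; exact: L2r_Cc_integrable Lh Cphi.
by move=> [Z [mZ Z0 HZ]]; exists Z; split => // t Ht; apply: HZ => H; apply: Ht; apply/eqP; rewrite -subr_eq0 H.
Qed.

(** The derivative of the product [f * phi] has compact support, so its integral is 0. *)
Lemma wderiv_classical j f df : continuous f -> continuous df ->
  (forall x, is_derive x (delta_mx j 0) f (df x)) -> wderiv j f df.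
Proof.
move=> cf cdf f' phi tphi; have Cphi : Cc phi := test_function_Cc [::] tphi.
have Cdphi : Cc (partial j phi) := test_function_Cc [:: j] tphi.
have I1 := Cc_integrable (CcMl cdf Cphi); have I2 := Cc_integrable (CcMl cf Cdphi).
have := integral_partial_eq0 (CcMl cf Cphi) (CcD (CcMl cdf Cphi) (CcMl cf Cdphi))
  (fun x => is_derive_mul (f' x) (test_function_is_derive x j tphi)).
move=> /(congr1 fine) /=; rewrite -/(Rintegral _ _ _) RintegralD// => /eqP.
by rewrite addr_eq0 => /eqP ->; rewrite opprK.
Qed.

Lemma wderivB j f1 f2 g1 g2 : L2r f1 -> L2r f2 -> L2r g1 -> L2r g2 ->
  wderiv j f1 g1 -> wderiv j f2 g2 -> wderiv j (fun x => f1 x - f2 x) (fun x => g1 x - g2 x).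
Proof.
move=> Lf1 Lf2 Lg1 Lg2 w1 w2 phi tphi.
have Cphi : Cc phi := test_function_Cc [::] tphi.
have Cdphi : Cc (partial j phi) := test_function_Cc [:: j] tphi.
under eq_Rintegral do rewrite mulrBl; under [in RHS]eq_Rintegral do rewrite mulrBl.
rewrite !RintegralB//; [by rewrite w1// w2// opprB opprK addrC|..]; exact: L2r_Cc_integrable.
Qed.

Lemma ae_eq_Rintegral_mul (g g' : 'cV[R]_n -> R) phi : measurable_fun setT (fun t : n.-tuple R => g (vec t)) ->
  measurable_fun setT (fun t : n.-tuple R => g' (vec t)) ->
  continuous phi -> {ae mu, forall t, g (vec t) = g' (vec t)} ->
  \int[mu]_t (g (vec t) * phi (vec t)) = \int[mu]_t (g' (vec t) * phi (vec t)).
Proof.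
move=> mg mg' cphi gg'; rewrite /Rintegral; congr fine.
have mphi := continuous_measurable_vec cphi.
apply: ae_eq_integral => //.
- by apply/measurable_EFinP; exact: measurable_funM.
- by apply/measurable_EFinP; exact: measurable_funM.
- by apply: filterS gg' => t /= -> _.
Qed.

End SquareIntegrable.

(** * Weak gradients of complex functions, through real and imaginary parts *)

Section ComplexValued.
Variables (R : realType) (n : nat).
Local Notation mu := (lebesgueRn R n).
Implicit Types (f : 'cV[R]_n -> R[i]) (G : 'cV[R]_n -> 'cV[R[i]]_n).

Definition ReF f : 'cV[R]_n -> R := fun x => complex.Re (f x).
Definition ImF f : 'cV[R]_n -> R := fun x => complex.Im (f x).

Lemma normc_sqr (z : R[i]) : Normc.normc z ^+ 2 = complex.Re z ^+ 2 + complex.Im z ^+ 2.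
Proof. by case: z => a b /=; rewrite sqr_sqrtr// addr_ge0 ?sqr_ge0. Qed.

Lemma integralC_mulr f (phi : 'cV[R]_n -> R) :
  integralC (fun x => f x * (phi x)%:C) =
  (\int[mu]_t (ReF f (vec t) * phi (vec t))) +i* (\int[mu]_t (ImF f (vec t) * phi (vec t))).
Proof.
rewrite /integralC; congr (_ +i* _); apply: eq_Rintegral => t _; rewrite /ReF /ImF;
by case: (f _) => a b /=; rewrite mulr0 ?subr0 ?add0r.
Qed.

Lemma sqint_normc f : measurable_fun setT (fun t : n.-tuple R => ReF f (vec t)) ->
  measurable_fun setT (fun t : n.-tuple R => ImF f (vec t)) ->
  sqint (fun x => Normc.normc (f x)) = (sqint (ReF f) + sqint (ImF f))%E.
Proof.
move=> mR mI; rewrite /sqint -ge0_integralD//.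
- by apply: eq_integral => t _; rewrite normc_sqr EFinD.
- by move=> t _; rewrite lee_fin sqr_ge0.
- by apply/measurable_EFinP; exact: measurable_funX.
- by move=> t _; rewrite lee_fin sqr_ge0.
- by apply/measurable_EFinP; exact: measurable_funX.
Qed.

Lemma inL2P f : inL2 f <-> L2r (ReF f) /\ L2r (ImF f).
Proof.
split=> [[mR mI /L2enorm_lty]|[[mR LR] [mI LI]]].
  rewrite sqint_normc// => H; split; split=> //; apply: le_lt_trans H.
    by rewrite leeDl// sqint_ge0.
  by rewrite leeDr// sqint_ge0.
by split => //; apply/L2enorm_lty; rewrite sqint_normc// lte_add_pinfty.
Qed.

Lemma is_weak_gradientP f G : is_weak_gradient f G <->
  forall j, [/\ L2r (ReF (fun x => G x j 0)), L2r (ImF (fun x => G x j 0)),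
    wderiv j (ReF f) (ReF (fun x => G x j 0)) & wderiv j (ImF f) (ImF (fun x => G x j 0))].
Proof.
split=> [[LG wG] j|H].
  have /inL2P[LR LI] := LG j; split => // phi tphi;
  by have := wG phi tphi j; rewrite !integralC_mulr => -[].
split=> [j|phi tphi j]; first by apply/inL2P; have [] := H j.
by rewrite !integralC_mulr; have [_ _ /(_ _ tphi) -> /(_ _ tphi) ->] := H j.
Qed.

Lemma is_weak_gradient_unique f G G' : is_weak_gradient f G -> is_weak_gradient f G' ->
  {ae mu, forall t, G (vec t) = G' (vec t)}.
Proof.
move=> /is_weak_gradientP wG /is_weak_gradientP wG'.
have H : {ae mu, forall t, forall j, G (vec t) j 0 = G' (vec t) j 0}.
  apply: filter_forall => j.
  have [LR LI wR wI] := wG j; have [LR' LI' wR' wI'] := wG' j.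
  have := wderiv_unique LR LR' wR wR'; have := wderiv_unique LI LI' wI wI'.
  apply: filterS2 => t; rewrite /ReF /ImF.
  by case: (G _ j 0) (G' _ j 0) => a b [c d] /= -> ->.
by apply: filterS H => t H; apply/matrixP => i k; rewrite ord1.
Qed.

Lemma weak_gradientP f G : is_weak_gradient f G -> is_weak_gradient f (weak_gradient f).
Proof. by move=> wG; rewrite /weak_gradient; exact: (xgetPex (fun=> 0) (ex_intro _ G wG)). Qed.

(** The chosen representative is thereby replaced, inside integrals, by any weak gradient at hand,
    in practice the classical one. *)
Lemma weak_gradient_ae f G : is_weak_gradient f G ->
  {ae mu, forall t, weak_gradient f (vec t) = G (vec t)}.
Proof. by move=> wG; apply: is_weak_gradient_unique (weak_gradientP wG) wG. Qed.

Definition gradsq G (x : 'cV[R]_n) : R :=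
  \sum_j (complex.Re (G x j 0) ^+ 2 + complex.Im (G x j 0) ^+ 2).

Definition gradint G : \bar R := (\int[mu]_t (gradsq G (vec t))%:E)%E.

Lemma gradsq_ge0 G x : 0 <= gradsq G x.
Proof. by apply: sumr_ge0 => j _; rewrite addr_ge0 ?sqr_ge0. Qed.

Lemma measurable_gradsq f G : is_weak_gradient f G ->
  measurable_fun setT (fun t : n.-tuple R => gradsq G (vec t)).
Proof.
move=> /is_weak_gradientP wG; apply: measurable_sum => j.
have [[mR _] [mI _] _ _] := wG j.
by apply: measurable_funD; exact: measurable_funX.
Qed.

Lemma gradsq_integrable f G : is_weak_gradient f G ->
  mu.-integrable setT (fun t => (gradsq G (vec t))%:E).
Proof.
move=> /is_weak_gradientP wG; rewrite /gradsq.
under eq_fun do rewrite -sumEFin.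
apply: integrable_sum => // j _; have [LR LI _ _] := wG j.
by under eq_fun do rewrite EFinD; apply: integrableD => //; [exact: (L2r_integrable_sqr LR)|exact: (L2r_integrable_sqr LI)].
Qed.

Lemma gradL2normE f G : is_weak_gradient f G ->
  gradL2norm f = Num.sqrt (fine (gradint G)).
Proof.
move=> wG; rewrite /gradL2norm fine_L2enorm; congr (Num.sqrt (fine _)).
have mw := measurable_gradsq (weak_gradientP wG).
rewrite /sqint /gradint; apply: ae_eq_integral => //.
- apply/measurable_EFinP; rewrite (_ : (fun t => _) = (fun t => gradsq (weak_gradient f) (vec t)))//.
  apply/funext => t; rewrite sqr_sqrtr; first by apply: eq_bigr => j _; rewrite normc_sqr.
  by apply: sumr_ge0 => j _; rewrite sqr_ge0.
- by apply/measurable_EFinP; exact: measurable_gradsq wG.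
- apply: filterS (weak_gradient_ae wG) => t /= E _; rewrite E.
  rewrite sqr_sqrtr; first by congr (_ %:E); apply: eq_bigr => j _; rewrite normc_sqr.
  by apply: sumr_ge0 => j _; rewrite sqr_ge0.
Qed.

Lemma is_weak_gradientB f f' G G' : inL2 f -> inL2 f' -> is_weak_gradient f G -> is_weak_gradient f' G' ->
  is_weak_gradient (f \- f') (fun x => G x - G' x).
Proof.
move=> /inL2P[Rf If] /inL2P[Rf' If'] /is_weak_gradientP wG /is_weak_gradientP wG'.
have ReB (z w : R[i]) : complex.Re (z - w) = complex.Re z - complex.Re w by case: z w => a b [].
have ImB (z w : R[i]) : complex.Im (z - w) = complex.Im z - complex.Im w by case: z w => a b [].
apply/is_weak_gradientP => j.
have [LR LI wR wI] := wG j; have [LR' LI' wR' wI'] := wG' j.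
have -> : ReF (fun x => (G x - G' x) j 0) = (fun x => ReF (fun x => G x j 0) x - ReF (fun x => G' x j 0) x).
  by apply/funext => x; rewrite /ReF !mxE ReB.
have -> : ImF (fun x => (G x - G' x) j 0) = (fun x => ImF (fun x => G x j 0) x - ImF (fun x => G' x j 0) x).
  by apply/funext => x; rewrite /ImF !mxE ImB.
have -> : ReF (f \- f') = (fun x => ReF f x - ReF f' x) by apply/funext => x; rewrite /ReF ReB.
have -> : ImF (f \- f') = (fun x => ImF f x - ImF f' x) by apply/funext => x; rewrite /ImF ImB.
by split; [exact: L2rB|exact: L2rB|exact: wderivB|exact: wderivB].
Qed.

(** An extension is compared with the solution only almost everywhere at each time; this transfers
    its weak gradient. *)
Lemma is_weak_gradient_ae f f' G : inL2 f -> inL2 f' ->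
  {ae mu, forall t, f (vec t) = f' (vec t)} -> is_weak_gradient f G -> is_weak_gradient f' G.
Proof.
move=> /inL2P[[Rf _] [If _]] /inL2P[[Rf' _] [If' _]] ff' /is_weak_gradientP wG.
apply/is_weak_gradientP => j; have [LR LI wR wI] := wG j; split => // phi tphi.
- rewrite -wR//; apply: ae_eq_Rintegral_mul => //; first exact: (test_function_Cc [:: j] tphi).1.
  by apply: filterS ff' => t; rewrite /ReF => ->.
- rewrite -wI//; apply: ae_eq_Rintegral_mul => //; first exact: (test_function_Cc [:: j] tphi).1.
  by apply: filterS ff' => t; rewrite /ImF => ->.
Qed.

Lemma gradint_fin f G : is_weak_gradient f G -> gradint G \is a fin_num.
Proof. by move=> wG; apply: integrable_fin_num => //; exact: gradsq_integrable wG. Qed.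

Lemma gradL2norm_sqr f G : is_weak_gradient f G -> gradL2norm f ^+ 2 = fine (gradint G).
Proof.
move=> wG; rewrite (gradL2normE wG) sqr_sqrtr// fine_ge0//.
by apply: integral_ge0 => t _; rewrite lee_fin gradsq_ge0.
Qed.

(** A squared substitute for the triangle inequality, obtained pointwise under the integral; its
    constant 2 is harmless where only boundedness matters. *)
Lemma gradL2norm_le f f' G G' : is_weak_gradient f G -> is_weak_gradient f' G' ->
  inL2 f -> inL2 f' ->
  gradL2norm f ^+ 2 <= 2 * gradL2norm (f \- f') ^+ 2 + 2 * gradL2norm f' ^+ 2.
Proof.
move=> wG wG' Lf Lf'; have wB := is_weak_gradientB Lf Lf' wG wG'.
rewrite (gradL2norm_sqr wG) (gradL2norm_sqr wG') (gradL2norm_sqr wB).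
rewrite -!/(Rintegral _ _ _).
have I1 := gradsq_integrable wG; have I2 := gradsq_integrable wG'; have I3 := gradsq_integrable wB.
have I2' : mu.-integrable setT (fun t => (2 * gradsq G' (vec t))%:E).
  by under eq_fun do rewrite EFinM; exact: integrableZl.
have I3' : mu.-integrable setT (fun t => (2 * gradsq (fun x => G x - G' x) (vec t))%:E).
  by under eq_fun do rewrite EFinM; exact: integrableZl.
rewrite -RintegralZl// -RintegralZl// -RintegralD//.
apply: le_Rintegral => //; first exact: (integrableD measurableT I3' I2').
move=> t _; rewrite /gradsq !mulr_sumr -big_split/=; apply: ler_sum => j _.
rewrite !mxE; case: (G _ j 0) (G' _ j 0) => a b [c d] /=.
(* The identity [2 (a - c) ^ 2 + 2 c ^ 2 - a ^ 2 = (a - 2 c) ^ 2]. *)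
have := sqr_ge0 (a - c - c); have := sqr_ge0 (b - d - d); nra.
Qed.

End ComplexValued.

(** * Classical functions under the majorant: membership and continuity in Sigma *)

Section SigmaFunctions.
Variables (R : realType) (n : nat).
Local Notation mu := (lebesgueRn R n).
Implicit Types (A B : 'cV[R]_n -> R) (dA dB : 'I_n -> 'cV[R]_n -> R).

Lemma enorm_sqr (x : 'cV[R]_n) : enorm x ^+ 2 = \sum_i x i 0 ^+ 2.
Proof. by rewrite sqr_sqrtr// sumr_ge0// => i _; exact: sqr_ge0. Qed.

Lemma enorm_ge0 (x : 'cV[R]_n) : 0 <= enorm x.
Proof. exact: sqrtr_ge0. Qed.

Lemma enorm_continuous : continuous (@enorm R n).
Proof.
apply: (cont_comp2 _ (@sqrt_continuous R)); apply: cont_sum => i.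
by apply: contX; exact: cont_coord.
Qed.

Definition c1grad A dA := [/\ continuous A, forall j, continuous (dA j) &
  forall j x, is_derive x (delta_mx j 0) A (dA j x)].

(* A pointwise integrable majorant of the density of the squared Sigma norm. *)
Definition dominated (C : R) A dA := forall x,
  (1 + enorm x ^+ 2) * A x ^+ 2 + \sum_j dA j x ^+ 2 <= C * weight x.

Lemma c1gradB A B dA dB : c1grad A dA -> c1grad B dB ->
  c1grad (fun x => A x - B x) (fun j x => dA j x - dB j x).
Proof.
move=> [cA cdA A'] [cB cdB B']; split=> [|j|j x]; [exact: contB|exact: contB|].
by apply: is_derive_add (A' _ _) _; apply: is_derive_opp; exact: B'.
Qed.

Lemma dominatedB C D A B dA dB : dominated C A dA -> dominated D B dB ->
  dominated (2 * (C + D)) (fun x => A x - B x) (fun j x => dA j x - dB j x).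
Proof.
move=> hA hB x; have HA := hA x; have HB := hB x.
apply: (@le_trans _ _ (2 * ((1 + enorm x ^+ 2) * A x ^+ 2 + \sum_j dA j x ^+ 2) +
   2 * ((1 + enorm x ^+ 2) * B x ^+ 2 + \sum_j dB j x ^+ 2))); last by lra.
have sq2 (a b : R) : (a - b) ^+ 2 <= 2 * a ^+ 2 + 2 * b ^+ 2.
  by have := sqr_ge0 (a + b); nra.
have H1 : (1 + enorm x ^+ 2) * (A x - B x) ^+ 2 <= (1 + enorm x ^+ 2) * (2 * A x ^+ 2 + 2 * B x ^+ 2).
  by rewrite ler_wpM2l// addr_ge0// sqr_ge0.
have H2 : \sum_j (dA j x - dB j x) ^+ 2 <= 2 * (\sum_j dA j x ^+ 2) + 2 * (\sum_j dB j x ^+ 2).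
  by rewrite !mulr_sumr -big_split/=; apply: ler_sum => j _.
by lra.
Qed.

Lemma weight_integrableZ C : mu.-integrable setT (fun t => (C * weight (vec t))%:E).
Proof. by under eq_fun do rewrite EFinM; apply: integrableZl => //; exact: weight_integrable. Qed.

Lemma le_weight_integrable (g : 'cV[R]_n -> R) C : continuous g -> (forall x, 0 <= g x <= C * weight x) ->
  mu.-integrable setT (fun t => (g (vec t))%:E).
Proof.
move=> cg gC; apply: (@le_integrable _ _ _ _ _ measurableT _ (fun t => (C * weight (vec t))%:E)).
- by apply/measurable_EFinP; exact: continuous_measurable_vec.
- move=> t _; have /andP[g0 g1] := gC (vec t); rewrite lee_fin ger0_norm// ger0_norm//.
  exact: le_trans g1.
- exact: weight_integrableZ.
Qed.

Lemma dominated_L2r (g : 'cV[R]_n -> R) C : continuous g -> (forall x, g x ^+ 2 <= C * weight x) -> L2r g.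
Proof.
move=> cg gC; split; first exact: continuous_measurable_vec.
have /integrableP[_] : mu.-integrable setT (fun t => (g (vec t) ^+ 2)%:E).
  apply: (@le_weight_integrable (fun x => g x ^+ 2) C); first exact: contX.
  by move=> x; rewrite sqr_ge0 gC.
by under eq_integral do rewrite gee0_abs ?lee_fin ?sqr_ge0//.
Qed.

Definition mkC A B : 'cV[R]_n -> R[i] := fun x => A x +i* B x.
Definition mkG dA dB : 'cV[R]_n -> 'cV[R[i]]_n := fun x => \col_j (dA j x +i* dB j x).

Lemma dominated_fun C A dA x : dominated C A dA -> A x ^+ 2 <= C * weight x.
Proof.
move=> H; apply: le_trans (H x); rewrite mulrDl mul1r -addrA lerDl addr_ge0//.
  by rewrite mulr_ge0 ?sqr_ge0.
by apply: sumr_ge0 => j _; exact: sqr_ge0.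
Qed.

Lemma dominated_weighted C A dA x : dominated C A dA -> (enorm x * A x) ^+ 2 <= C * weight x.
Proof.
move=> H; apply: le_trans (H x); rewrite mulrDl mul1r -addrA addrCA exprMn lerDl addr_ge0 ?sqr_ge0//.
by apply: sumr_ge0 => j _; exact: sqr_ge0.
Qed.

Lemma dominated_partial C A dA j x : dominated C A dA -> dA j x ^+ 2 <= C * weight x.
Proof.
move=> H; apply: le_trans (H x); rewrite (bigD1 j)//= addrCA lerDl addr_ge0//.
  by rewrite mulr_ge0 ?sqr_ge0// addr_ge0// sqr_ge0.
by apply: sumr_ge0 => k _; exact: sqr_ge0.
Qed.

Section Pair.
Variables (A B : 'cV[R]_n -> R) (dA dB : 'I_n -> 'cV[R]_n -> R) (C D : R).
Hypotheses (cA : c1grad A dA) (cB : c1grad B dB).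
Hypotheses (hA : dominated C A dA) (hB : dominated D B dB).

Lemma mkC_weak_gradient : is_weak_gradient (mkC A B) (mkG dA dB).
Proof.
have [cA0 cA1 A'] := cA; have [cB0 cB1 B'] := cB.
apply/is_weak_gradientP => j.
have -> : ReF (fun x => mkG dA dB x j 0) = dA j by apply/funext => x; rewrite /ReF mxE.
have -> : ImF (fun x => mkG dA dB x j 0) = dB j by apply/funext => x; rewrite /ImF mxE.
split.
- by apply: (@dominated_L2r _ C) => // x; exact: dominated_partial hA.
- by apply: (@dominated_L2r _ D) => // x; exact: dominated_partial hB.
- exact: wderiv_classical.
- exact: wderiv_classical.
Qed.

Lemma mkC_inL2 : inL2 (mkC A B).
Proof.
have [cA0 _ _] := cA; have [cB0 _ _] := cB; apply/inL2P; split.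
- by apply: (@dominated_L2r _ C) => // x; exact: dominated_fun hA.
- by apply: (@dominated_L2r _ D) => // x; exact: dominated_fun hB.
Qed.

Lemma mkC_inSigma : inSigma (mkC A B).
Proof.
have [cA0 _ _] := cA; have [cB0 _ _] := cB; split.
  by split; [exact: mkC_inL2|exists (mkG dA dB); exact: mkC_weak_gradient].
apply/inL2P; split.
- rewrite (_ : ReF _ = fun x => enorm x * A x); last first.
    by apply/funext => x; rewrite /ReF /weighted /mkC/= mul0r subr0.
  apply: (@dominated_L2r _ C); first exact: contM enorm_continuous cA0.
  by move=> x; exact: dominated_weighted hA.
- rewrite (_ : ImF _ = fun x => enorm x * B x); last first.
    by apply/funext => x; rewrite /ImF /weighted /mkC/= mul0r addr0.
  apply: (@dominated_L2r _ D); first exact: contM enorm_continuous cB0.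
  by move=> x; exact: dominated_weighted hB.
Qed.

Lemma gradL2norm_mkC : gradL2norm (mkC A B) =
  Num.sqrt (\int[mu]_t (\sum_j (dA j (vec t) ^+ 2 + dB j (vec t) ^+ 2))).
Proof.
rewrite (gradL2normE mkC_weak_gradient); congr (Num.sqrt (fine _)).
by apply: eq_integral => t _; congr (_%:E); apply: eq_bigr => j _; rewrite mxE.
Qed.

Lemma L2norm_mkC : L2norm (mkC A B) = Num.sqrt (\int[mu]_t (A (vec t) ^+ 2 + B (vec t) ^+ 2)).
Proof.
rewrite /L2norm fine_L2enorm; congr (Num.sqrt (fine _)).
by apply: eq_integral => t _; rewrite normc_sqr.
Qed.

Lemma L2norm_weighted_mkC : L2norm (weighted (mkC A B)) =
  Num.sqrt (\int[mu]_t (enorm (vec t) ^+ 2 * (A (vec t) ^+ 2 + B (vec t) ^+ 2))).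
Proof.
rewrite /L2norm fine_L2enorm; congr (Num.sqrt (fine _)).
apply: eq_integral => t _; rewrite normc_sqr /weighted /mkC/= !mul0r subr0 addr0.
by rewrite !exprMn mulrDr.
Qed.

End Pair.

(** Dominated convergence with a majorant uniform over a neighbourhood []u, v[] of [t]; all
    hypotheses are local in time, as the bounds degenerate at the blow-up time. *)
Lemma integral_cvg0 (u v t C : R) (h : R -> 'cV[R]_n -> R) : u < t < v ->
  (forall s, u < s < v -> continuous (h s)) ->
  (forall s x, u < s < v -> 0 <= h s x <= C * weight x) ->
  (forall x s, u < s < v -> h r x @[r --> s] --> h s x) ->
  (forall x, h t x = 0) ->
  \int[mu]_y (h s (vec y)) @[s --> t] --> (0 : R).
Proof.
move=> tuv ch hC hcont ht.
have -> : 0 = \int[mu]_y (h t (vec y)).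
  by under eq_Rintegral do rewrite ht; rewrite Rintegral_cst//= mul0r.
have inI (s : R) : s \in (`]u, v[%classic : set R) -> u < s < v by rewrite inE/= in_itv.
apply: (@continuity_under_integral _ _ _ mu (fun s y => h s (vec y)) setT measurableT u v _ _ (fun y => C * weight (vec y))) => //.
- by move=> s; rewrite /= in_itv/= => suv; apply: (@le_weight_integrable (h s) C); [exact: ch|move=> x; exact: hC].
- by apply/aeW => y _ s /inI suv; exact: hcont.
- exact: weight_integrableZ.
- move=> s; rewrite /= in_itv/= => suv; apply/aeW => y _.
  by have /andP[h0 h1] := hC s (vec y) suv; rewrite ger0_norm.
- by rewrite inE/= in_itv.
Qed.

(** The difference from time [t] is again of class C^1 and dominated, with constant [2 (C + C)].
    Each of the three terms of the norm is then the root of an integral whose integrand tends to 0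
    pointwise under a fixed majorant. *)
Lemma Sigma_norm_cvg0 (u v t C : R) (A B : R -> 'cV[R]_n -> R) (dA dB : R -> 'I_n -> 'cV[R]_n -> R) :
  u < t < v ->
  (forall s, u < s < v -> c1grad (A s) (dA s)) ->
  (forall s, u < s < v -> c1grad (B s) (dB s)) ->
  (forall s, u < s < v -> dominated C (A s) (dA s)) ->
  (forall s, u < s < v -> dominated C (B s) (dB s)) ->
  (forall x s, u < s < v -> A r x @[r --> s] --> A s x) ->
  (forall x s, u < s < v -> B r x @[r --> s] --> B s x) ->
  (forall j x s, u < s < v -> dA r j x @[r --> s] --> dA s j x) ->
  (forall j x s, u < s < v -> dB r j x @[r --> s] --> dB s j x) ->
  Sigma_norm (mkC (A s) (B s) \- mkC (A t) (B t)) @[s --> t] --> (0 : R).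
Proof.
move=> tuv cA cB hA hB kA kB kdA kdB.
pose A1 s x := A s x - A t x; pose B1 s x := B s x - B t x.
pose dA1 s j x := dA s j x - dA t j x; pose dB1 s j x := dB s j x - dB t j x.
have cA1 s : u < s < v -> c1grad (A1 s) (dA1 s) by move=> /cA h; exact: c1gradB (cA t tuv).
have cB1 s : u < s < v -> c1grad (B1 s) (dB1 s) by move=> /cB h; exact: c1gradB (cB t tuv).
pose E := 2 * (C + C).
have hA1 s : u < s < v -> dominated E (A1 s) (dA1 s) by move=> /hA h; exact: dominatedB (hA t tuv).
have hB1 s : u < s < v -> dominated E (B1 s) (dB1 s) by move=> /hB h; exact: dominatedB (hB t tuv).
have kA1 x s : u < s < v -> A1 r x @[r --> s] --> A1 s x.
  by move=> suv; apply: cvgB; [exact: kA|exact: cvg_cst].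
have kB1 x s : u < s < v -> B1 r x @[r --> s] --> B1 s x.
  by move=> suv; apply: cvgB; [exact: kB|exact: cvg_cst].
have kdA1 j x s : u < s < v -> dA1 r j x @[r --> s] --> dA1 s j x.
  by move=> suv; apply: cvgB; [exact: kdA|exact: cvg_cst].
have kdB1 j x s : u < s < v -> dB1 r j x @[r --> s] --> dB1 s j x.
  by move=> suv; apply: cvgB; [exact: kdB|exact: cvg_cst].
have ksq (f : R -> R) s : f r @[r --> s] --> f s -> f r ^+ 2 @[r --> s] --> f s ^+ 2.
  by move=> fs; rewrite expr2; under eq_fun do rewrite expr2; exact: cvgM.
have sqrt0 (f : R -> R) : f s @[s --> t] --> (0 : R) -> Num.sqrt (f s) @[s --> t] --> (0 : R).
  by move=> f0; rewrite -[X in _ --> X]sqrtr0; apply: (@cvg_comp _ _ _ f Num.sqrt) f0 _; exact: sqrt_continuous.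
have L1 : \int[mu]_y (\sum_j (dA1 s j (vec y) ^+ 2 + dB1 s j (vec y) ^+ 2)) @[s --> t] --> (0 : R).
  apply: (@integral_cvg0 u v t (E + E) (fun s x => \sum_j (dA1 s j x ^+ 2 + dB1 s j x ^+ 2))) => //.
  - move=> s suv; apply: cont_sum => j; have [_ h1 _] := cA1 s suv; have [_ h2 _] := cB1 s suv.
    by apply: contD; exact: contX.
  - move=> s x suv; rewrite sumr_ge0/=; last by move=> j _; rewrite addr_ge0 ?sqr_ge0.
    have := hA1 s suv x; have := hB1 s suv x; rewrite big_split/=.
    have : 0 <= (1 + enorm x ^+ 2) * A1 s x ^+ 2 by rewrite mulr_ge0 ?sqr_ge0// addr_ge0// sqr_ge0.
    have : 0 <= (1 + enorm x ^+ 2) * B1 s x ^+ 2 by rewrite mulr_ge0 ?sqr_ge0// addr_ge0// sqr_ge0.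
    by rewrite mulrDl; lra.
  - move=> x s suv; apply: cvg_big => [|j _]; first exact: add_continuous.
    by apply: cvgD; apply: ksq; [exact: kdA1|exact: kdB1].
  - by move=> x; apply: big1 => j _; rewrite /dA1 /dB1 !subrr expr0n addr0.
have L2 : \int[mu]_y (enorm (vec y) ^+ 2 * (A1 s (vec y) ^+ 2 + B1 s (vec y) ^+ 2)) @[s --> t] --> (0 : R).
  apply: (@integral_cvg0 u v t (E + E) (fun s x => enorm x ^+ 2 * (A1 s x ^+ 2 + B1 s x ^+ 2))) => //.
  - move=> s suv; have [h1 _ _] := cA1 s suv; have [h2 _ _] := cB1 s suv.
    apply: contM; first by apply: contX; exact: enorm_continuous.
    by apply: contD; exact: contX.
  - move=> s x suv; rewrite mulr_ge0 ?sqr_ge0 ?addr_ge0 ?sqr_ge0//= mulrDr -!exprMn mulrDl.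
    by apply: lerD; [exact: dominated_weighted (hA1 s suv)|exact: dominated_weighted (hB1 s suv)].
  - move=> x s suv; apply: cvgM; first exact: cvg_cst.
    by apply: cvgD; apply: ksq; [exact: kA1|exact: kB1].
  - by move=> x; rewrite /A1 /B1 !subrr expr0n addr0 mulr0.
have L3 : \int[mu]_y (A1 s (vec y) ^+ 2 + B1 s (vec y) ^+ 2) @[s --> t] --> (0 : R).
  apply: (@integral_cvg0 u v t (E + E) (fun s x => A1 s x ^+ 2 + B1 s x ^+ 2)) => //.
  - move=> s suv; have [h1 _ _] := cA1 s suv; have [h2 _ _] := cB1 s suv.
    by apply: contD; exact: contX.
  - move=> s x suv; rewrite addr_ge0 ?sqr_ge0//= mulrDl.
    by apply: lerD; [exact: dominated_fun (hA1 s suv)|exact: dominated_fun (hB1 s suv)].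
  - move=> x s suv; by apply: cvgD; apply: ksq; [exact: kA1|exact: kB1].
  - by move=> x; rewrite /A1 /B1 !subrr expr0n addr0.
have H : (Num.sqrt (\int[mu]_y (\sum_j (dA1 s j (vec y) ^+ 2 + dB1 s j (vec y) ^+ 2))) +
  Num.sqrt (\int[mu]_y (enorm (vec y) ^+ 2 * (A1 s (vec y) ^+ 2 + B1 s (vec y) ^+ 2))) +
  Num.sqrt (\int[mu]_y (A1 s (vec y) ^+ 2 + B1 s (vec y) ^+ 2))) @[s --> t] --> (0 : R).
  rewrite -[X in _ --> X]addr0; apply: cvgD; last exact: sqrt0 L3.
  by rewrite -[X in _ --> X]addr0; apply: cvgD; [exact: sqrt0 L1|exact: sqrt0 L2].
apply: (cvg_trans _ H); apply: near_eq_cvg.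
have near_uv : \forall s \near t, s \in `]u, v[ by apply: near_in_itvoo; rewrite in_itv.
near=> s; have suv : u < s < v by rewrite -[_ < _ < _]/(s \in `]u, v[); near: s.
have -> : mkC (A s) (B s) \- mkC (A t) (B t) = mkC (A1 s) (B1 s) by apply/funext => x.
rewrite /Sigma_norm (gradL2norm_mkC (cA1 s suv) (cB1 s suv) (hA1 s suv) (hB1 s suv)).
by rewrite L2norm_weighted_mkC L2norm_mkC.
Unshelve. all: by end_near. Qed.

End SigmaFunctions.

(** * Maximality *)

Section Maximality.
Variables (R : realType) (n : nat) (gamma : R) (M : 'M[R]_n).
Local Notation mu := (lebesgueRn R n).

Lemma Sigma_norm_ge_grad (f : 'cV[R]_n -> R[i]) : gradL2norm f <= Sigma_norm f.
Proof.
by rewrite /Sigma_norm -addrA lerDl addr_ge0// /L2norm fine_L2enorm sqrtr_ge0.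
Qed.

Lemma gradL2norm_ge0 (f : 'cV[R]_n -> R[i]) : 0 <= gradL2norm f.
Proof. by rewrite /gradL2norm fine_L2enorm sqrtr_ge0. Qed.

Lemma blowup_not_extendable (T T' : R) (u v : R -> 'cV[R]_n -> R[i]) : 0 < T -> T < T' ->
  (forall t, 0 <= t < T -> inSigma (u t)) -> gradL2norm (u t) @[t --> T^'-] --> +oo ->
  solution gamma M T' v ->
  ~ (forall t, 0 <= t < T -> {ae mu, forall x, v t (vec x) = u t (vec x)}).
Proof.
move=> T0 TT' uS uoo [vS vcont _] vu.
have TI : 0 <= T < T' by rewrite ltW.
have /cvgr_lt/(_ 1 ltr01) vT := vcont T TI.
have [[LvT [GT wT]] _] := vS T TI.
(* [gradL2norm_le] with [v s] within distance 1 of [v T] bounds the squared gradient norm by [K]; as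
   [1 <= K], the norm itself is at most [K]. *)
pose K := 2 + 2 * gradL2norm (v T) ^+ 2.
have K1 : 1 <= K by rewrite /K; have := sqr_ge0 (gradL2norm (v T)); lra.
have bd : \forall s \near T^'-, gradL2norm (u s) <= K.
  have vT' : \forall s \near T, s \in `[0, T'[ -> Sigma_norm (v s \- v T) < 1.
    by move: vT; rewrite !near_withinE; apply: filterS => s H sI; exact: H.
  near=> s.
  have s0 : 0 <= s by near: s; exact: nbhs_left_ge.
  have sT : s < T by near: s; exact: nbhs_left_lt.
  have sI : 0 <= s < T' by rewrite s0 (lt_trans sT).
  have H : Sigma_norm (v s \- v T) < 1.
    have : s \in `[0, T'[ by rewrite in_itv.
    near: s; apply: (@cvg_at_left_filter _ _ id T T) => //.
  have [[Lv [G wG]] _] := vS s sI.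
  have [[Lu _] _] : inSigma (u s) by apply: uS; rewrite s0.
  have vus : {ae mu, forall x, v s (vec x) = u s (vec x)} by apply: vu; rewrite s0.
  have wu := is_weak_gradient_ae Lv Lu vus wG.
  rewrite (gradL2normE wu) -(gradL2normE wG).
  have := gradL2norm_le wG wT Lv LvT.
  have := le_lt_trans (Sigma_norm_ge_grad _) H; have := gradL2norm_ge0 (v s \- v T).
  set a := gradL2norm (v s); set b := gradL2norm (_ \- _) => b0 b1 H2.
  have : a ^+ 2 <= K by rewrite /K; nra.
  by have := gradL2norm_ge0 (v s); rewrite -/a; nra.
have /cvgryPgt/(_ K) big := uoo.
have : \forall s \near T^'-, False.
  by apply: filterS2 bd big => s /le_lt_trans /[apply]; rewrite ltxx.
by move=> /filter_ex[].
Unshelve. all: by end_near. Qed.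

End Maximality.

(** * Decay of the ground state *)

Section Monotone.
Variable R : realType.

Lemma is_derive_mvt (f df : R -> R) (a b : R) : a <= b ->
  (forall x : R, a <= x <= b -> is_derive x 1 f (df x)) ->
  exists2 c, a <= c <= b & f b - f a = df c * (b - a).
Proof.
move=> ab f'.
have cf : {within `[a, b], continuous f}.
  apply: derivable_within_continuous => x; rewrite in_itv/= => xab.
  by have [] := f' x xab.
have f'oo x : x \in `]a, b[ -> is_derive x 1 f (df x).
  by rewrite in_itv/= => /andP[/ltW ax /ltW xb]; apply: f'; rewrite ax.
by have [c] := MVT_segment ab f'oo cf; rewrite in_itv/= => cab E; exists c.
Qed.

Lemma is_derive_le0_le (f df : R -> R) (a b : R) : a <= b ->
  (forall x : R, a <= x <= b -> is_derive x 1 f (df x)) -> (forall x : R, a <= x <= b -> df x <= 0) ->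
  f b <= f a.
Proof.
move=> ab f' df0; have [c cab E] := is_derive_mvt ab f'.
by rewrite -subr_le0 E mulr_le0_ge0 ?subr_ge0// df0.
Qed.

Lemma is_derive_ge0_le (f df : R -> R) (a b : R) : a <= b ->
  (forall x : R, a <= x <= b -> is_derive x 1 f (df x)) -> (forall x : R, a <= x <= b -> 0 <= df x) ->
  f a <= f b.
Proof.
move=> ab f' df0; have [c cab E] := is_derive_mvt ab f'.
by rewrite -subr_ge0 E mulr_ge0 ?subr_ge0// df0.
Qed.

Lemma is_derive_lipschitz (f df : R -> R) (a b B : R) : a <= b ->
  (forall x : R, a <= x <= b -> is_derive x 1 f (df x)) -> (forall x : R, a <= x <= b -> `|df x| <= B) ->
  `|f b - f a| <= B * (b - a).
Proof.
move=> ab f' dfB; have [c cab ->] := is_derive_mvt ab f'.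
by rewrite normrM (@ger0_norm _ (b - a)) ?subr_ge0// ler_wpM2r ?subr_ge0// dfB.
Qed.

Lemma continuous_bounded_seg (f : R -> R) (a b : R) : continuous f ->
  exists2 B, 0 <= B & forall x, a <= x <= b -> `|f x| <= B.
Proof.
move=> cf; have /compact_bounded[M [_ HM]] : compact (f @` `[a, b]).
  by apply: continuous_compact; [exact: continuous_subspaceT|exact: segment_compact].
exists (`|M| + 1) => [|x xr]; first by rewrite addr_ge0.
by apply: HM; [rewrite ltr_pwDr// ler_norm|exists x => //; rewrite /= in_itv].
Qed.

End Monotone.

(** * Bounds and decay for the radial equation *)

Section RadialODE.
Variables (R : realType) (q q1 q2 : R -> R) (m : nat) (a : R).
Hypothesis a0 : 0 < a.
Hypothesis q' : forall r : R, is_derive r 1 q (q1 r).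
Hypothesis q1' : forall r : R, is_derive r 1 q1 (q2 r).
Hypothesis qpos : forall r : R, 0 < q r.
Hypothesis ode : forall r : R, 0 < r -> q2 r + m%:R * (q1 r / r) = q r - q r `^ (1 + a).

(* The energy [q1 ^+ 2 / 2 + F q], with [F' q = - q + q `^ (1 + a)], does not increase. *)
Lemma radial_bounded : exists2 B, 0 <= B & forall r, 0 <= r -> `|q r| <= B /\ `|q1 r| <= B.
Proof.
pose E (r : R) := 2^-1 * q1 r ^+ 2 + - (2^-1 * q r ^+ 2) + (2 + a)^-1 * q r `^ (2 + a).
have a2 : 2 + a != 0 by rewrite gt_eqF// addr_gt0.
have E' (r : R) : 1 <= r -> is_derive r 1 E (- m%:R * (q1 r ^+ 2 / r)).
  move=> r1; have r0 : 0 < r by exact: lt_le_trans r1.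
  have D1 := is_derive_scale 2^-1 (is_derive_pow 2 (q1' r)).
  have D2 := is_derive_scale 2^-1 (is_derive_pow 2 (q' r)).
  have D3 := is_derive_scale (2 + a)^-1 (is_derive_comp1 (is_derive1_powR (2 + a) (qpos r)) (q' r)).
  have := is_derive_add (is_derive_add D1 (is_derive_opp D2)) D3.
  move=> /is_derive_eq; apply.
  have := ode r0; rewrite (_ : 2 + a - 1 = 1 + a); last by ring.
  move=> H; have -> : q2 r = q r - q r `^ (1 + a) - m%:R * (q1 r / r) by rewrite -H; ring.
  by rewrite /= ?expr1; field; rewrite a2 gt_eqF.
(* The comparison starts at 1, away from the singular coefficient at the origin; on [[0, 1]]
   continuity bounds [q] and [q1]. *)
have EB (r : R) : 1 <= r -> E r <= E 1.
  move=> r1; apply: (is_derive_le0_le r1 (df := fun r => - m%:R * (q1 r ^+ 2 / r))).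
    by move=> x /andP[x1 _]; exact: E'.
  move=> x /andP[x1 _]; rewrite mulNr oppr_le0 mulr_ge0// divr_ge0 ?sqr_ge0//.
  exact: le_trans x1.
(* Above this threshold [q ^ a >= 2 + a], so the power term of the energy is at least [q ^ 2] and
   the energy at least [q ^ 2 / 2]; hence [q ^ 2 <= 2 * E 1]. *)
pose K := (2 + a) `^ a^-1.
have qB (r : R) : 1 <= r -> q r <= K + `|2 * E 1| + 1.
  move=> r1; have [qK|Kq] := leP (q r) K.
    by apply: (le_trans qK); rewrite -addrA lerDl addr_ge0.
  have H : 2 + a <= q r `^ a.
    have K0 : 0 <= K by exact: powR_ge0.
    have := ge0_ler_powR (ltW a0) K0 (ltW (qpos r)) (ltW Kq).
    by rewrite /K -powRrM mulVf ?gt_eqF// powRr1// addr_ge0// ltW.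
  have H2 : q r ^+ 2 <= (2 + a)^-1 * q r `^ (2 + a).
    rewrite mulrC ler_pdivlMr ?addr_gt0// [in X in _ <= X]powRD; last by apply/implyP => _; rewrite gt_eqF.
    by rewrite powR_mulrn ?(ltW (qpos r))// ler_wpM2l// sqr_ge0.
  have := EB r r1; rewrite {1}/E => H3.
  have H4 : q r ^+ 2 <= `|2 * E 1|.
    apply: le_trans (ler_norm _); have := sqr_ge0 (q1 r); lra.
  have H5 : 0 <= K by exact: powR_ge0.
  have := qpos r; set c := `|_| in H4 *; nra.
have cq : continuous q by exact: is_derive_cont1 q'.
have cq1 : continuous q1 by exact: is_derive_cont1 q1'.
have [B1 B10 HB1] := continuous_bounded_seg 0 1 cq.
have [B2 B20 HB2] := continuous_bounded_seg 0 1 cq1.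
pose B3 := K + `|2 * E 1| + 1.
have K0 : 0 <= K by exact: powR_ge0.
have B30 : 0 <= B3 by rewrite !addr_ge0.
(* [B1] and [B2] serve on [[0, 1]], [B3] bounds [q] beyond, and the last group bounds [q1]: its
   square is at most [2 * E 1 + q ^ 2], and [c ^ 2 <= d] implies [c <= d + 1]. *)
exists (B1 + B2 + B3 + (`|2 * E 1| + B3 ^+ 2 + 1)).
  by rewrite !addr_ge0 ?sqr_ge0.
have B3s := sqr_ge0 B3; have E1n := normr_ge0 (2 * E 1).
move=> r r0; have [r1|/ltW r1] := leP r 1.
  have := HB1 r; have := HB2 r; rewrite r0 r1 => /(_ isT) ? /(_ isT) ?; split; lra.
have qr := qB r r1; rewrite -/B3 in qr; have q0 := qpos r.
split; first by rewrite ger0_norm ?ltW//; lra.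
have := EB r r1; rewrite {1}/E => H3.
have H0 : 0 <= (2 + a)^-1 * q r `^ (2 + a).
  by rewrite mulr_ge0 ?powR_ge0// invr_ge0 addr_ge0// ltW.
have H1 : q1 r ^+ 2 <= 2 * E 1 + q r ^+ 2 by lra.
have H2 : q r ^+ 2 <= B3 ^+ 2 by rewrite ler_sqr ?nnegrE// ltW.
have H4 := ler_norm (2 * E 1).
have : `|q1 r| ^+ 2 <= `|2 * E 1| + B3 ^+ 2 by rewrite real_normK ?num_real//; lra.
have := normr_ge0 (q1 r); set c := `|q1 r|; set d := `|2 * E 1| + _ => c0 cd.
have d0 : 0 <= d by apply: le_trans cd; exact: sqr_ge0.
have : c <= d + 1 by nra.
by lra.
Qed.

Hypothesis q_cvg0 : forall e, 0 < e -> exists r0, forall r, r0 <= r -> q r < e.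

(* Far out [q1 < 0] and [q2 >= q / 2], so [q1 ^+ 2 - q ^+ 2 / 2] decreases to a nonnegative
   limit and [q1 <= - q / 2]. *)
Lemma radial_decay : exists2 C, 0 <= C & forall r, 0 <= r ->
  `|q r| <= C * expR (- (r / 2)) /\ `|q1 r| <= C * expR (- (r / 2)).
Proof.
have i2 : 0 < 2^-1 :> R by rewrite invr_gt0.
(* Below the threshold [2^-1] to the power [a^-1] one has [q ^ a <= 1 / 2], so the nonlinear term is
   at most half of [q]. *)
have [r0 Hr0] := q_cvg0 (powR_gt0 a^-1 i2).
pose R0 := `|r0| + 1.
have R01 : 1 <= R0 by rewrite /R0 lerDr.
have R0r (r : R) : R0 <= r -> 0 < r.
  by move=> rR; apply: lt_le_trans rR; apply: lt_le_trans R01.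
have small (r : R) : R0 <= r -> q r / 2 <= q r - q r `^ (1 + a).
  move=> rR; have /Hr0 qr : r0 <= r.
    by apply: le_trans rR; rewrite /R0 (le_trans (ler_norm _))// lerDl.
  have := ge0_ler_powR (ltW a0) (ltW (qpos r)) (powR_ge0 _ _) (ltW qr).
  rewrite -powRrM mulVf ?gt_eqF// powRr1 ?(ltW i2)// => H.
  rewrite powRD; last by apply/implyP => _; rewrite gt_eqF.
  rewrite powRr1 ?(ltW (qpos r))//; have := qpos r; nra.
have q1_neg (r : R) : R0 <= r -> q1 r < 0.
  move=> rR; rewrite ltNge; apply/negP => q1r.
  (* The equation in divergence form: the derivative of [s ^ m * q1] is [s ^ m] times a quantity
     nonnegative beyond [R0]. If [q1] were nonnegative at [r] it would remain so, and [q],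
     nondecreasing and positive, could not tend to 0. *)
  pose w (s : R) := s ^+ m * q1 s.
  have w' (s : R) : R0 <= s -> is_derive s 1 w (s ^+ m * (q s - q s `^ (1 + a))).
    move=> sR; have s0 := R0r s sR.
    have := is_derive_mul (is_derive_pow m (is_derive_id s (1 : R))) (q1' s).
    move=> /is_derive_eq; apply; rewrite -(ode s0) mulr1.
    case: {+}m => [|k] /=; first by rewrite !expr0; ring.
    by rewrite exprS; field; rewrite gt_eqF.
  have q1_ge0 (s : R) : r <= s -> 0 <= q1 s.
    move=> rs; have sR := le_trans rR rs; have s0 := R0r s sR.
    have : w r <= w s.
      apply: (is_derive_ge0_le rs (df := fun s => s ^+ m * (q s - q s `^ (1 + a)))).
        by move=> x /andP[rx _]; apply: w'; exact: le_trans rx.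
      move=> x /andP[rx _]; have xR := le_trans rR rx.
      rewrite mulr_ge0 ?exprn_ge0 ?(ltW (R0r x xR))//.
      by apply: le_trans (small x xR); rewrite divr_ge0// ltW.
    rewrite /w => H; have : 0 <= s ^+ m * q1 s.
      by apply: le_trans H; rewrite mulr_ge0// exprn_ge0// ltW// R0r.
    by rewrite pmulr_rge0// exprn_gt0.
  have [s0 Hs0] := q_cvg0 (qpos r).
  have rs : r <= Num.max r s0 by rewrite le_max lexx.
  have : q (Num.max r s0) < q r by apply: Hs0; rewrite le_max lexx orbT.
  rewrite ltNge; move/negP; apply.
  apply: (@is_derive_ge0_le _ q q1 _ _ rs (fun x _ => q' x)).
  by move=> x /andP[rx _]; exact: q1_ge0.
have q2_ge (r : R) : R0 <= r -> q r / 2 <= q2 r.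
  move=> rR; have r0' := R0r r rR; have := ode r0'; have := small r rR.
  have : 0 <= - (m%:R * (q1 r / r)).
    by rewrite -mulrN; apply: mulr_ge0 => //; rewrite -mulNr divr_ge0 ?(ltW r0')// oppr_ge0 ltW// q1_neg.
  lra.
have F_ge0 (r : R) : R0 <= r -> q r ^+ 2 / 2 <= q1 r ^+ 2.
  move=> rR; pose F (s : R) := q1 s ^+ 2 + - (2^-1 * q s ^+ 2).
  have F' (s : R) : is_derive s 1 F (2%:R * q1 s ^+ 2.-1 * q2 s + - (2^-1 * (2%:R * q s ^+ 2.-1 * q1 s))).
    apply: is_derive_add (is_derive_pow 2 (q1' s)) _.
    by apply: is_derive_opp; apply: is_derive_scale; exact: is_derive_pow.
  have Fdec (s : R) : r <= s -> F s <= F r.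
    move=> rs; apply: (is_derive_le0_le rs (fun x _ => F' x)).
    move=> x /andP[rx _]; have xR := le_trans rR rx; rewrite /= !expr1.
    have := q2_ge x xR; have := q1_neg x xR; nra.
  have : 0 <= F r; last by rewrite /F; lra.
  apply/ler_addgt0Pl => e e0.
  (* With [q] below both 1 and [e], [q ^ 2 / 2] is below [e], so [F] at the later point exceeds
     [- e]. *)
  have e1 : 0 < Num.min 1 e by rewrite lt_min ltr01.
  have [s0 Hs0] := q_cvg0 e1.
  have rs : r <= Num.max r s0 by rewrite le_max lexx.
  have : q (Num.max r s0) < Num.min 1 e by apply: Hs0; rewrite le_max lexx orbT.
  rewrite lt_min => /andP[qs1 qse]; have := Fdec _ rs; rewrite /F.
  have := qpos (Num.max r s0); have := sqr_ge0 (q1 (Num.max r s0)); nra.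
(* The energy inequality gives the rate [1 / sqrt 2]; it is weakened to the rational rate
   [1 / 2]. *)
have q1_le (r : R) : R0 <= r -> q1 r <= - (q r / 2).
  by move=> rR; have := F_ge0 r rR; have := q1_neg r rR; have := qpos r; nra.
pose C1 := q R0 * expR (R0 / 2).
have C10 : 0 <= C1 by rewrite mulr_ge0 ?expR_ge0// ltW.
have exp' (r : R) : is_derive r 1 (fun r => expR (2^-1 * r)) (expR (2^-1 * r) * (2^-1 * 1)).
  exact: is_derive_comp1 (is_derive_expR _) (is_derive_scale _ (is_derive_id r (1 : R))).
have qdecay (r : R) : R0 <= r -> q r <= C1 * expR (- (r / 2)).
  move=> rR; rewrite expRN ler_pdivlMr ?expR_gt0// /C1.
  rewrite (mulrC r) (mulrC R0).
  apply: (is_derive_le0_le rR (fun x _ => is_derive_mul (q' x) (exp' x))).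
  move=> x /andP[xR _]; have := q1_le x xR; have := expR_gt0 (2^-1 * x); nra.
(* On [[r - 1, r]] the mean value theorem gives a point where [q1 = q r - q (r - 1)]; as [q1] is
   negative and nondecreasing, [|q1 r| <= q (r - 1)]. The unit shift costs the factor
   [expR 2^-1]. *)
have q1decay (r : R) : R0 + 1 <= r -> `|q1 r| <= C1 * expR 2^-1 * expR (- (r / 2)).
  move=> rR; have r1 : R0 <= r - 1 by lra.
  have rr1 : r - 1 <= r by lra.
  rewrite ltr0_norm ?q1_neg//; last by lra.
  have [c /andP[c1 c2]] := is_derive_mvt rr1 (fun x _ => q' x).
  have q1c : q1 c <= q1 r.
    apply: (is_derive_ge0_le c2 (fun x _ => q1' x)) => x /andP[cx _].
    have xR : R0 <= x by lra.
    by apply: le_trans (q2_ge x xR); rewrite divr_ge0// ltW.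
  have := qdecay (r - 1) r1; have := qpos r.
  rewrite -mulrA -expRD (_ : - ((r - 1) / 2) = 2^-1 + - (r / 2)); last by field.
  nra.
have [B B0 HB] := radial_bounded.
(* Chosen so that [C2 * expR (- (r / 2))] is at least [B] up to [r = R0 + 1], where the exponential
   estimates take over. *)
pose C2 := B * expR ((R0 + 1) / 2).
have C20 : 0 <= C2 by rewrite mulr_ge0// expR_ge0.
have C30 : 0 <= C1 * expR 2^-1 by rewrite mulr_ge0// expR_ge0.
exists (C1 + C2 + C1 * expR 2^-1); first by rewrite !addr_ge0.
move=> r rge0; have Er := expR_ge0 (- (r / 2)).
have P1 := mulr_ge0 C10 Er; have P2 := mulr_ge0 C20 Er; have P3 := mulr_ge0 C30 Er.
rewrite !mulrDl.
have [rR|Rr] := leP r (R0 + 1).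
  have [h1 h2] := HB r rge0.
  have : B <= C2 * expR (- (r / 2)).
    rewrite /C2 -mulrA -expRD ler_peMr// -[leLHS]expR0 ler_expR; lra.
  by split; lra.
have rR : R0 <= r by move: Rr; lra.
have := qdecay r rR; have := q1decay r (ltW Rr); rewrite (gtr0_norm (qpos r)).
by split; lra.
Qed.

End RadialODE.

(** * The Euclidean norm and its derivatives *)

Section EnormDerivative.
Variables (R : realType) (n : nat).
Implicit Types x : 'cV[R]_n.

Lemma is_derive_coord (i j : 'I_n) x : is_derive x (delta_mx j 0) (fun x => x i 0) (i == j)%:R.
Proof.
have x0 : 0 *: delta_mx j 0 + x = x by rewrite scale0r add0r.
rewrite -{1}x0; apply/(is_derive_lineP (fun x => x i 0) x (delta_mx j 0) 0).
rewrite (_ : (fun h : R => _) = fun h : R => (i == j)%:R * h + x i 0); last first.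
  by apply/funext => h; rewrite !mxE eqxx andbT mulrC.
have := is_derive_add (is_derive_scale (i == j)%:R (is_derive_id (0 : R) (1 : R))) (is_derive_cstr (x i 0) (0 : R) (1 : R)).
by rewrite mulr1 addr0.
Qed.

Lemma is_derive_enorm_sqr j x : is_derive x (delta_mx j 0) (fun x => enorm x ^+ 2) (2 * x j 0).
Proof.
rewrite (_ : (fun x => _) = fun x => \sum_i x i 0 ^+ 2); last by apply/funext => y; rewrite enorm_sqr.
have := is_derive_bigsum (fun i => is_derive_pow 2 (is_derive_coord i j x)).
move=> /is_derive_eq; apply; rewrite (bigD1 j)//= eqxx mulr1 big1 ?addr0 ?expr1//.
by move=> i /negbTE ->; rewrite mulr0.
Qed.

Lemma is_derive_enorm j x : 0 < enorm x -> is_derive x (delta_mx j 0) (@enorm R n) (x j 0 / enorm x).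
Proof.
move=> x0; rewrite (_ : @enorm R n = fun x => Num.sqrt (enorm x ^+ 2)); last first.
  by apply/funext => y; rewrite sqrtr_sqr ger0_norm// enorm_ge0.
have x20 : 0 < enorm x ^+ 2 by rewrite exprn_gt0.
have := @is_derive_comp1 _ _ Num.sqrt (fun x => enorm x ^+ 2) x _ _ _ (is_derive1_sqrt x20) (is_derive_enorm_sqr j x).
move=> /is_derive_eq; apply; rewrite sqrtr_sqr ger0_norm ?enorm_ge0//.
by field; rewrite gt_eqF.
Qed.

Lemma enorm_eq0 x : enorm x = 0 -> x = 0.
Proof.
move=> /(congr1 (fun y => y ^+ 2)); rewrite enorm_sqr expr0n/= => /eqP.
rewrite psumr_eq0; last by move=> i _; exact: sqr_ge0.
move=> /allP H; apply/matrixP => i j; rewrite ord1 mxE.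
by have := H i (mem_index_enum _); rewrite sqrf_eq0 => /eqP.
Qed.

Lemma enormZ (c : R) x : 0 <= c -> enorm (c *: x) = c * enorm x.
Proof.
move=> c0; rewrite /enorm (_ : \sum_i _ = c ^+ 2 * \sum_i x i 0 ^+ 2).
  by rewrite sqrtrM ?sqr_ge0// sqrtr_sqr ger0_norm.
by rewrite mulr_sumr; apply: eq_bigr => i _; rewrite mxE exprMn.
Qed.

Lemma enorm_line j (r : R) : enorm (r *: delta_mx j 0 : 'cV[R]_n) = `|r|.
Proof.
rewrite /enorm (bigD1 j)//= big1 ?addr0; last first.
  by move=> i /negbTE ij; rewrite !mxE ij mulr0 expr0n.
by rewrite !mxE !eqxx mulr1 sqrtr_sqr.
Qed.

Lemma coord_le_enorm i x : `|x i 0| <= enorm x.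
Proof.
rewrite -(@ler_sqr _ `|_|) ?nnegrE ?enorm_ge0// real_normK ?num_real// enorm_sqr (bigD1 i)//= lerDl.
by apply: sumr_ge0 => j _; exact: sqr_ge0.
Qed.

End EnormDerivative.

(** * From the elliptic equation to the radial one, and decay to zero *)

Section GroundState.
Variables (R : realType) (m : nat) (Q : 'cV[R]_m.+1 -> R).
Hypothesis gsQ : ground_state Q.
Local Notation n := m.+1.
Local Notation mu := (lebesgueRn R n).
Local Notation e0 := (delta_mx ord0 0 : 'cV[R]_n).

(** Restriction to the whole first axis, negative [r] included: derivatives are two-sided even at 0,
    where evenness then makes the first one vanish. *)
Definition profile (r : R) : R := Q (r *: e0).
Definition profile1 (r : R) : R := partial ord0 Q (r *: e0).
Definition profile2 (r : R) : R := partials [:: ord0; ord0] Q (r *: e0).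

Lemma ground_state_derive j x : is_derive x (delta_mx j 0) Q (partial j Q x).
Proof. by have [[[dQ _] _] _ _ _] := gsQ; apply: derivableP; exact: (dQ [::]). Qed.

Lemma ground_state_derive2 i j x : is_derive x (delta_mx j 0) (partial i Q) (partials [:: j; i] Q x).
Proof. by have [[[dQ _] _] _ _ _] := gsQ; apply: derivableP; exact: (dQ [:: i]). Qed.

Lemma ground_state_cont s : (size s <= 2)%N -> continuous (partials s Q).
Proof. by have [[[_ cQ] _] _ _ _] := gsQ; exact: cQ. Qed.

Lemma ground_state_gt0 x : 0 < Q x.
Proof. by have [_ + _ _] := gsQ; exact. Qed.

Lemma profileE x : Q x = profile (enorm x).
Proof. by have [_ _ + _] := gsQ; apply; rewrite enorm_line ger0_norm// enorm_ge0. Qed.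

Lemma profile_derive (r : R) : is_derive r 1 profile (profile1 r).
Proof.
have := (is_derive_lineP Q 0 e0 r (profile1 r)).1.
rewrite addr0 (_ : (fun h => _) = profile); last by apply/funext => h; rewrite addr0.
by apply; exact: ground_state_derive.
Qed.

Lemma profile1_derive (r : R) : is_derive r 1 profile1 (profile2 r).
Proof.
have := (is_derive_lineP (partial ord0 Q) 0 e0 r (profile2 r)).1.
rewrite addr0 (_ : (fun h => _) = profile1); last by apply/funext => h; rewrite addr0.
by apply; exact: ground_state_derive2.
Qed.

Lemma profile_even (r : R) : profile (- r) = profile r.
Proof. by have [_ _ + _] := gsQ; apply; rewrite !enorm_line normrN. Qed.

Lemma profile1_0 : profile1 0 = 0.
Proof.
have h := profile_derive 0.
have h' : is_derive (0 : R) 1 (fun r => profile (- r)) (profile1 (- 0) * - 1).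
  by apply: is_derive_comp1 (profile_derive _) _; apply: is_derive_opp; exact: is_derive_id.
have E : (fun r => profile (- r)) = profile by apply/funext => r; exact: profile_even.
rewrite E oppr0 in h'.
have := @derive_val _ _ _ _ _ _ _ h; rewrite (@derive_val _ _ _ _ _ _ _ h').
by lra.
Qed.

(* At the origin the quotient is [0 / 0 = 0], which is the right value. *)
Lemma partial_radial j x : partial j Q x = profile1 (enorm x) * (x j 0 / enorm x).
Proof.
have := enorm_ge0 x; rewrite le_eqVlt => /orP[/eqP/esym x0|x0].
  rewrite x0 profile1_0 mul0r (enorm_eq0 x0).
  (* By radiality [Q] restricts to the same [profile] on every axis. *)
  have h := (is_derive_lineP Q 0 (delta_mx j 0) 0 (partial j Q 0)).1.
  rewrite scale0r addr0 (_ : (fun h => _) = profile) in h; last first.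
    by apply/funext => r; rewrite addr0 /profile; have [_ _ + _] := gsQ; apply; rewrite !enorm_line.
  have h1 := h (ground_state_derive j 0).
  have := @derive_val _ _ _ _ _ _ _ h1.
  by rewrite (@derive_val _ _ _ _ _ _ _ (profile_derive 0)) profile1_0.
have := @is_derive_comp1 _ _ profile (@enorm R n) x _ _ _ (profile_derive (enorm x)) (is_derive_enorm j x0).
rewrite (_ : (fun y => _) = Q); last by apply/funext => y; rewrite -profileE.
by move=> h; rewrite /partial (@derive_val _ _ _ _ _ _ _ h).
Qed.

(** In the derivative of [profile1 (enorm x) * (x_j / enorm x)] at a point with [x_j = 0], only the
    term differentiating [x_j] survives. The [m] transverse directions thus produce the first-order
    term of the radial equation. *)
Lemma partial2_transverse j (r : R) : j != ord0 -> 0 < r ->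
  partials [:: j; j] Q (r *: e0) = profile1 r / r.
Proof.
move=> j0 r0; set x := r *: e0.
have xr : enorm x = r by rewrite enorm_line gtr0_norm.
have x0 : 0 < enorm x by rewrite xr.
have xj : x j 0 = 0 by rewrite !mxE (negbTE j0) mulr0.
have xn0 : enorm x != 0 by rewrite gt_eqF.
have d1 := @is_derive_comp1 _ _ profile1 (@enorm R n) x _ _ _ (profile1_derive (enorm x)) (is_derive_enorm j x0).
have d2 := is_derive_mul (is_derive_coord j j x) (is_derive_inv xn0 (is_derive_enorm j x0)).
have := is_derive_mul d1 d2.
rewrite (_ : (fun y => _) = partial j Q); last by apply/funext => y; rewrite partial_radial.
move=> h; rewrite /= {1}/partial (@derive_val _ _ _ _ _ _ _ h) xj eqxx xr.
by rewrite !(mul0r, mulr0) addr0 add0r mul1r.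
Qed.

Lemma profile_ode (r : R) : 0 < r ->
  profile2 r + m%:R * (profile1 r / r) = profile r - profile r `^ (1 + 4 / n%:R).
Proof.
move=> r0; have [_ _ _ eqQ] := gsQ.
have := eqQ (r *: e0); rewrite /laplacian big_ord_recl.
rewrite (eq_bigr (fun=> profile1 r / r)); last by move=> i _; rewrite partial2_transverse.
rewrite sumr_const card_ord -mulr_natl -/(profile r) -/(profile2 r); lra.
Qed.

(** A box resting on the point at distance [r] on the first axis: its measure [d * (2 d) ^ m] does
    not depend on [r], while the norm varies on it by at most [n * d]. *)
Definition slab (r d : R) : set (n.-tuple R) :=
  [set t | forall i : 'I_n, (if i == ord0 then `[r, r + d] else `[- d, d])%classic (tnth t i)].

Lemma slab_measurable r d : measurable (slab r d).
Proof.
rewrite (_ : slab r d = \bigcap_(i in [set: 'I_n]) [set t : n.-tuple R | (if i == ord0 then `[r, r + d] else `[- d, d])%classic (tnth t i)]).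
  apply: fin_bigcap_measurable => // i _.
  by rewrite -[X in measurable X]setTI; apply: measurable_tnth => //; case: ifP.
by apply/seteqP; split => [t Bt i _|t Bt i] /=; [exact: Bt|exact: (Bt i I)].
Qed.

Lemma slab_measure r d : 0 < d -> mu (slab r d) = (\prod_(i < n) (if i == ord0 then d else d + d))%:E.
Proof.
move=> d0; rewrite /slab (lebesgueRn_box (A := fun i : 'I_n => (if i == ord0 then `[r, r + d] else `[- d, d])%classic)).
  rewrite (big_morph EFin EFinM erefl); apply: eq_bigr => i _; case: ifP => _.
    by rewrite lebesgue_measure_itv/= lte_fin ltrDl d0 -EFinB addrAC subrr add0r.
  by rewrite lebesgue_measure_itv/= lte_fin gtrN// -EFinB opprK.
by move=> i; case: ifP.
Qed.

Lemma slab_enorm r d t : 0 < r -> 0 < d -> slab r d t -> r <= enorm (vec t) <= r + n%:R * d.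
Proof.
move=> r0 d0 st; apply/andP; split.
  have := st ord0; rewrite /= ?eqxx /= in_itv/= => /andP[h _].
  apply: le_trans (coord_le_enorm ord0 _); rewrite mxE; apply: le_trans h _; exact: ler_norm.
rewrite -(@ler_sqr _ (enorm _)) ?nnegrE ?enorm_ge0//; last by rewrite addr_ge0 ?mulr_ge0 ?(ltW r0) ?(ltW d0).
rewrite enorm_sqr big_ord_recl.
apply: (@le_trans _ _ ((r + d) ^+ 2 + \sum_(i < m) d ^+ 2)).
  apply: lerD.
    have := st ord0; rewrite /= ?eqxx /= in_itv/= mxE => /andP[h1 h2].
    by rewrite ler_sqr ?nnegrE ?addr_ge0 ?(ltW r0) ?(ltW d0)// (le_trans (ltW r0)).
  apply: ler_sum => i _; have := st (lift ord0 i); rewrite /= in_itv/= mxE -ler_norml => h.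
  by rewrite -[leLHS]real_normK ?num_real// ler_sqr ?nnegrE ?(ltW d0).
rewrite sumr_const card_ord -mulr_natl -natr1.
have k0 : 0 <= m%:R :> R by [].
move: k0; set k := m%:R => k0.
have h1 := mulr_ge0 k0 (mulr_ge0 (ltW r0) (ltW d0)).
have h2 := mulr_ge0 k0 (sqr_ge0 d); have h3 := mulr_ge0 k0 h2.
rewrite -subr_ge0 (_ : _ - _ = 2 * (k * (r * d)) + k * (k * d ^+ 2) + k * d ^+ 2); last by ring.
by lra.
Qed.

(** If [profile r >= e] far out, the Lipschitz bound keeps [Q >= e / 2] on a slab of fixed measure,
    which contradicts the vanishing tails of the integral of [Q ^ 2]. *)
Lemma profile_cvg0 (e : R) : 0 < e -> exists r0, forall r, r0 <= r -> profile r < e.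
Proof.
move=> e0.
have [B B0 HB] := radial_bounded (divr_gt0 (ltr0n R 4) (ltr0Sn R m)) profile_derive profile1_derive
  (fun r => ground_state_gt0 _) profile_ode.
(* Across the slab the profile then varies by at most [B * (n * d) <= e / 2]; the 1 in [B + 1]
   guards against [B = 0]. *)
pose d := e / (2 * ((B + 1) * n%:R)).
have n0 : 0 < n%:R :> R by rewrite ltr0n.
have d0 : 0 < d by rewrite divr_gt0// mulr_gt0// mulr_gt0// ltr_wpDl.
pose k := \prod_(i < n) (if i == ord0 then d else d + d).
have k0 : 0 < k by apply: prodr_gt0 => i _; case: ifP => _ //; exact: addr_gt0.
have LQ : L2r Q.
  have [[_ [+ _]] _ _ _] := gsQ; move=> /inL2P[+ _].
  by rewrite (_ : ReF _ = Q)//; apply/funext => x.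
have IQ := L2r_integrable_sqr LQ.
(* Half-spaces decreasing to the empty set; the slab at [r] lies in [S j] once [r >= j]. *)
pose S (k : nat) : set (n.-tuple R) := [set t | k%:R <= tnth t ord0].
have mS j : measurable (S j).
  rewrite -[S j]setTI; have := @measurable_tnth _ R n ord0 measurableT _ (measurable_itv `[(j%:R : R), +oo[).
  by congr (measurable (_ `&` _)); apply/seteqP; split => t /=; rewrite in_itv/= andbT.
have tail : (\int[mu]_t ((Q (vec t) ^+ 2 * \1_(S j) t)%:E))%E @[j --> \oo] --> 0%E.
  rewrite -[X in _ --> X](integral0 mu setT).
  apply: (@dominated_cvg _ _ _ mu _ measurableT _ _ (fun t => (Q (vec t) ^+ 2)%:E)) => //.
  - move=> j; apply/measurable_EFinP; apply: measurable_funM; last exact: measurable_indic.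
    by apply: measurable_funX; exact: LQ.1.
  - move=> t _; apply: cvg_near_cst.
    exists (Num.truncn (tnth t ord0)).+1 => // j /= jt.
    rewrite indicE memNset ?mulr0// /S/= => h.
    have : tnth t ord0 < j%:R by apply: lt_le_trans (truncnS_gt _) _; rewrite ler_nat.
    by rewrite ltNge h.
  - move=> j t _; rewrite lee_fin normrM ger0_norm ?sqr_ge0// indicE.
    by case: (_ \in _); rewrite ?normr1 ?mulr1 ?normr0 ?mulr0 ?sqr_ge0.
have fin j : (\int[mu]_t ((Q (vec t) ^+ 2 * \1_(S j) t)%:E))%E \is a fin_num.
  apply: integrable_fin_num => //; apply: le_integrable IQ => //.
    apply/measurable_EFinP; apply: measurable_funM; last exact: measurable_indic.
    by apply: measurable_funX; exact: LQ.1.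
  move=> t _; rewrite lee_fin normrM indicE.
  by case: (_ \in _); rewrite ?normr1 ?mulr1 ?normr0 ?mulr0 ?normr_ge0.
have ek : 0 < (e / 2) ^+ 2 * k by rewrite mulr_gt0// exprn_gt0// divr_gt0.
have [j _ Hj] := cvgr_lt _ (fine_cvg tail) _ ek.
have {Hj} : fine (\int[mu]_t ((Q (vec t) ^+ 2 * \1_(S j) t)%:E))%E < (e / 2) ^+ 2 * k := Hj j (leqnn j).
rewrite -lte_fin fineK// => Hj.
exists (j%:R + 1) => r jr; rewrite ltNge; apply/negP => er.
have r0 : 0 < r by apply: lt_le_trans jr; rewrite ltr_wpDl.
move: Hj; apply/negP; rewrite -leNgt.
apply: (@le_trans _ _ (\int[mu]_(t in slab r d) ((e / 2) ^+ 2)%:E)%E).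
  rewrite integral_cst; last exact: slab_measurable.
  by rewrite [X in (_ <= _ * X)%E](slab_measure r d0).
rewrite integral_mkcond; apply: ge0_le_integral => //.
- by move=> t _; rewrite patchE; case: ifP => // _; rewrite lee_fin sqr_ge0.
- by apply/(measurable_restrictT _ (slab_measurable r d)); exact: measurable_cst.
- apply/measurable_EFinP; apply: measurable_funM; last exact: measurable_indic.
  by apply: measurable_funX; exact: LQ.1.
move=> t _; rewrite patchE; case: ifPn => [/set_mem st|_]; last first.
  by rewrite lee_fin mulr_ge0// sqr_ge0.
have /andP[h1 h2] := slab_enorm r0 d0 st.
have jt : S j t.
  rewrite /S/=; have := st ord0; rewrite /= ?eqxx /= in_itv/= => /andP[h _].
  by apply: le_trans h; apply: le_trans jr; rewrite lerDl.
rewrite lee_fin indicE mem_set// mulr1 ler_sqr ?nnegrE ?divr_ge0 ?(ltW e0) ?(ltW (ground_state_gt0 _))//.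
rewrite profileE.
have HB' x : r <= x <= enorm (vec t) -> `|profile1 x| <= B.
  by move=> /andP[rx _]; have [] := HB x (le_trans (ltW r0) rx).
have := is_derive_lipschitz h1 (fun x _ => profile_derive x) HB'.
rewrite ler_norml => /andP[h3 _].
have Bd : B * (n%:R * d) <= e / 2.
  rewrite /d (_ : B * _ = (e / 2) * (B / (B + 1))); last first.
    by field; rewrite gt_eqF ?ltr_wpDl//= gt_eqF.
  rewrite ler_piMr ?divr_ge0 ?(ltW e0)// ler_pdivrMr ?ltr_wpDl// mul1r lerDl//.
have : B * (enorm (vec t) - r) <= B * (n%:R * d) by rewrite ler_wpM2l//; lra.
lra.
Qed.

End GroundState.

(** * Comparing the weight with powers and exponentials of the norm *)

Section WeightBounds.
Variable R : realType.

Lemma weight_lower n (x : 'cV[R]_n) : 1 <= (1 + enorm x ^+ 2) ^+ n * weight x.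
Proof.
rewrite /weight -[X in _ ^+ X](card_ord n) -prodr_const -big_split/=.
elim/big_ind : _ => [//|u v u1 v1|i _]; first by rewrite -[1]mulr1 ler_pM.
rewrite ler_pdivlMr ?(lt_le_trans ltr01) ?oneDsqr_ge1// mul1r /oneDsqr lerD2l.
rewrite enorm_sqr (bigD1 i)//= lerDl; apply: sumr_ge0 => j _; exact: sqr_ge0.
Qed.

Lemma weight_scale n (k : R) (x : 'cV[R]_n) : 1 <= k -> weight (k *: x) <= weight x.
Proof.
move=> k1; apply: ler_prod => i _; rewrite invr_ge0 (le_trans ler01) ?oneDsqr_ge1//=.
rewrite lef_pV2 ?posrE ?(lt_le_trans ltr01) ?oneDsqr_ge1// /oneDsqr lerD2l mxE exprMn.
by rewrite ler_peMl ?sqr_ge0// exprn_ege1.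
Qed.

(** [(1 + r ^ 2) ^ k <= (1 + r) ^ (2 k) <= (1 + r) ^ (2 k + 1)], and the last power is bounded by
    one term of the exponential series; the base [1 + r >= 1] allows raising the exponent. *)
Lemma sqrD1_expR k (r : R) : 0 <= r -> (1 + r ^+ 2) ^+ k <= (k.*2.+1)`!%:R * expR (1 + r).
Proof.
move=> r0; have r1 : 0 <= 1 + r by rewrite addr_ge0.
have := expR_ge1Dxn k.*2 r1 => H.
have f0 : 0 < (k.*2.+1)`!%:R :> R by rewrite ltr0n fact_gt0.
apply: (@le_trans _ _ ((1 + r) ^+ k.*2.+1)).
  apply: (@le_trans _ _ ((1 + r) ^+ k.*2)); last first.
    by rewrite exprS ler_peMl ?exprn_ge0// lerDl.
  by rewrite -mul2n exprM lerXn2r// ?nnegrE ?addr_ge0 ?sqr_ge0//; nra.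
rewrite mulrC -ler_pdivrMr//; apply: le_trans H; rewrite lerDr//.
Qed.

End WeightBounds.

Section GroundStateBounds.
Variables (R : realType) (m : nat) (Q : 'cV[R]_m.+1 -> R).
Hypothesis gsQ : ground_state Q.
Local Notation n := m.+1.

Lemma four_div_gt0 : 0 < 4 / n%:R :> R. Proof. by rewrite divr_gt0// ltr0n. Qed.

Lemma profile_bounded : exists2 B, 0 <= B &
  forall r, 0 <= r -> `|profile Q r| <= B /\ `|profile1 Q r| <= B.
Proof.
exact: (radial_bounded four_div_gt0 (profile_derive gsQ) (profile1_derive gsQ)
  (fun r => ground_state_gt0 gsQ _) (profile_ode gsQ)).
Qed.

Lemma profile_decay : exists2 C, 0 <= C & forall r, 0 <= r ->
  `|profile Q r| <= C * expR (- (r / 2)) /\ `|profile1 Q r| <= C * expR (- (r / 2)).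
Proof.
exact: (radial_decay four_div_gt0 (profile_derive gsQ) (profile1_derive gsQ)
  (fun r => ground_state_gt0 gsQ _) (profile_ode gsQ) (profile_cvg0 gsQ)).
Qed.

Lemma decay_weight (f : R -> R) C : 0 <= C -> (forall r, 0 <= r -> `|f r| <= C * expR (- (r / 2))) ->
  exists2 D, 0 <= D & forall x : 'cV[R]_n, (1 + enorm x ^+ 2) * f (enorm x) ^+ 2 <= D * weight x.
Proof.
(* Of the [n + 1] powers of [1 + r ^ 2], one stands in the claim and [n] are spent on
   [weight_lower]; [sqrD1_expR] bounds them by [expR (1 + r)], and the squared decay [expR (- r)]
   leaves [expR 1]. *)
move=> C0 fC; pose D := C ^+ 2 * ((n.+1).*2.+1)`!%:R * expR 1.
exists D; first by rewrite !mulr_ge0 ?expR_ge0 ?sqr_ge0.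
move=> x; set r := enorm x; have r0 : 0 <= r by exact: enorm_ge0.
have p0 : 0 <= 1 + r ^+ 2 by rewrite addr_ge0// sqr_ge0.
have W := weight_lower x; rewrite -/r in W.
apply: (@le_trans _ _ ((1 + r ^+ 2) * f r ^+ 2 * ((1 + r ^+ 2) ^+ n * weight x))).
  by rewrite ler_peMr// mulr_ge0// sqr_ge0.
rewrite (_ : _ * (_ * weight x) = (1 + r ^+ 2) ^+ n.+1 * f r ^+ 2 * weight x); last by rewrite (exprS _ n); ring.
apply: ler_wpM2r; first exact: ltW (weight_gt0 _).
have f2 : f r ^+ 2 <= C ^+ 2 * expR (- r).
  rewrite -real_normK ?num_real//.
  have -> : C ^+ 2 * expR (- r) = (C * expR (- (r / 2))) ^+ 2.
    by rewrite exprMn -expRM_natl; congr (_ * expR _); field.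
  by rewrite ler_sqr ?nnegrE ?mulr_ge0 ?expR_ge0// fC.
apply: (@le_trans _ _ (((n.+1).*2.+1)`!%:R * expR (1 + r) * (C ^+ 2 * expR (- r)))).
  by apply: ler_pM => //; [exact: exprn_ge0|exact: sqr_ge0|exact: sqrD1_expR].
rewrite expRD le_eqVlt; apply/orP; left; apply/eqP; rewrite /D expRN; field.
by rewrite gt_eqF// expR_gt0.
Qed.

Lemma ground_state_weight : exists2 D, 0 <= D & forall x : 'cV[R]_n,
  (1 + enorm x ^+ 2) * Q x ^+ 2 <= D * weight x /\ \sum_j partial j Q x ^+ 2 <= D * weight x.
Proof.
have [C C0 HC] := profile_decay.
have [D1 D10 H1] := decay_weight C0 (fun r r0 => (HC r r0).1).
have [D2 D20 H2] := decay_weight C0 (fun r r0 => (HC r r0).2).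
exists (D1 + D2); first exact: addr_ge0.
move=> x; have W := weight_gt0 x.
have W1 := mulr_ge0 D10 (ltW W); have W2 := mulr_ge0 D20 (ltW W); rewrite mulrDl; split.
  by rewrite (profileE gsQ x); have := H1 x; lra.
have : \sum_j partial j Q x ^+ 2 <= profile1 Q (enorm x) ^+ 2.
  under eq_bigr do rewrite (partial_radial gsQ) exprMn expr_div_n.
  rewrite -mulr_sumr ler_piMr ?sqr_ge0// -mulr_suml -enorm_sqr.
  have [->|x0] := eqVneq (enorm x) 0; first by rewrite expr0n mul0r.
  by rewrite divff// expf_neq0.
have := H2 x; rewrite mulrDl mul1r.
have : 0 <= enorm x ^+ 2 * profile1 Q (enorm x) ^+ 2 by rewrite mulr_ge0 ?sqr_ge0.
lra.
Qed.

(** The generator of dilations acts on a radial function as [|x| d/dr]; this term arises both from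
    the time derivative of the scale and from the cross term of the Laplacian. *)
Lemma sum_coord_partial (k : R) (x : 'cV[R]_n) : 0 < k ->
  \sum_j x j 0 * partial j Q (k *: x) = profile1 Q (k * enorm x) * enorm x.
Proof.
move=> k0; under eq_bigr do rewrite (partial_radial gsQ) enormZ ?(ltW k0)// mxE.
have [x0|x0] := eqVneq (enorm x) 0.
  by rewrite x0 !mulr0 big1 // => i _; rewrite invr0 !mulr0.
rewrite (eq_bigr (fun j => profile1 Q (k * enorm x) / enorm x * x j 0 ^+ 2)); last first.
  by move=> j _; field; rewrite x0 gt_eqF.
by rewrite -mulr_sumr -enorm_sqr; field.
Qed.

End GroundStateBounds.

(** * Waves with quadratic phase *)

Section StaticProfile.
Variables (R : realType) (m : nat) (Q : 'cV[R]_m.+1 -> R).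
Hypothesis gsQ : ground_state Q.
Local Notation n := m.+1.
Implicit Types (a b w k : R) (x : 'cV[R]_n).

Definition wave a b w k x : R := a * (cos (w + b * enorm x ^+ 2) * Q (k *: x)).

Definition dwave a b w k j x : R :=
  a * (- sin (w + b * enorm x ^+ 2) * (b * (2 * x j 0)) * Q (k *: x) +
       cos (w + b * enorm x ^+ 2) * (k * partial j Q (k *: x))).

Definition ddwave a b w k j x : R :=
  a * (- cos (w + b * enorm x ^+ 2) * (b * (2 * x j 0)) ^+ 2 * Q (k *: x)
       - sin (w + b * enorm x ^+ 2) * (b * 2) * Q (k *: x)
       - 2 * (sin (w + b * enorm x ^+ 2) * (b * (2 * x j 0)) * (k * partial j Q (k *: x)))
       + cos (w + b * enorm x ^+ 2) * (k ^+ 2 * partials [:: j; j] Q (k *: x))).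

Lemma is_derive_dilate (f : 'cV[R]_n -> R) k j x d : is_derive (k *: x) (delta_mx j 0) f d ->
  is_derive x (delta_mx j 0) (fun x => f (k *: x)) (k * d).
Proof.
move=> fd; have x0 : 0 *: delta_mx j 0 + x = x by rewrite scale0r add0r.
have kx0 : 0 *: delta_mx j 0 + k *: x = k *: x by rewrite scale0r add0r.
rewrite -{1}x0; apply/(is_derive_lineP (fun x => f (k *: x)) x (delta_mx j 0) 0).
have fd0 : is_derive (k * 0) 1 (fun h => f (h *: delta_mx j 0 + k *: x)) d.
  by rewrite mulr0; apply/(is_derive_lineP f (k *: x) (delta_mx j 0) 0); rewrite kx0.
have := @is_derive_comp1 _ _ (fun h => f (h *: delta_mx j 0 + k *: x)) (fun h => k * h) 0 1 _ _ fd0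
  (is_derive_scale k (is_derive_id (0 : R) (1 : R))).
rewrite mulr1 mulrC (_ : (fun h : R => _) = (fun h => f (k *: (h *: delta_mx j 0 + x))))//.
by apply/funext => h; rewrite scalerDr scalerA.
Qed.

Lemma is_derive_phase b w j x :
  is_derive x (delta_mx j 0) (fun x => w + b * enorm x ^+ 2) (b * (2 * x j 0)).
Proof.
have := is_derive_add (is_derive_cstr w x (delta_mx j 0)) (is_derive_scale b (is_derive_enorm_sqr j x)).
by rewrite add0r.
Qed.

Lemma is_derive_cos_phase b w j x : is_derive x (delta_mx j 0) (fun x => cos (w + b * enorm x ^+ 2))
  (- sin (w + b * enorm x ^+ 2) * (b * (2 * x j 0))).
Proof.
exact: (@is_derive_comp1 _ _ cos _ _ _ _ _ (is_derive_cos _) (is_derive_phase b w j x)).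
Qed.

Lemma is_derive_sin_phase b w j x : is_derive x (delta_mx j 0) (fun x => sin (w + b * enorm x ^+ 2))
  (cos (w + b * enorm x ^+ 2) * (b * (2 * x j 0))).
Proof.
exact: (@is_derive_comp1 _ _ sin _ _ _ _ _ (is_derive_sin _) (is_derive_phase b w j x)).
Qed.

Lemma wave_derive a b w k j x : is_derive x (delta_mx j 0) (wave a b w k) (dwave a b w k j x).
Proof.
apply: is_derive_scale; apply: is_derive_mul; first exact: is_derive_cos_phase.
by apply: is_derive_dilate; exact: ground_state_derive.
Qed.

Lemma dwave_derive a b w k j x : is_derive x (delta_mx j 0) (dwave a b w k j) (ddwave a b w k j x).
Proof.
have dQ := is_derive_dilate (ground_state_derive gsQ j (k *: x)).
have ddQ := is_derive_scale k (is_derive_dilate (ground_state_derive2 gsQ j j (k *: x))).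
have dX := is_derive_scale b (is_derive_scale 2 (is_derive_coord j j x)).
have dS := is_derive_opp (is_derive_sin_phase b w j x).
have := is_derive_scale a (is_derive_add (is_derive_mul (is_derive_mul dS dX) dQ)
  (is_derive_mul (is_derive_cos_phase b w j x) ddQ)).
move=> /is_derive_eq; apply; rewrite eqxx /ddwave (_ : true%:R = 1 :> R)//; ring.
Qed.

Lemma phase_continuous b w : continuous (fun x => w + b * enorm x ^+ 2).
Proof.
apply: contD; first exact: cont_cst; apply: contM; first exact: cont_cst.
by apply: contX; exact: enorm_continuous.
Qed.

Lemma cos_phase_continuous b w : continuous (fun x => cos (w + b * enorm x ^+ 2)).
Proof. by apply: (@cont_comp _ _ cos); [exact: continuous_cos|exact: phase_continuous]. Qed.

Lemma sin_phase_continuous b w : continuous (fun x => sin (w + b * enorm x ^+ 2)).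
Proof. by apply: (@cont_comp _ _ sin); [exact: continuous_sin|exact: phase_continuous]. Qed.

Lemma partials_dilate_continuous s k : (size s <= 2)%N -> continuous (fun x => partials s Q (k *: x)).
Proof. by move=> s2; exact: cont_comp2 (@continuous_scale _ _ k) (ground_state_cont gsQ s2). Qed.

Lemma coord_phase_continuous b j : continuous (fun x => b * (2 * x j 0)).
Proof. by do 2?(apply: contM; first exact: cont_cst); exact: cont_coord. Qed.

Lemma wave_continuous a b w k : continuous (wave a b w k).
Proof.
apply: contM; first exact: cont_cst.
by apply: contM; [exact: cos_phase_continuous|exact: (@partials_dilate_continuous [::])].
Qed.

Lemma dwave_continuous a b w k j : continuous (dwave a b w k j).
Proof.
apply: contM; first exact: cont_cst; apply: contD.
  apply: contM; last exact: (@partials_dilate_continuous [::]).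
  by apply: contM; [apply: contN; exact: sin_phase_continuous|exact: coord_phase_continuous].
apply: contM; first exact: cos_phase_continuous.
by apply: contM; [exact: cont_cst|exact: (@partials_dilate_continuous [:: j])].
Qed.

Lemma ddwave_continuous a b w k j : continuous (ddwave a b w k j).
Proof.
have cQ := @partials_dilate_continuous [::] k isT.
have cQ1 := @partials_dilate_continuous [:: j] k isT.
have cQ2 := @partials_dilate_continuous [:: j; j] k isT.
have cc := @cos_phase_continuous b w; have cs := @sin_phase_continuous b w.
have cx := @coord_phase_continuous b j.
apply: contM; first exact: cont_cst; apply: contD; [apply: contB; [apply: contB|]|].
- by apply: contM => //; apply: contM; [exact: contN|exact: contX].
- by apply: contM => //; apply: contM => //; exact: cont_cst.
- apply: contM; first exact: cont_cst; apply: contM; first exact: contM.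
  by apply: contM => //; exact: cont_cst.
- by apply: contM => //; apply: contM => //; exact: cont_cst.
Qed.

Lemma wave_c1grad a b w k : c1grad (wave a b w k) (dwave a b w k).
Proof.
split; [exact: wave_continuous|move=> j; exact: dwave_continuous|].
by move=> j x; exact: wave_derive.
Qed.

(** Sine and cosine are at most 1. The summands 1, [8 b ^ 2] and [2 k ^ 2] come from the wave
    itself, the gradient of its phase and the gradient of the profile; [1 <= k] moves the bound from
    [k *: x] to [x]. *)
Lemma wave_dominated D a b w k : (forall x, (1 + enorm x ^+ 2) * Q x ^+ 2 <= D * weight x /\
    \sum_j partial j Q x ^+ 2 <= D * weight x) -> 0 <= D -> 1 <= k ->
  dominated (a ^+ 2 * (1 + 8 * b ^+ 2 + 2 * k ^+ 2) * D) (wave a b w k) (dwave a b w k).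
Proof.
move=> HD D0 k1 x; have k0 : 0 <= k by exact: le_trans k1.
have [H1 H2] := HD (k *: x).
have Wk : D * weight (k *: x) <= D * weight x by rewrite ler_wpM2l// weight_scale.
set C := cos (w + b * enorm x ^+ 2); set S := sin (w + b * enorm x ^+ 2).
have C1 : C ^+ 2 <= 1 by rewrite -(cos2Dsin2 (w + b * enorm x ^+ 2)) lerDl sqr_ge0.
have S1 : S ^+ 2 <= 1 by rewrite -(cos2Dsin2 (w + b * enorm x ^+ 2)) lerDr sqr_ge0.
have q0 := sqr_ge0 (Q (k *: x)).
have e0 := sqr_ge0 (enorm x).
have eK : (1 + enorm x ^+ 2) * Q (k *: x) ^+ 2 <= D * weight x.
  apply: le_trans Wk; apply: le_trans H1; rewrite ler_wpM2r// lerD2l enormZ// exprMn ler_peMl//.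
  by rewrite exprn_ege1.
have a0 := sqr_ge0 a.
have E1 : (1 + enorm x ^+ 2) * wave a b w k x ^+ 2 <= a ^+ 2 * (D * weight x).
  rewrite /wave -/C !exprMn.
  rewrite (_ : _ * (a ^+ 2 * _) = a ^+ 2 * (C ^+ 2 * ((1 + enorm x ^+ 2) * Q (k *: x) ^+ 2))); last by ring.
  apply: ler_wpM2l => //; apply: le_trans eK.
  by rewrite ler_piMl// mulr_ge0// addr_ge0.
have E2 : \sum_j dwave a b w k j x ^+ 2 <= a ^+ 2 * (8 * b ^+ 2 * (enorm x ^+ 2 * Q (k *: x) ^+ 2) +
    2 * k ^+ 2 * \sum_j partial j Q (k *: x) ^+ 2).
  rewrite enorm_sqr mulr_suml !mulr_sumr -big_split/= mulr_sumr; apply: ler_sum => j _.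
  rewrite /dwave -/C -/S exprMn; apply: ler_wpM2l => //.
  set q := Q _; set p := partial j Q _; set y := x j 0.
  have T1 : (- S * (b * (2 * y)) * q + C * (k * p)) ^+ 2 <=
    2 * (S ^+ 2 * (b * (2 * y) * q) ^+ 2) + 2 * (C ^+ 2 * (k * p) ^+ 2).
    by rewrite -!exprMn; have := sqr_ge0 (S * (b * (2 * y) * q) + C * (k * p)); lra.
  apply: (le_trans T1).
  have T2 : S ^+ 2 * (b * (2 * y) * q) ^+ 2 <= (b * (2 * y) * q) ^+ 2 by rewrite ler_piMl ?sqr_ge0.
  have T3 : C ^+ 2 * (k * p) ^+ 2 <= (k * p) ^+ 2 by rewrite ler_piMl ?sqr_ge0.
  apply: (@le_trans _ _ (2 * (b * (2 * y) * q) ^+ 2 + 2 * (k * p) ^+ 2)); first by lra.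
  by rewrite le_eqVlt; apply/orP; left; apply/eqP; ring.
apply: (le_trans (lerD E1 E2)); rewrite -mulrDr.
rewrite (_ : a ^+ 2 * _ * D * weight x = a ^+ 2 * ((1 + 8 * b ^+ 2 + 2 * k ^+ 2) * (D * weight x))); last by ring.
apply: ler_wpM2l => //.
have E3 : enorm x ^+ 2 * Q (k *: x) ^+ 2 <= D * weight x.
  by apply: le_trans eK; rewrite mulrDl mul1r lerDr.
have E4 := le_trans H2 Wk.
have b0 := sqr_ge0 b; have kk0 := sqr_ge0 k.
have F3 : b ^+ 2 * (enorm x ^+ 2 * Q (k *: x) ^+ 2) <= b ^+ 2 * (D * weight x) by rewrite ler_wpM2l.
have F4 : k ^+ 2 * \sum_j partial j Q (k *: x) ^+ 2 <= k ^+ 2 * (D * weight x) by rewrite ler_wpM2l.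
lra.
Qed.

(** The gradient of a radial wave is a scalar multiple of [x], and [M x . x = 0] for skew [M]. *)
Lemma dwave_rotation (M : 'M[R]_n) a b w k x : M^T = - M -> 0 < k ->
  \sum_j (M *m x) j 0 * dwave a b w k j x = 0.
Proof.
move=> skM k0.
have Mx0 : \sum_j (M *m x) j 0 * x j 0 = 0.
  have -> : \sum_j (M *m x) j 0 * x j 0 = (x^T *m (M *m x)) 0 0.
    by rewrite [RHS]mxE; apply: eq_bigr => j _; rewrite [x^T _ _]mxE mulrC.
  have E : x^T *m (M *m x) = (x^T *m (M *m x))^T.
    by apply/matrixP => i j; rewrite [RHS]mxE !ord1.
  have : x^T *m (M *m x) = - (x^T *m (M *m x)).
    by rewrite {1}E !trmx_mul trmxK skM mulmxN mulNmx mulmxA.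
  move=> /matrixP/(_ 0 0); rewrite [in X in _ = X]mxE => /eqP.
  by rewrite -addr_eq0 -mulr2n mulrn_eq0/= => /eqP.
rewrite -[RHS](mulr0 (a * (- sin (w + b * enorm x ^+ 2) * (b * 2) * Q (k *: x) +
  cos (w + b * enorm x ^+ 2) * (k * (profile1 Q (k * enorm x) * (k / (k * enorm x))))))).
rewrite -[X in _ = _ * X]Mx0 mulr_sumr; apply: eq_bigr => j _.
rewrite /dwave (partial_radial gsQ) enormZ ?(ltW k0)// [(k *: x) j 0]mxE; ring.
Qed.

End StaticProfile.

(** * The right-hand side tested on a classical function *)

Section RhsPairing.
Variables (R : realType) (n : nat).
Local Notation mu := (lebesgueRn R n).

Lemma Re_sum (I : finType) (F : I -> R[i]) : complex.Re (\sum_i F i) = \sum_i complex.Re (F i).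
Proof. by apply: (big_morph (@complex.Re R)) => // -[a b] [c d]. Qed.

Lemma Im_sum (I : finType) (F : I -> R[i]) : complex.Im (\sum_i F i) = \sum_i complex.Im (F i).
Proof. by apply: (big_morph (@complex.Im R)) => // -[a b] [c d]. Qed.

Lemma Re_mulr (z : R[i]) (r : R) : complex.Re (z * r%:C) = complex.Re z * r.
Proof. by case: z => a b /=; rewrite mulr0 subr0. Qed.

Lemma Im_mulr (z : R[i]) (r : R) : complex.Im (z * r%:C) = complex.Im z * r.
Proof. by case: z => a b /=; rewrite mulr0 add0r. Qed.

Lemma Re_mull (z : R[i]) (r : R) : complex.Re (r%:C * z) = r * complex.Re z.
Proof. by case: z => a b /=; rewrite mul0r subr0. Qed.

Lemma Im_mull (z : R[i]) (r : R) : complex.Im (r%:C * z) = r * complex.Im z.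
Proof. by case: z => a b /=; rewrite mul0r addr0. Qed.

Lemma ae_eq_Rintegral (f g : n.-tuple R -> R) : measurable_fun setT f -> measurable_fun setT g ->
  {ae mu, forall t, f t = g t} -> \int[mu]_t f t = \int[mu]_t g t.
Proof.
move=> mf mg fg; rewrite /Rintegral; congr fine; apply: ae_eq_integral => //.
- exact/measurable_EFinP.
- exact/measurable_EFinP.
- by apply: filterS fg => t /= -> _.
Qed.

Variables (gamma : R) (M : 'M[R]_n) (phi : 'cV[R]_n -> R).
Variables (A B : 'cV[R]_n -> R) (dA dB : 'I_n -> 'cV[R]_n -> R) (C D : R).
Hypotheses (cA : c1grad A dA) (cB : c1grad B dB).
Hypotheses (hA : dominated C A dA) (hB : dominated D B dB).
Hypotheses (rA : forall x, \sum_j (M *m x) j 0 * dA j x = 0).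
Hypotheses (rB : forall x, \sum_j (M *m x) j 0 * dB j x = 0).
Hypothesis tphi : test_function phi.

Let N (x : 'cV[R]_n) : R := Normc.normc (mkC A B x) `^ (4 / n%:R).

(** The modulus factor [N'] is a separate argument because it alone couples the real and imaginary
    parts; the rest acts on each of them. *)
Definition rhs_part (N' A' : 'cV[R]_n -> R) (dA' : 'I_n -> 'cV[R]_n -> R) : R :=
  \int[mu]_t (\sum_j dA' j (vec t) * partial j phi (vec t))
  + \int[mu]_t (gamma ^+ 2 * enorm (vec t) ^+ 2 * A' (vec t) * phi (vec t))
  - \int[mu]_t (N' (vec t) * A' (vec t) * phi (vec t)).

(** The chosen weak gradient equals the classical one almost everywhere, hence under each integral;
    the rotation term then has integrand 0 almost everywhere. *)
Lemma rhs_pairing_mkC : rhs_pairing gamma M (mkC A B) phi = rhs_part N A dA +i* rhs_part N B dB.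
Proof.
have wG := mkC_weak_gradient cA cB hA hB.
have ww := weak_gradientP wG; have aew := weak_gradient_ae wG.
have [cA0 cA1 _] := cA; have [cB0 cB1 _] := cB.
have cphi : continuous phi := (test_function_Cc [::] tphi).1.
have cdphi j : continuous (partial j phi) := (test_function_Cc [:: j] tphi).1.
have mphi := continuous_measurable_vec cphi.
have mdphi j := continuous_measurable_vec (cdphi j).
have mR j : measurable_fun setT (fun t : n.-tuple R => complex.Re (weak_gradient (mkC A B) (vec t) j 0)).
  by have /is_weak_gradientP/(_ j)[[]] := ww.
have mI j : measurable_fun setT (fun t : n.-tuple R => complex.Im (weak_gradient (mkC A B) (vec t) j 0)).
  by have /is_weak_gradientP/(_ j)[_ []] := ww.
have mdA j := continuous_measurable_vec (cA1 j).
have mdB j := continuous_measurable_vec (cB1 j).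
have mM j : measurable_fun setT (fun t : n.-tuple R => (M *m vec t) j 0).
  apply: (@continuous_measurable_vec _ _ (fun x => (M *m x) j 0)).
  under eq_fun do rewrite mxE; apply: cont_sum => i; apply: contM; [exact: cont_cst|exact: cont_coord].
rewrite /rhs_pairing.
have -> : integralC (fun x => \sum_j weak_gradient (mkC A B) x j 0 * (partial j phi x)%:C) =
  (\int[mu]_t (\sum_j dA j (vec t) * partial j phi (vec t))) +i*
  (\int[mu]_t (\sum_j dB j (vec t) * partial j phi (vec t))).
  rewrite /integralC; congr (_ +i* _).
    under eq_Rintegral do rewrite Re_sum; under eq_Rintegral do under eq_bigr do rewrite Re_mulr.
    apply: ae_eq_Rintegral.
    - by apply: measurable_sum => j; exact: measurable_funM.
    - by apply: measurable_sum => j; exact: measurable_funM.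
    - by apply: filterS aew => t -> ; apply: eq_bigr => j _; rewrite mxE.
  under eq_Rintegral do rewrite Im_sum; under eq_Rintegral do under eq_bigr do rewrite Im_mulr.
  apply: ae_eq_Rintegral.
  - by apply: measurable_sum => j; exact: measurable_funM.
  - by apply: measurable_sum => j; exact: measurable_funM.
  - by apply: filterS aew => t -> ; apply: eq_bigr => j _; rewrite mxE.
have -> : integralC (fun x => (gamma ^+ 2 * enorm x ^+ 2)%:C * mkC A B x * (phi x)%:C) =
  (\int[mu]_t (gamma ^+ 2 * enorm (vec t) ^+ 2 * A (vec t) * phi (vec t))) +i*
  (\int[mu]_t (gamma ^+ 2 * enorm (vec t) ^+ 2 * B (vec t) * phi (vec t))).
  by rewrite /integralC; congr (_ +i* _); apply: eq_Rintegral => t _; rewrite ?Re_mulr ?Im_mulr ?Re_mull ?Im_mull.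
have -> : integralC (fun x => (Normc.normc (mkC A B x) `^ (4 / n%:R))%:C * mkC A B x * (phi x)%:C) =
  (\int[mu]_t (N (vec t) * A (vec t) * phi (vec t))) +i*
  (\int[mu]_t (N (vec t) * B (vec t) * phi (vec t))).
  by rewrite /integralC; congr (_ +i* _); apply: eq_Rintegral => t _; rewrite ?Re_mulr ?Im_mulr ?Re_mull ?Im_mull.
have -> : integralC (fun x => (\sum_j ((M *m x) j 0)%:C * weak_gradient (mkC A B) x j 0) * (phi x)%:C) = 0.
  rewrite /integralC.
  have z (f : n.-tuple R -> R) : measurable_fun setT f -> {ae mu, forall t, f t = 0} -> \int[mu]_t f t = 0.
    move=> mf f0; rewrite (ae_eq_Rintegral mf (measurable_cst _) f0).
    by rewrite Rintegral_cst//= mul0r.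
  rewrite z; [rewrite z//|..].
  - under eq_fun do rewrite Im_mulr Im_sum; apply: measurable_funM => //.
    by under eq_fun do under eq_bigr do rewrite Im_mull; apply: measurable_sum => j; exact: measurable_funM.
  - apply: filterS aew => t ->; rewrite Im_mulr Im_sum.
    by under eq_bigr do rewrite Im_mull [mkG _ _ _ _ _]mxE/=; rewrite rB mul0r.
  - under eq_fun do rewrite Re_mulr Re_sum; apply: measurable_funM => //.
    by under eq_fun do under eq_bigr do rewrite Re_mull; apply: measurable_sum => j; exact: measurable_funM.
  - apply: filterS aew => t ->; rewrite Re_mulr Re_sum.
    by under eq_bigr do rewrite Re_mull [mkG _ _ _ _ _]mxE/=; rewrite rA mul0r.
by rewrite mulr0 addr0.
Qed.

End RhsPairing.

(** * The equation for a single wave *)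

Section WeakEquation.
Variables (R : realType) (m : nat) (Q : 'cV[R]_m.+1 -> R).
Hypothesis gsQ : ground_state Q.
Local Notation n := m.+1.
Local Notation mu := (lebesgueRn R n).
Variables (gamma : R) (phi : 'cV[R]_n -> R).
Hypothesis tphi : test_function phi.

(* The time derivative of [wave a b w k] when [a' = - 2 n a b], [b' = - gamma^2 k^2],
   [w' = k^2], [k' = - 4 b k], as they are for the lens transform. *)
Definition wave_dt (a b w k : R) (x : 'cV[R]_n) : R :=
  a * (- (2 * n%:R * b) * (cos (w + b * enorm x ^+ 2) * Q (k *: x))
       - sin (w + b * enorm x ^+ 2) * (k ^+ 2 - gamma ^+ 2 * k ^+ 2 * enorm x ^+ 2) * Q (k *: x)
       + cos (w + b * enorm x ^+ 2) * (profile1 Q (k * enorm x) * (- (4 * b * k) * enorm x))).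

(** The real part of [u_t = i (Delta u - gamma^2 |x|^2 u + |u|^(4/n) u)]: multiplication by i
    appears as the shift [w + pi / 2]. *)
Lemma wave_equation (a b w k : R) x : 0 < k -> 0 < a -> a `^ (4 / n%:R) = k ^+ 2 ->
  4 * b ^+ 2 + gamma ^+ 2 = gamma ^+ 2 * k ^+ 2 ->
  wave_dt a b w k x = \sum_j ddwave Q a b (w + pi / 2) k j x
    - gamma ^+ 2 * enorm x ^+ 2 * wave Q a b (w + pi / 2) k x
    + (a * Q (k *: x)) `^ (4 / n%:R) * wave Q a b (w + pi / 2) k x.
Proof.
move=> k0 a0 ak bk; set y := k *: x; set q := Q y; set e := enorm x ^+ 2.
have q0 : 0 < q by exact: ground_state_gt0.
set S := sin (w + b * e); set C := cos (w + b * e).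
have cE : cos (w + pi / 2 + b * e) = - S by rewrite addrAC cosDpihalf.
have sE : sin (w + pi / 2 + b * e) = C by rewrite addrAC sinDpihalf.
have lapE : \sum_j partials [:: j; j] Q y = q - q `^ (1 + 4 / n%:R).
  by have [_ _ _ /(_ y)] := gsQ; rewrite /laplacian -/q => /eqP; lra.
have lap : \sum_j ddwave Q a b (w + pi / 2) k j x =
  a * (4 * b ^+ 2 * S * q * e - 2 * n%:R * b * C * q
    - 4 * b * k * C * (profile1 Q (k * enorm x) * enorm x)
    - k ^+ 2 * S * (q - q `^ (1 + 4 / n%:R))).
  rewrite -lapE -(sum_coord_partial gsQ x k0) /e (enorm_sqr x).
  rewrite (_ : n%:R = \sum_(j < n) (1 : R)); last by rewrite sumr_const card_ord.
  rewrite !(mulr_sumr, mulr_suml) -!sumrB mulr_sumr; apply: eq_bigr => j _.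
  rewrite /ddwave -/e cE sE -/y -/q; ring.
rewrite lap /wave_dt /wave -/e -/y -/q cE -/S -/C.
rewrite powRM ?(ltW a0) ?(ltW q0)// ak powRD; last by apply/implyP => _; rewrite gt_eqF.
rewrite powRr1 ?(ltW q0)//.
(* The terms quadratic in [x] match by this relation; those with a power of [q] cancelled through
   the amplitude relation, already substituted. *)
have -> : 4 * b ^+ 2 = gamma ^+ 2 * k ^+ 2 - gamma ^+ 2 by lra.
ring.
Qed.

(** The pointwise equation is integrated against [phi], with one integration by parts in each
    coordinate turning [ddwave] into [dwave]. [N] stays abstract so that it can be instantiated by
    the modulus of the complex wave. *)
Lemma wave_weak_equation (N : 'cV[R]_n -> R) (a b w k : R) : 0 < k -> 0 < a -> a `^ (4 / n%:R) = k ^+ 2 ->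
  4 * b ^+ 2 + gamma ^+ 2 = gamma ^+ 2 * k ^+ 2 ->
  (forall x, N x = (a * Q (k *: x)) `^ (4 / n%:R)) -> continuous N ->
  \int[mu]_t (wave_dt a b w k (vec t) * phi (vec t)) =
  - rhs_part gamma phi N (wave Q a b (w + pi / 2) k) (dwave Q a b (w + pi / 2) k).
Proof.
move=> k0 a0 ak bk NE cN.
have Cphi : Cc phi := test_function_Cc [::] tphi.
have Cdphi j : Cc (partial j phi) := test_function_Cc [:: j] tphi.
set W := wave _ _ _ _ _; set dW := dwave _ _ _ _ _.
have cW : continuous W by exact: wave_continuous.
have cdW j : continuous (dW j) by exact: dwave_continuous.
have cddW j : continuous (ddwave Q a b (w + pi / 2) k j) by exact: ddwave_continuous.
have ibp j : \int[mu]_t (dW j (vec t) * partial j phi (vec t)) =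
    - \int[mu]_t (ddwave Q a b (w + pi / 2) k j (vec t) * phi (vec t)).
  by apply: wderiv_classical => // x; exact: dwave_derive.
have I1 j : mu.-integrable setT (fun t => (dW j (vec t) * partial j phi (vec t))%:E).
  exact: Cc_integrable (CcMl (cdW j) (Cdphi j)).
have I2 j : mu.-integrable setT (fun t => (ddwave Q a b (w + pi / 2) k j (vec t) * phi (vec t))%:E).
  exact: Cc_integrable (CcMl (cddW j) Cphi).
have Rsum (f : 'I_n -> n.-tuple R -> R) : (forall j, mu.-integrable setT (fun t => (f j t)%:E)) ->
    \int[mu]_t (\sum_j f j t) = \sum_j \int[mu]_t (f j t).
  move=> If; rewrite /Rintegral; under eq_integral do rewrite -sumEFin.
  rewrite integral_sum//; rewrite -sum_fine// => j _; exact: integrable_fin_num.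
have ce : continuous (fun x : 'cV[R]_n => gamma ^+ 2 * enorm x ^+ 2).
  by apply: contM; [exact: cont_cst|apply: contX; exact: enorm_continuous].
have I3 : mu.-integrable setT (fun t => (gamma ^+ 2 * enorm (vec t) ^+ 2 * W (vec t) * phi (vec t))%:E).
  exact: Cc_integrable (CcMl (contM ce cW) Cphi).
have I4 : mu.-integrable setT (fun t => (N (vec t) * W (vec t) * phi (vec t))%:E).
  exact: Cc_integrable (CcMl (contM cN cW) Cphi).
have I2s : mu.-integrable setT (fun t => (\sum_j ddwave Q a b (w + pi / 2) k j (vec t) * phi (vec t))%:E).
  exact: Cc_integrable (Cc_sum (fun j => CcMl (cddW j) Cphi)).
rewrite /rhs_part (Rsum (fun j t => dW j (vec t) * partial j phi (vec t)))//.
under eq_bigr do rewrite ibp.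
rewrite sumrN -(Rsum (fun j t => ddwave Q a b (w + pi / 2) k j (vec t) * phi (vec t)))//.
have WE x := @wave_equation a b w k x k0 a0 ak bk.
under eq_Rintegral do rewrite WE -/W -NE mulrDl mulrBl mulr_suml.
have I5 : mu.-integrable setT (fun t => (\sum_j ddwave Q a b (w + pi / 2) k j (vec t) * phi (vec t)
   - gamma ^+ 2 * enorm (vec t) ^+ 2 * W (vec t) * phi (vec t))%:E).
  by under eq_fun do rewrite EFinB; exact: integrableB.
rewrite (RintegralD measurableT I5 I4) (RintegralB measurableT I2s I3); ring.
Qed.

End WeakEquation.

(** * The lens transform *)

Section LensParameters.
Variables (R : realType) (m : nat) (gamma : R).
Hypothesis gamma0 : 0 < gamma.
Local Notation n := m.+1.

Definition lens_c (t : R) : R := cos (2 * gamma * t).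
Definition lens_k (t : R) : R := (lens_c t)^-1.
Definition lens_b (t : R) : R := - (gamma / 2 * tan (2 * gamma * t)).
Definition lens_w (t : R) : R := tan (2 * gamma * t) / (2 * gamma).
Definition lens_a (t : R) : R := (lens_c t `^ (n%:R / 2))^-1.

Let gn0 : gamma != 0. Proof. by rewrite gt_eqF. Qed.

Lemma lens_k_gt0 (t : R) : 0 < lens_c t -> 0 < lens_k t.
Proof. by rewrite invr_gt0. Qed.

Lemma lens_a_gt0 (t : R) : 0 < lens_c t -> 0 < lens_a t.
Proof. by move=> c0; rewrite invr_gt0 powR_gt0. Qed.

Lemma lens_k_ge1 (t : R) : 0 < lens_c t -> 1 <= lens_k t.
Proof. by move=> c0; rewrite /lens_k invf_ge1// cos_le1. Qed.

Lemma lens_bk (t : R) : 0 < lens_c t -> 4 * lens_b t ^+ 2 + gamma ^+ 2 = gamma ^+ 2 * lens_k t ^+ 2.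
Proof.
move=> c0; have cn0 : cos (2 * gamma * t) != 0 by rewrite gt_eqF.
by rewrite /lens_k /lens_c exprVn (cos2_tan2 cn0) /lens_b; field.
Qed.

(** As [a = k ^ (n / 2)], the power [4 / n] is exactly the one for which the nonlinearity scales
    like the Laplacian. *)
Lemma lens_ak (t : R) : 0 < lens_c t -> lens_a t `^ (4 / n%:R) = lens_k t ^+ 2.
Proof.
move=> c0; rewrite /lens_a -powRN -powRrM.
have -> : - (n%:R / 2) * (4 / n%:R) = - 2%:R :> R by field; rewrite addrC natr1 pnatr_eq0.
by rewrite powRN powR_mulrn ?(ltW c0)// /lens_k exprVn.
Qed.

Lemma is_derive_phase2 (t : R) : is_derive t 1 (fun t => 2 * gamma * t) (2 * gamma).
Proof. by have := is_derive_scale (2 * gamma) (is_derive_id t (1 : R)); rewrite mulr1. Qed.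

Lemma lens_c_derive (t : R) : is_derive t 1 lens_c (- sin (2 * gamma * t) * (2 * gamma)).
Proof. exact: (@is_derive_comp1 _ _ cos _ _ _ _ _ (is_derive_cos _) (is_derive_phase2 t)). Qed.

Lemma lens_tan_derive (t : R) : 0 < lens_c t ->
  is_derive t 1 (fun t => tan (2 * gamma * t)) (lens_k t ^+ 2 * (2 * gamma)).
Proof.
move=> c0; have cn0 : cos (2 * gamma * t) != 0 by rewrite gt_eqF.
rewrite /lens_k exprVn.
exact: (@is_derive_comp1 _ _ tan _ _ _ _ _ (is_derive_tan cn0) (is_derive_phase2 t)).
Qed.

Lemma lens_b_derive (t : R) : 0 < lens_c t -> is_derive t 1 lens_b (- (gamma ^+ 2 * lens_k t ^+ 2)).
Proof.
move=> c0; have := is_derive_opp (is_derive_scale (gamma / 2) (lens_tan_derive c0)).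
by move=> /is_derive_eq; apply; field.
Qed.

Lemma lens_w_derive (t : R) : 0 < lens_c t -> is_derive t 1 lens_w (lens_k t ^+ 2).
Proof.
move=> c0; have := is_derive_scale (2 * gamma)^-1 (lens_tan_derive c0).
rewrite (_ : (fun y => _) = lens_w); last by apply/funext => y; rewrite /lens_w mulrC.
by move=> /is_derive_eq; apply; field.
Qed.

Lemma lens_k_derive (t : R) : 0 < lens_c t -> is_derive t 1 lens_k (- (4 * lens_b t * lens_k t)).
Proof.
move=> c0; have cn0 : lens_c t != 0 by rewrite gt_eqF.
have := is_derive_inv cn0 (lens_c_derive t); move=> /is_derive_eq; apply.
rewrite /lens_b /lens_k /tan -/(lens_c t); field; exact: cn0.
Qed.

Lemma lens_a_derive (t : R) : 0 < lens_c t -> is_derive t 1 lens_a (lens_a t * (- (2 * n%:R * lens_b t))).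
Proof.
move=> c0; have cn0 : lens_c t != 0 by rewrite gt_eqF.
have pn0 : lens_c t `^ (n%:R / 2) != 0 by rewrite gt_eqF// powR_gt0.
have d1 := @is_derive_comp1 _ _ (fun y : R => y `^ (n%:R / 2)) _ _ _ _ _ (is_derive1_powR (n%:R / 2) c0) (lens_c_derive t).
have := @is_derive_inv _ _ (fun y => lens_c y `^ (n%:R / 2)) t 1 _ pn0 d1; move=> /is_derive_eq; apply.
rewrite (powRD (r := n%:R / 2) (s := -1)); last by apply/implyP.
rewrite powR_inv1 ?(ltW c0)// /lens_a /lens_b /tan -/(lens_c t).
by field; rewrite cn0 pn0.
Qed.

Lemma lens_b_bound (t : R) : 0 < lens_c t -> `|lens_b t| <= gamma * lens_k t.
Proof.
move=> c0; have k0 := lens_k_gt0 c0; have := lens_bk c0; have g2 := sqr_ge0 gamma.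
have gk : 0 <= gamma * lens_k t by rewrite mulr_ge0 ?ltW.
move=> H; rewrite -(@ler_sqr _ `|_|) ?nnegrE// real_normK ?num_real// exprMn.
have := sqr_ge0 (lens_b t); lra.
Qed.

(** Scale and amplitude are negative powers of the cosine, which by continuity stays above half its
    value at [t] nearby. *)
Lemma lens_local_bounds (t : R) : 0 < lens_c t -> exists u v K A, [/\ u < t < v, 1 <= K, 0 <= A &
  forall s, u < s < v -> [/\ 0 < lens_c s, lens_k s <= K & lens_a s <= A]].
Proof.
move=> c0; have cc : continuous lens_c by exact: is_derive_cont1 lens_c_derive.
have c20 : 0 < lens_c t / 2 by rewrite divr_gt0.
have c2 : lens_c t / 2 < lens_c t by rewrite ltr_pdivrMr// ltr_pMr// ltr1n.
have /nbhs_ballP[e /= e0 He] : \forall s \near t, lens_c t / 2 < lens_c s by exact: (cvgr_gt _ (cc t)).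
exists (t - e), (t + e), (lens_c t / 2)^-1, ((lens_c t / 2) `^ (n%:R / 2))^-1; split.
- by rewrite ltrBlDr !ltrDl e0.
- rewrite invf_ge1//; apply: (le_trans (ltW c2)); exact: cos_le1.
- by rewrite invr_ge0 powR_ge0.
move=> s /andP[us sv]; have /He cs : ball t e s.
  by rewrite /ball/= ltr_distlC us sv.
have cs0 : 0 < lens_c s by exact: lt_trans cs.
split => //; first by rewrite /lens_k lef_pV2 ?posrE ?ltW.
rewrite /lens_a lef_pV2 ?posrE ?powR_gt0//.
by apply: ge0_ler_powR; rewrite ?nnegrE ?divr_ge0 ?ltW.
Qed.

End LensParameters.

(** * Time derivative, continuity and uniform bounds of the lens waves *)

Section LensWave.
Variables (R : realType) (m : nat) (Q : 'cV[R]_m.+1 -> R) (gamma : R).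
Hypothesis gsQ : ground_state Q.
Hypothesis gamma0 : 0 < gamma.
Local Notation n := m.+1.
Local Notation mu := (lebesgueRn R n).
Local Notation c := (lens_c gamma).
Local Notation k := (lens_k gamma).
Local Notation b := (lens_b gamma).
Local Notation w := (lens_w gamma).
Local Notation a := (lens_a m gamma).

(* The real part is the phase shift [th = 0] and the imaginary part the phase shift [th = - pi / 2]. *)
Definition lens (th t : R) : 'cV[R]_n -> R := wave Q (a t) (b t) (w t + th) (k t).
Definition dlens (th t : R) : 'I_n -> 'cV[R]_n -> R := dwave Q (a t) (b t) (w t + th) (k t).
Definition lens_dt (th t : R) : 'cV[R]_n -> R := wave_dt Q gamma (a t) (b t) (w t + th) (k t).

(** Negative [r] is included because the identity is rewritten under the time variable, where
    [lens_k] may be negative; evenness of the profile covers it. *)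
Lemma profile_scale (r : R) (x : 'cV[R]_n) : Q (r *: x) = profile Q (r * enorm x).
Proof.
rewrite (profileE gsQ); have [r0|/ltW r0] := leP 0 r; first by rewrite enormZ.
have -> : enorm (r *: x) = enorm ((- r) *: x).
  by rewrite /enorm; congr Num.sqrt; apply: eq_bigr => i _; rewrite !mxE mulNr sqrrN.
by rewrite enormZ ?oppr_ge0// mulNr (profile_even gsQ).
Qed.

Lemma lens_time_derive th (t : R) x : 0 < c t -> is_derive t 1 (fun t => lens th t x) (lens_dt th t x).
Proof.
move=> c0.
have d1 : is_derive t 1 (fun t => w t + th + b t * enorm x ^+ 2)
    (k t ^+ 2 - gamma ^+ 2 * k t ^+ 2 * enorm x ^+ 2).
  have := is_derive_add (is_derive_add (lens_w_derive gamma0 c0) (is_derive_cstr th t (1 : R)))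
    (is_derive_mul (lens_b_derive c0) (is_derive_cstr (enorm x ^+ 2) t (1 : R))).
  by move=> /is_derive_eq; apply; ring.
have d2 := @is_derive_comp1 _ _ cos _ _ _ _ _ (is_derive_cos _) d1.
have d3 := is_derive_mul (lens_k_derive c0) (is_derive_cstr (enorm x) t (1 : R)).
have d4 := @is_derive_comp1 _ _ (profile Q) _ _ _ _ _ (profile_derive gsQ _) d3.
have := is_derive_mul (lens_a_derive m c0) (is_derive_mul d2 d4).
rewrite (_ : (fun y => _) = (fun t => lens th t x)); last first.
  by apply/funext => s; rewrite /lens /wave profile_scale.
move=> /is_derive_eq; apply; rewrite /lens_dt /wave_dt profile_scale; ring.
Qed.

Lemma is_derive_cvg (f : R -> R) (t d : R) : is_derive t 1 f d -> f s @[s --> t] --> f t.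
Proof.
by move=> [df _]; apply: differentiable_continuous; apply/derivable1_diffP.
Qed.

Lemma lens_cvg th (t : R) x : 0 < c t -> lens th s x @[s --> t] --> lens th t x.
Proof. by move=> c0; apply: is_derive_cvg; exact: lens_time_derive. Qed.

Lemma partials_dilate_cvg s (t : R) x : (size s <= 2)%N -> 0 < c t ->
  partials s Q (k r *: x) @[r --> t] --> partials s Q (k t *: x).
Proof.
move=> s2 c0; apply: (@cvg_comp _ _ _ (fun r => k r *: x) (partials s Q) _ (nbhs (k t *: x))); last first.
  exact: (ground_state_cont gsQ s2).
apply: cvg_cV => i; rewrite mxE; under eq_fun do rewrite mxE.
by apply: cvgMl; exact: (is_derive_cvg (lens_k_derive c0)).
Qed.

Lemma dlens_cvg th j (t : R) x : 0 < c t -> dlens th s j x @[s --> t] --> dlens th t j x.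
Proof.
move=> c0.
have ca : a s @[s --> t] --> a t by exact: (is_derive_cvg (lens_a_derive m c0)).
have cb : b s @[s --> t] --> b t by exact: (is_derive_cvg (lens_b_derive c0)).
have cw : w s @[s --> t] --> w t by exact: (is_derive_cvg (lens_w_derive gamma0 c0)).
have ck : k s @[s --> t] --> k t by exact: (is_derive_cvg (lens_k_derive c0)).
have cp : w s + th + b s * enorm x ^+ 2 @[s --> t] --> w t + th + b t * enorm x ^+ 2.
  exact: (cvgD (cvgD cw (cvg_cst _)) (cvgM cb (cvg_cst _))).
have ccos : cos (w s + th + b s * enorm x ^+ 2) @[s --> t] --> cos (w t + th + b t * enorm x ^+ 2).
  by apply: (cvg_comp _ _ cp); exact: continuous_cos.
have csin : sin (w s + th + b s * enorm x ^+ 2) @[s --> t] --> sin (w t + th + b t * enorm x ^+ 2).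
  by apply: (cvg_comp _ _ cp); exact: continuous_sin.
have cQ := @partials_dilate_cvg [::] t x isT c0.
have cQ1 := @partials_dilate_cvg [:: j] t x isT c0.
rewrite /dlens /dwave; apply: cvgM; first exact: ca.
apply: cvgD; apply: cvgM; [|exact: cQ|exact: ccos|].
- by apply: cvgM; [exact: (cvgN csin)|exact: (cvgM cb (cvg_cst _))].
- exact: (cvgM ck cQ1).
Qed.

(** The constant of [wave_dominated] increases with the absolute values of [a], [b] and [k], all
    bounded near [t], and does not involve the phase. *)
Lemma lens_dominated (t : R) : 0 < c t -> exists u v C, u < t < v /\ forall th s, u < s < v -> 0 < c s /\ dominated C (lens th s) (dlens th s).
Proof.
move=> /(lens_local_bounds m)[u [v [K [A [tuv K1 A0 HKA]]]]].
have [D D0 HD] := ground_state_weight gsQ.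
exists u, v, (A ^+ 2 * (1 + 8 * (gamma * K) ^+ 2 + 2 * K ^+ 2) * D); split => // th s suv.
have [c0 kK aA] := HKA s suv; split => // x.
have := wave_dominated (a s) (b s) (w s + th) HD D0 (lens_k_ge1 c0) x.
move=> /le_trans; apply; apply: ler_wpM2r; first exact: ltW (weight_gt0 _).
apply: ler_wpM2r => //.
have a0 := lens_a_gt0 m c0; have k0 := lens_k_gt0 c0.
have b1 := lens_b_bound gamma0 c0.
have a2 : a s ^+ 2 <= A ^+ 2 by rewrite ler_sqr ?nnegrE// ltW.
have k2 : k s ^+ 2 <= K ^+ 2 by rewrite ler_sqr ?nnegrE ?(ltW k0)// (le_trans ler01).
have b2 : b s ^+ 2 <= (gamma * K) ^+ 2.
  rewrite -(real_normK (num_real (b s))) ler_sqr ?nnegrE ?mulr_ge0 ?(ltW gamma0) ?(le_trans ler01 K1)//.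
  by apply: (le_trans b1); rewrite ler_wpM2l// ltW.
apply: ler_pM => //; [exact: sqr_ge0| |by lra].
by have := sqr_ge0 (b s); have := sqr_ge0 (k s); lra.
Qed.

(** Boundedness of the profile and its derivative is enough here: quadratic growth is absorbed by
    the compact support of the test function. *)
Lemma lens_dt_bound (t : R) : 0 < c t -> exists u v D, [/\ u < t < v, 0 <= D &
  forall th s x, u < s < v -> 0 < c s /\ `|lens_dt th s x| <= D * (1 + enorm x ^+ 2)].
Proof.
move=> /(lens_local_bounds m)[u [v [K [A [tuv K1 A0 HKA]]]]].
have [B B0 HB] := profile_bounded gsQ.
have K0 : 0 <= K by exact: le_trans K1.
have g0 := ltW gamma0; have n0 : 0 <= n%:R :> R by [].
exists u, v, (A * (2 * n%:R * (gamma * K) * B + (K ^+ 2 + gamma ^+ 2 * K ^+ 2) * B + B * (4 * (gamma * K) * K))).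
split => //; first by rewrite !(mulr_ge0, addr_ge0, sqr_ge0).
move=> th s x suv; have [c0 kK aA] := HKA s suv; split => //.
have a0 := ltW (lens_a_gt0 m c0); have k0 := ltW (lens_k_gt0 c0).
have b1 : `|b s| <= gamma * K.
  by apply: le_trans (lens_b_bound gamma0 c0) _; rewrite ler_wpM2l.
set e := enorm x; have e0 : 0 <= e by exact: enorm_ge0.
have ke0 : 0 <= k s * e by exact: mulr_ge0.
have [q1 q2] := HB _ ke0.
have k2 : k s ^+ 2 <= K ^+ 2 by rewrite ler_sqr ?nnegrE.
rewrite /lens_dt /wave_dt profile_scale -/e.
set C := cos _; set S := sin _; set q := profile Q _; set p := profile1 Q _.
have C1 : `|C| <= 1 by rewrite ler_norml cos_geN1 cos_le1.
have S1 : `|S| <= 1 by rewrite ler_norml sin_geN1 sin_le1.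
have E0 : 0 <= 1 + e ^+ 2 by rewrite addr_ge0// sqr_ge0.
have E1 : 1 <= 1 + e ^+ 2 by rewrite lerDl sqr_ge0.
rewrite normrM (ger0_norm a0) -[leRHS]mulrA; apply: ler_pM => //.
have gK0 : 0 <= gamma * K by exact: mulr_ge0.
have T1 : `|- (2 * n%:R * b s) * (C * q)| <= 2 * n%:R * (gamma * K) * B * (1 + e ^+ 2).
  rewrite !normrM normrN !normrM (ger0_norm n0) (@ger0_norm _ 2)//.
  apply: (@le_trans _ _ (2 * n%:R * (gamma * K) * (1 * B))); last first.
    by rewrite mul1r ler_peMr// !mulr_ge0.
  apply: ler_pM; rewrite ?mulr_ge0//; first by rewrite ler_wpM2l// mulr_ge0.
  by apply: ler_pM.
have T2 : `|S * (k s ^+ 2 - gamma ^+ 2 * k s ^+ 2 * e ^+ 2) * q| <= (K ^+ 2 + gamma ^+ 2 * K ^+ 2) * B * (1 + e ^+ 2).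
  rewrite !normrM [leRHS]mulrAC; apply: ler_pM; rewrite ?mulr_ge0//.
  rewrite -[X in _ <= X]mul1r; apply: ler_pM => //.
  apply: (@le_trans _ _ (k s ^+ 2 + gamma ^+ 2 * k s ^+ 2 * e ^+ 2)).
    apply: (le_trans (ler_normB _ _)); rewrite !ger0_norm ?sqr_ge0//.
    by rewrite !mulr_ge0 ?sqr_ge0.
  have h1 : gamma ^+ 2 * k s ^+ 2 <= gamma ^+ 2 * K ^+ 2 by rewrite ler_wpM2l ?sqr_ge0.
  have h2 : gamma ^+ 2 * k s ^+ 2 * e ^+ 2 <= gamma ^+ 2 * K ^+ 2 * e ^+ 2 by rewrite ler_wpM2r ?sqr_ge0.
  have h3 : 0 <= K ^+ 2 * e ^+ 2 by rewrite mulr_ge0 ?sqr_ge0.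
  have h4 : 0 <= gamma ^+ 2 * K ^+ 2 by rewrite mulr_ge0 ?sqr_ge0.
  by rewrite mulrDl !mulrDr !mulr1; lra.
have T3 : `|C * (p * (- (4 * b s * k s) * e))| <= B * (4 * (gamma * K) * K) * (1 + e ^+ 2).
  rewrite !normrM normrN !normrM (@ger0_norm _ 4)// (ger0_norm k0) (ger0_norm e0).
  apply: (@le_trans _ _ (1 * (B * (4 * (gamma * K) * K * (1 + e ^+ 2))))); last by rewrite mul1r [leLHS]mulrA.
  have z1 : 0 <= 4 * `|b s| by rewrite mulr_ge0.
  have z2 : 0 <= 4 * `|b s| * k s by rewrite mulr_ge0.
  have z3 : 0 <= 4 * `|b s| * k s * e by rewrite mulr_ge0.
  apply: ler_pM => //; first by rewrite mulr_ge0.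
  apply: ler_pM => //; apply: ler_pM => //.
    by apply: ler_pM => //; rewrite ler_wpM2l.
  by have := sqr_ge0 (e - 1); rewrite sqrrB; have := sqr_ge0 e; lra.
apply: (le_trans (ler_normD _ _)); apply: (le_trans (lerD (ler_normB _ _) (lexx _))).
by clear -T1 T2 T3; lra.
Qed.

(** Differentiation under the integral, with majorant the bound of [lens_dt_bound] times [|phi|]. *)
Lemma lens_weak_derive th (phi : 'cV[R]_n -> R) (t : R) : test_function phi -> 0 < c t ->
  is_derive t 1 (fun s => \int[mu]_y (lens th s (vec y) * phi (vec y)))
    (\int[mu]_y (lens_dt th t (vec y) * phi (vec y))).
Proof.
move=> tphi c0; have Cphi : Cc phi := test_function_Cc [::] tphi.
have [u [v [D [tuv D0 HD]]]] := lens_dt_bound c0.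
pose f (s : R) (y : n.-tuple R) := lens th s (vec y) * phi (vec y).
pose G (y : n.-tuple R) := D * (1 + enorm (vec y) ^+ 2) * `|phi (vec y)|.
have f' (s : R) y : u < s < v -> is_derive s 1 (f ^~ y) (lens_dt th s (vec y) * phi (vec y)).
  move=> suv; have [cs _] := HD th s (vec y) suv.
  have := is_derive_mul (lens_time_derive th (vec y) cs) (is_derive_cstr (phi (vec y)) s (1 : R)).
  by rewrite mulr0 addr0.
have CG : Cc (fun x => D * (1 + enorm x ^+ 2) * `|phi x|).
  have Cn : Cc (fun x => `|phi x|).
    split; first by apply: cont_norm; exact: Cphi.1.
    by have [r Hr] := Cphi.2; exists r => x i /Hr ->; rewrite normr0.
  apply: CcMl Cn; apply: contM; first exact: cont_cst.
  by apply: contD; [exact: cont_cst|apply: contX; exact: enorm_continuous].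
have tI : `]u, v[%classic t by rewrite /= in_itv.
have inI (s : R) : `]u, v[%classic s -> u < s < v by rewrite /= in_itv.
have If (s : R) : `]u, v[%classic s -> mu.-integrable setT (EFin \o f s).
  move=> _; apply: Cc_integrable (CcMl _ Cphi); exact: wave_continuous.
have df (s : R) y : `]u, v[%classic s -> setT y -> derivable (f ^~ y) s 1.
  by move=> /inI sI _; have [] := f' s y sI.
have G0 y : 0 <= G y.
  by rewrite /G !mulr_ge0// addr_ge0// sqr_ge0.
have IG : mu.-integrable setT (EFin \o G) := Cc_integrable CG.
have fG (s : R) y : `]u, v[%classic s -> setT y -> `|partial1of2 f s y| <= G y.
  move=> /inI sI _; rewrite partial1of2E (@derive_val _ _ _ _ _ _ _ (f' s y sI)) normrM.
  by apply: ler_wpM2r => //; have [] := HD th s (vec y) sI.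
split; first exact: (derivable_under_integral measurableT tI If df G0 IG fG).
rewrite -derive1E (differentiation_under_integral measurableT tI If df G0 IG fG).
apply: eq_Rintegral => y _; rewrite partial1of2E.
exact: (@derive_val _ _ _ _ _ _ _ (f' t y (inI _ tI))).
Qed.

End LensWave.

(** * The gradient norm in closed form *)

Section GradientNorm.
Variables (R : realType) (m : nat) (Q : 'cV[R]_m.+1 -> R) (gamma : R).
Hypothesis gsQ : ground_state Q.
Hypothesis gamma0 : 0 < gamma.
Local Notation n := m.+1.
Local Notation mu := (lebesgueRn R n).
Local Notation c := (lens_c gamma).
Local Notation k := (lens_k gamma).
Local Notation b := (lens_b gamma).
Local Notation w := (lens_w gamma).
Local Notation a := (lens_a m gamma).

Definition lensC (t : R) : 'cV[R]_n -> R[i] :=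
  mkC (lens Q gamma 0 t) (lens Q gamma (- (pi / 2)) t).

Definition moment2 : R := \int[mu]_y (enorm (vec y) ^+ 2 * Q (vec y) ^+ 2).
Definition energy : R := \int[mu]_y (\sum_j partial j Q (vec y) ^+ 2).

Let gradQ (x : 'cV[R]_n) : R := \sum_j partial j Q x ^+ 2.
Let momQ (x : 'cV[R]_n) : R := enorm x ^+ 2 * Q x ^+ 2.

Let gradQ_cont : continuous gradQ.
Proof. by apply: cont_sum => j; apply: contX; exact: (ground_state_cont gsQ (s := [:: j])). Qed.

Let momQ_cont : continuous momQ.
Proof.
apply: contM; apply: contX; first exact: enorm_continuous.
exact: (ground_state_cont gsQ (s := [::])).
Qed.

Let gradQ_int : mu.-integrable setT (fun t => (gradQ (vec t))%:E).
Proof.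
have [D D0 HD] := ground_state_weight gsQ.
apply: (@le_weight_integrable _ _ gradQ D) => // x; have [_ ->] := HD x.
by rewrite andbT; apply: sumr_ge0 => j _; exact: sqr_ge0.
Qed.

Let momQ_int : mu.-integrable setT (fun t => (momQ (vec t))%:E).
Proof.
have [D D0 HD] := ground_state_weight gsQ.
apply: (@le_weight_integrable _ _ momQ D) => // x; have [H _] := HD x.
rewrite /momQ mulr_ge0 ?sqr_ge0//=; apply: le_trans H.
by rewrite mulrDl mul1r lerDr sqr_ge0.
Qed.

Lemma lens_a_sqr (t : R) : 0 < c t -> a t ^+ 2 = k t ^+ n.
Proof.
move=> c0; rewrite /lens_a /lens_k !exprVn -[in LHS]powR_mulrn ?powR_ge0// -powRrM.
by rewrite (_ : n%:R / 2 * 2%:R = n%:R) ?powR_mulrn ?(ltW c0)//; field.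
Qed.

Lemma lensC_c1grad th t : c1grad (lens Q gamma th t) (dlens Q gamma th t).
Proof. exact: wave_c1grad. Qed.

Lemma lensC_dominated (t : R) : 0 < c t ->
  exists C, forall th, dominated C (lens Q gamma th t) (dlens Q gamma th t).
Proof.
move=> c0; have [u [v [C [tuv HC]]]] := lens_dominated gsQ gamma0 c0.
by exists C => th; have [] := HC th t tuv.
Qed.

(** Real and imaginary parts are in quadrature: the cross terms between the phase gradient and the
    profile gradient cancel. *)
Lemma dlens_sqr (t : R) j (x : 'cV[R]_n) :
  dlens Q gamma 0 t j x ^+ 2 + dlens Q gamma (- (pi / 2)) t j x ^+ 2 =
  a t ^+ 2 * (4 * b t ^+ 2 * (x j 0 ^+ 2 * Q (k t *: x) ^+ 2) + k t ^+ 2 * partial j Q (k t *: x) ^+ 2).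
Proof.
rewrite /dlens /dwave addr0 (addrAC (w t)) cosBpihalf sinBpihalf.
set z := w t + _; have := cos2Dsin2 z; set C := cos z; set S := sin z => CS.
set q := Q _; set p := partial j Q _; set y := x j 0.
transitivity (a t ^+ 2 * ((C ^+ 2 + S ^+ 2) * (4 * b t ^+ 2 * (y ^+ 2 * q ^+ 2) + k t ^+ 2 * p ^+ 2))); first by ring.
by rewrite CS mul1r.
Qed.

(** In the variable [y = k x] the density becomes [g], and the Jacobian [k ^ -n] is cancelled by
    [a ^ 2 = k ^ n]. The moment gets the coefficient [4 b ^ 2 / k ^ 2], equal to [gamma ^ 2] times a
    squared sine. *)
Lemma gradL2norm_lensC (t : R) : 0 < c t ->
  gradL2norm (lensC t) = Num.sqrt (gamma ^+ 2 * sin (2 * gamma * t) ^+ 2 * moment2 + k t ^+ 2 * energy).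
Proof.
move=> c0; have k0 := lens_k_gt0 c0; have [C HC] := lensC_dominated c0.
have kn0 : k t != 0 by rewrite gt_eqF.
rewrite (gradL2norm_mkC (lensC_c1grad _ _) (lensC_c1grad _ _) (HC _) (HC _)); congr Num.sqrt.
pose g y := a t ^+ 2 * (4 * b t ^+ 2 / k t ^+ 2) * momQ y + a t ^+ 2 * k t ^+ 2 * gradQ y.
have gE x : \sum_j (dlens Q gamma 0 t j x ^+ 2 + dlens Q gamma (- (pi / 2)) t j x ^+ 2) = g (k t *: x).
  under eq_bigr do rewrite dlens_sqr.
  rewrite -mulr_sumr big_split/= -!mulr_sumr -mulr_suml -enorm_sqr.
  by rewrite /g /momQ /gradQ enormZ ?(ltW k0)//; field.
have g0 x : 0 <= g x.
  have m0 : 0 <= momQ x by rewrite mulr_ge0 ?sqr_ge0.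
  have q0 : 0 <= gradQ x by apply: sumr_ge0 => j _; exact: sqr_ge0.
  have a2 := sqr_ge0 (a t); have b2 := sqr_ge0 (b t); have k2 := sqr_ge0 (k t).
  by apply: addr_ge0; apply: mulr_ge0 => //; apply: mulr_ge0 => //; rewrite divr_ge0// mulr_ge0.
have cg : continuous g by apply: contD; apply: contM => //; exact: cont_cst.
have E := ge0_integral_dilation k0 cg g0.
(* Finiteness turns the extended-real dilation formula into one between real integrals. *)
have fin : (\int[mu]_t0 (g (k t *: vec t0))%:E)%E \is a fin_num.
  have /gradint_fin := mkC_weak_gradient (lensC_c1grad 0 t) (lensC_c1grad (- (pi / 2)) t) (HC _) (HC _).
  rewrite /gradint; congr (_ \is a fin_num); apply: eq_integral => y _; congr (_%:E).
  by rewrite -gE; apply: eq_bigr => j _; rewrite mxE.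
under eq_Rintegral do rewrite gE.
have kn : k t ^+ n != 0 by rewrite expf_neq0.
have -> : \int[mu]_y g (k t *: vec y) = (k t ^+ n)^-1 * \int[mu]_y g (vec y).
  rewrite /Rintegral E; move: fin; case: (\int[mu]_t0 _)%E => //= r _.
  by rewrite mulKf.
have I1 : mu.-integrable setT (fun y => (a t ^+ 2 * (4 * b t ^+ 2 / k t ^+ 2) * momQ (vec y))%:E).
  by under eq_fun do rewrite EFinM; exact: integrableZl.
have I2 : mu.-integrable setT (fun y => (a t ^+ 2 * k t ^+ 2 * gradQ (vec y))%:E).
  by under eq_fun do rewrite EFinM; exact: integrableZl.
have -> : \int[mu]_y g (vec y) = a t ^+ 2 * (4 * b t ^+ 2 / k t ^+ 2) * moment2 + a t ^+ 2 * k t ^+ 2 * energy.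
  by rewrite (RintegralD measurableT I1 I2) (@RintegralZl _ _ _ mu setT _ _ measurableT momQ_int) (@RintegralZl _ _ _ mu setT _ _ measurableT gradQ_int).
rewrite (lens_a_sqr c0).
have -> : 4 * b t ^+ 2 / k t ^+ 2 = gamma ^+ 2 * sin (2 * gamma * t) ^+ 2.
  by rewrite /lens_b /lens_k /tan -/(c t); field; rewrite gt_eqF.
by field.
Qed.

Lemma moment2_ge0 : 0 <= moment2.
Proof. by apply: Rintegral_ge0 => y _; rewrite mulr_ge0 ?sqr_ge0. Qed.

(** The profile is positive at 0 and tends to 0, so its derivative is nonzero somewhere; by
    continuity the squared gradient exceeds half its value there on a slab of positive measure. *)
Lemma energy_gt0 : 0 < energy.
Proof.
have [r1 Hr1] := profile_cvg0 gsQ (ground_state_gt0 gsQ (0 *: delta_mx ord0 0)).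
pose r2 := Num.max 0 r1.
have r20 : 0 <= r2 by rewrite le_max lexx.
have H2 : profile Q r2 < profile Q 0 by apply: Hr1; rewrite le_max lexx orbT.
have [r /andP[r0 _] E] := is_derive_mvt r20 (fun x _ => profile_derive gsQ x).
have p1 : profile1 Q r != 0.
  apply/eqP => p0; move: E; rewrite p0 mul0r => /eqP; rewrite subr_eq0 => /eqP E.
  by move: H2; rewrite E ltxx.
pose x := r *: delta_mx ord0 0 : 'cV[R]_n.
have gx : 0 < gradQ x.
  rewrite /gradQ (bigD1 ord0)//= ltr_wpDr//; first by apply: sumr_ge0 => j _; exact: sqr_ge0.
  by rewrite exprn_even_gt0.
have gx2 : 0 < gradQ x / 2 by rewrite divr_gt0.
have gx3 : gradQ x / 2 < gradQ x by rewrite ltr_pdivrMr// ltr_pMr// ltr1n.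
have /nbhs_ballP[e /= e0 He] : \forall y \near x, gradQ x / 2 < gradQ y by exact: (cvgr_gt _ (@gradQ_cont x)).
(* Strictly below [e], so that the closed slab fits in the open ball of the sup norm. *)
pose d := e / 2.
have d0 : 0 < d by rewrite divr_gt0.
have de : d < e by rewrite ltr_pdivrMr// ltr_pMr// ltr1n.
have slab_ball y : slab r d y -> ball x e (vec y).
  move=> sy; rewrite -ball_normE /ball_/=; apply: le_lt_trans de; apply: norm_cV_le; first exact: ltW.
  move=> i; rewrite !mxE eqxx andbT; have := sy i.
  have [->|i0] := eqVneq i ord0; rewrite /= in_itv/= => /andP[h1 h2].
    by rewrite mulr1 distrC ger0_norm ?subr_ge0// lerBlDl.
  by rewrite mulr0 sub0r normrN ler_norml h1.
pose ka := \prod_(i < n) (if i == ord0 then d else d + d).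
have ka0 : 0 < ka by apply: prodr_gt0 => i _; case: ifP => _ //; exact: addr_gt0.
suff : ((gradQ x / 2 * ka)%:E <= \int[mu]_y (gradQ (vec y))%:E)%E.
  move=> H; rewrite /energy /Rintegral; apply: (@lt_le_trans _ _ (gradQ x / 2 * ka)); first by rewrite mulr_gt0.
  by rewrite -lee_fin fineK//; exact: integrable_fin_num.
apply: (@le_trans _ _ (\int[mu]_(t in slab r d) (gradQ x / 2)%:E)%E).
  rewrite integral_cst; last exact: slab_measurable.
  by rewrite [X in (_ <= _ * X)%E](slab_measure m r d0).
rewrite integral_mkcond; apply: ge0_le_integral => //.
- by move=> t _; rewrite patchE; case: ifP => // _; rewrite lee_fin ltW.
- by apply/(measurable_restrictT _ (@slab_measurable R m r d)); exact: measurable_cst.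
- by apply/measurable_EFinP; exact: continuous_measurable_vec.
move=> t _; rewrite patchE; case: ifPn => [/set_mem st|_]; last first.
  by rewrite lee_fin; apply: sumr_ge0 => j _; exact: sqr_ge0.
by rewrite lee_fin ltW// He//; exact: slab_ball.
Qed.

End GradientNorm.

(** * The lens transform solves the rotating equation *)

Section LensSolution.
Variables (R : realType) (m : nat) (Q : 'cV[R]_m.+1 -> R) (gamma : R) (M : 'M[R]_m.+1).
Hypothesis gsQ : ground_state Q.
Hypothesis gamma0 : 0 < gamma.
Hypothesis skM : M^T = - M.
Local Notation n := m.+1.
Local Notation mu := (lebesgueRn R n).
Local Notation c := (lens_c gamma).
Local Notation k := (lens_k gamma).
Local Notation b := (lens_b gamma).
Local Notation w := (lens_w gamma).
Local Notation a := (lens_a m gamma).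
Local Notation T := (pi / (4 * gamma)).
Local Notation lensQ := (lens Q gamma).
Local Notation dlensQ := (dlens Q gamma).
Local Notation lensCQ := (lensC Q gamma).

Lemma blowup_time_gt0 : 0 < T.
Proof. by rewrite divr_gt0 ?pi_gt0// mulr_gt0. Qed.

Lemma blowup_phase : 2 * gamma * T = pi / 2.
Proof. by field; rewrite gt_eqF. Qed.

Lemma lens_c_gt0 (t : R) : 0 <= t < T -> 0 < c t.
Proof.
move=> /andP[t0 tT]; apply: cos_gt0_pihalf; apply/andP; split.
  apply: (@lt_le_trans _ _ 0); first by rewrite oppr_lt0 divr_gt0 ?pi_gt0.
  by rewrite !mulr_ge0// ltW.
by rewrite -blowup_phase ltr_pM2l// mulr_gt0.
Qed.

Lemma expi_add (x y : R) : expi x * expi y = expi (x + y).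
Proof. by rewrite /expi cosD sinD; congr (_ +i* _) => //; rewrite addrC. Qed.

Lemma lensCE (t : R) (x : 'cV[R]_n) :
  ((c t `^ (n%:R / 2))^-1)%:C * expi (- (gamma / 2 * enorm x ^+ 2 * tan (2 * gamma * t)))
    * expi (tan (2 * gamma * t) / (2 * gamma)) * (Q ((c t)^-1 *: (expmx (t *: M) *m x)))%:C
  = lensCQ t x.
Proof.
rewrite -mulrA -mulrA [X in _ * X]mulrA expi_add.
have -> : Q ((c t)^-1 *: (expmx (t *: M) *m x)) = Q (k t *: x).
  by rewrite !(profile_scale gsQ) enorm_expmx.
rewrite /lensC /lens /wave /mkC addr0 (addrAC (w t)) cosBpihalf.
rewrite (_ : - (gamma / 2 * enorm x ^+ 2 * tan (2 * gamma * t)) + tan (2 * gamma * t) / (2 * gamma) =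
  w t + b t * enorm x ^+ 2); last by rewrite /lens_w /lens_b; ring.
rewrite /expi -/(a t); set z := w t + _; set q := Q _.
by apply/eqP; rewrite eq_complex /= !(mul0r, mulr0, subr0, addr0, add0r) !eqxx.
Qed.

Lemma normc_lensC (t : R) x : 0 < c t -> Normc.normc (lensCQ t x) = a t * Q (k t *: x).
Proof.
move=> c0; have a0 := lens_a_gt0 m c0; have q0 := ground_state_gt0 gsQ (k t *: x).
rewrite /lensC /mkC /= /lens /wave addr0 (addrAC (w t)) cosBpihalf.
set z := w t + _; set q := Q _.
rewrite (_ : _ + _ = (a t * q) ^+ 2); first by rewrite sqrtr_sqr ger0_norm// mulr_ge0// ltW.
have CS := cos2Dsin2 z.
transitivity ((a t * q) ^+ 2 * (cos z ^+ 2 + sin z ^+ 2)); first by ring.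
by rewrite CS mulr1.
Qed.

Lemma lensC_inSigma (t : R) : 0 < c t -> inSigma (lensCQ t).
Proof.
move=> c0; have [C HC] := lensC_dominated gsQ gamma0 c0.
exact (mkC_inSigma (lensC_c1grad gamma gsQ 0 t) (lensC_c1grad gamma gsQ (- (pi / 2)) t) (HC 0) (HC (- (pi / 2)))).
Qed.

Lemma lensC_cvg (t : R) : 0 < c t ->
  Sigma_norm (lensCQ s \- lensCQ t) @[s --> t] --> (0 : R).
Proof.
move=> c0; have [u [v [C [tuv HC]]]] := lens_dominated gsQ gamma0 c0.
apply: (@Sigma_norm_cvg0 _ _ u v t C (lensQ 0) (lensQ (- (pi / 2))) (dlensQ 0) (dlensQ (- (pi / 2)))) => //.
- by move=> s _; exact: (lensC_c1grad gamma gsQ).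
- by move=> s _; exact: (lensC_c1grad gamma gsQ).
- by move=> s suv; have [] := HC 0 s suv.
- by move=> s suv; have [] := HC (- (pi / 2)) s suv.
- by move=> x s suv; have [cs _] := HC 0 s suv; exact: lens_cvg.
- by move=> x s suv; have [cs _] := HC 0 s suv; exact: lens_cvg.
- by move=> j x s suv; have [cs _] := HC 0 s suv; exact: dlens_cvg.
- by move=> j x s suv; have [cs _] := HC 0 s suv; exact: dlens_cvg.
Qed.

(** A half turn of the phase changes the sign; [- pi] is the phase that the shift by [pi / 2] in the
    equation brings to [- pi / 2], that of the imaginary part. *)
Lemma lens_dtN (t : R) x : lens_dt Q gamma 0 t x = - lens_dt Q gamma (- pi) t x.
Proof.
rewrite /lens_dt /wave_dt.
set e := b t * enorm x ^+ 2; set z := w t + - pi + e.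
have -> : w t + 0 + e = z + pi by rewrite /z; ring.
by rewrite cosDpi sinDpi; ring.
Qed.

Lemma lens_dt_continuous th (t : R) : continuous (lens_dt Q gamma th t).
Proof.
have ce : continuous (@enorm R n) := @enorm_continuous R n.
have ce2 : continuous (fun x : 'cV[R]_n => enorm x ^+ 2) by exact: contX.
have cQ : continuous (fun x : 'cV[R]_n => Q (k t *: x)).
  exact: (partials_dilate_continuous gsQ (s := [::])).
have cp : continuous (fun x : 'cV[R]_n => profile1 Q (k t * enorm x)).
  move=> x; apply: (@cvg_comp _ _ _ (fun x : 'cV[R]_n => k t * enorm x) (profile1 Q) _ (nbhs (k t * enorm x))).
    exact: (cvgM (cvg_cst _) (ce x)).
  exact: (is_derive_cvg (profile1_derive gsQ _)).
have cc := @cos_phase_continuous R m (b t) (w t + th).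
have cs := @sin_phase_continuous R m (b t) (w t + th).
apply: contM; first exact: cont_cst.
apply: contD; first apply: contB.
- by apply: contM; [exact: cont_cst|exact: contM].
- apply: contM => //; apply: contM => //; apply: contB; first exact: cont_cst.
  by apply: contM => //; exact: cont_cst.
- apply: contM => //; apply: contM => //; apply: contM => //; exact: cont_cst.
Qed.

Lemma lensC_equation (t : R) phi : 0 < c t -> test_function phi ->
  'i * ((\int[mu]_y (lens_dt Q gamma 0 t (vec y) * phi (vec y))) +i*
        (\int[mu]_y (lens_dt Q gamma (- (pi / 2)) t (vec y) * phi (vec y)))) =
  rhs_pairing gamma M (lensCQ t) phi.
Proof.
move=> c0 tphi; have [C HC] := lensC_dominated gsQ gamma0 c0.
have a0 := lens_a_gt0 m c0; have k0 := lens_k_gt0 c0.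
rewrite (rhs_pairing_mkC gamma (lensC_c1grad gamma gsQ 0 t) (lensC_c1grad gamma gsQ (- (pi / 2)) t) (HC _) (HC _)
  (fun x => dwave_rotation gsQ _ _ _ _ skM k0) (fun x => dwave_rotation gsQ _ _ _ _ skM k0) tphi).
set N := (fun x => _ `^ _).
have NE x : N x = (a t * Q (k t *: x)) `^ (4 / n%:R) by rewrite /N -normc_lensC.
have cN : continuous N.
  rewrite (_ : N = fun x : 'cV[R]_n => (a t * Q (k t *: x)) `^ (4 / n%:R)); last by apply/funext => x; exact: NE.
  have cg : continuous (fun x : 'cV[R]_n => a t * Q (k t *: x)).
    by apply: contM; [exact: cont_cst|exact: (partials_dilate_continuous gsQ (s := [::]))].
  move=> x; apply: (@cvg_comp _ _ _ (fun x : 'cV[R]_n => a t * Q (k t *: x)) (fun y => y `^ (4 / n%:R)) _ (nbhs (a t * Q (k t *: x)))).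
    exact: cg.
  by apply: (is_derive_cvg (is_derive1_powR _ _)); rewrite mulr_gt0// ground_state_gt0.
have W th := wave_weak_equation gsQ tphi (w t + th) k0 a0 (lens_ak m c0) (lens_bk c0) NE cN.
(* The shift takes [- pi / 2] to 0 and [- pi] to [- pi / 2]: each component's time derivative is
   paired with the other component. *)
have W2 := W (- (pi / 2)); have W1 := W (- pi).
rewrite -addrA addNr in W2.
rewrite (_ : w t + - pi + pi / 2 = w t + - (pi / 2)) in W1; last by field.
have -> : \int[mu]_y (lens_dt Q gamma (- (pi / 2)) t (vec y) * phi (vec y)) =
  - rhs_part gamma phi N (lensQ 0 t) (dlensQ 0 t) by exact: W2.
have -> : \int[mu]_y (lens_dt Q gamma 0 t (vec y) * phi (vec y)) =
  rhs_part gamma phi N (lensQ (- (pi / 2)) t) (dlensQ (- (pi / 2)) t).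
  under eq_Rintegral do rewrite lens_dtN mulNr.
  rewrite -[RHS]opprK -W1 /Rintegral; under eq_integral do rewrite EFinN.
  rewrite integralN/= ?fineN//; apply: integrable_add_def => //.
  exact: (Cc_integrable (CcMl (@lens_dt_continuous (- pi) t) (test_function_Cc [::] tphi))).
by apply/eqP; rewrite eq_complex /=; apply/andP; split; apply/eqP; ring.
Qed.

Section Solution.
Variable u : R -> 'cV[R]_n -> R[i].
Hypothesis uE : forall t : R, 0 <= t < T -> u t = lensCQ t.

Lemma lens_solution : solution gamma M T u.
Proof.
split=> [t tT|t tT|t /andP[t0 tT] phi tphi].
- by rewrite uE//; apply: lensC_inSigma; exact: lens_c_gt0.
- have H : Sigma_norm (lensCQ s \- lensCQ t) @[s --> within `[0, T[%classic (nbhs t)] --> (0 : R).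
    by apply: cvg_within_filter; exact: lensC_cvg (lens_c_gt0 tT).
  apply: cvg_trans H; apply: near_eq_cvg; rewrite near_withinE; near=> s => sI.
  by rewrite !uE//; move: sI; rewrite /= in_itv.
have tI : 0 <= t < T by rewrite ltW.
have c0 := lens_c_gt0 tI.
(* [u] is prescribed only on [[0, T[]; at an interior time it agrees with the lens transform on a
   neighbourhood, as the two-sided derivative requires. *)
have near_t : \forall s \near t, u s = lensCQ s.
  have : \forall s \near t, s \in `]0, T[ by apply: near_in_itvoo; rewrite in_itv/= t0.
  by apply: filterS => s; rewrite in_itv/= => /andP[s0 sT]; rewrite uE// ltW.
exists ((\int[mu]_y (lens_dt Q gamma 0 t (vec y) * phi (vec y))) +i*
        (\int[mu]_y (lens_dt Q gamma (- (pi / 2)) t (vec y) * phi (vec y)))).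
split; last by rewrite (lensC_equation c0 tphi) uE.
- apply: (@near_eq_is_derive _ _ _ (fun s => \int[mu]_y (lensQ 0 s (vec y) * phi (vec y)))).
    by near=> s; rewrite (_ : u s = lensCQ s) ?integralC_mulr//; near: s.
  exact: lens_weak_derive.
- apply: (@near_eq_is_derive _ _ _ (fun s => \int[mu]_y (lensQ (- (pi / 2)) s (vec y) * phi (vec y)))).
    by near=> s; rewrite (_ : u s = lensCQ s) ?integralC_mulr//; near: s.
  exact: lens_weak_derive.
Unshelve. all: by end_near. Qed.

End Solution.

End LensSolution.

(** * Blow-up *)

Section BlowUpRate.
Variables (R : realType) (m : nat) (Q : 'cV[R]_m.+1 -> R) (gamma : R).
Hypothesis gsQ : ground_state Q.
Hypothesis gamma0 : 0 < gamma.
Local Notation n := m.+1.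
Local Notation c := (lens_c gamma).
Local Notation k := (lens_k gamma).
Local Notation T := (pi / (4 * gamma)).
Local Notation lensCQ := (lensC Q gamma).
Local Notation delta := (fun t : R => pi / 2 - 2 * gamma * t).

Let T0 : 0 < T := blowup_time_gt0 gamma0.

Lemma near_blowup_time : \forall t \near T^'-, 0 <= t < T.
Proof.
near=> t; apply/andP; split; near: t; [exact: nbhs_left_ge|exact: nbhs_left_lt].
Unshelve. all: by end_near. Qed.

Lemma lens_c_blowup : c T = 0.
Proof. by rewrite /lens_c (blowup_phase gamma0) cos_pihalf. Qed.

Lemma lens_c_cvg0 : c t @[t --> T] --> (0 : R).
Proof. by rewrite -lens_c_blowup; exact: (is_derive_cvg (lens_c_derive gamma T)). Qed.

Lemma lens_k_cvgy : k t @[t --> T^'-] --> +oo.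
Proof.
have cpos : \forall t \near T^'-, 0 < c t.
  by apply: filterS near_blowup_time => t; exact: lens_c_gt0.
by apply/(cvgrVy cpos); exact: cvg_at_left_filter lens_c_cvg0.
Qed.

Lemma remaining_phase_derive (t : R) : is_derive t 1 delta (- (2 * gamma)).
Proof.
have := is_derive_add (is_derive_cstr (pi / 2) t (1 : R)) (is_derive_opp (is_derive_phase2 gamma t)).
by rewrite add0r.
Qed.

Lemma remaining_phase_cvg0 : delta t @[t --> T] --> (0 : R).
Proof.
have := is_derive_cvg (remaining_phase_derive T).
by rewrite (blowup_phase gamma0) subrr.
Qed.

Lemma lens_k_rate : delta t * k t @[t --> T^'-] --> (1 : R).
Proof.
apply: cvg_dnbhs_at_left.
have g2 : 0 < 2 * gamma by rewrite mulr_gt0.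
(* On []0, T + T[] the phase [2 * gamma * t] stays in []0, pi[], so the derivative of the cosine
   does not vanish. *)
apply: (@lhopital R delta (fun=> - (2 * gamma)) c (fun t => - sin (2 * gamma * t) * (2 * gamma)) 0 (T + T) T 1).
- by rewrite in_itv/= T0 ltrDl.
- by move=> x _; exact: remaining_phase_derive.
- by move=> x _; exact: lens_c_derive.
- exact: remaining_phase_cvg0.
- exact: lens_c_cvg0.
- move=> t; rewrite inE/= => -[]; rewrite /= in_itv/= => /andP[t0 t2] _.
  rewrite mulf_neq0 ?oppr_eq0 ?(gt_eqF g2)// gt_eqF// sin_gt0_pi// mulr_gt0//=.
  rewrite (_ : pi = 2 * gamma * (T + T)) ?ltr_pM2l//.
  by rewrite mulrDr (blowup_phase gamma0); field.
have cs : sin (2 * gamma * t) @[t --> T] --> (1 : R).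
  have := cvg_comp _ _ (is_derive_cvg (is_derive_phase2 gamma T)) (@continuous_sin R _).
  by rewrite (blowup_phase gamma0) sin_pihalf.
rewrite [X in _ --> X](_ : 1 = - (2 * gamma) / (- 1 * (2 * gamma)) :> R); last by field; rewrite gt_eqF.
have d0 : - 1 * (2 * gamma) != 0 by rewrite mulN1r oppr_eq0 gt_eqF.
have H : (- sin (2 * gamma * t) * (2 * gamma)) @[t --> T] --> (- 1 * (2 * gamma)).
  by apply: cvgM; [exact: cvgN|exact: cvg_cst].
have H2 : (- sin (2 * gamma * t) * (2 * gamma))^-1 @[t --> T] --> (- 1 * (2 * gamma))^-1.
  exact: (cvgV d0 H).
exact: (@cvgM _ _ _ _ (fun=> - (2 * gamma)) _ _ _ (cvg_cst _) H2).
Qed.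

(** Dropping the nonnegative moment term leaves the lower bound [sqrt (energy Q) * k]. *)
Lemma gradL2norm_lensC_cvgy : gradL2norm (lensCQ t) @[t --> T^'-] --> +oo.
Proof.
have E0 : 0 < Num.sqrt (energy Q) by rewrite sqrtr_gt0 energy_gt0.
apply: (ger_cvgy _ (gt0_cvgMry E0 lens_k_cvgy)).
near=> t; have tT : 0 <= t < T by near: t; exact: near_blowup_time.
have c0 := lens_c_gt0 gamma0 tT; have k0 := ltW (lens_k_gt0 c0).
rewrite (gradL2norm_lensC gsQ gamma0 c0) -[X in _ * X]ger0_norm// -sqrtr_sqr -sqrtrM ?(ltW (energy_gt0 gsQ))//.
by apply: ler_wsqrtr; rewrite mulrC lerDr; exact: mulr_ge0 (mulr_ge0 (sqr_ge0 _) (sqr_ge0 _)) (moment2_ge0 Q).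
Unshelve. all: by end_near. Qed.

Lemma gradL2norm_ground_state : gradL2norm (lensCQ 0) = Num.sqrt (energy Q).
Proof.
have cE : c 0 = 1 by rewrite /lens_c mulr0 cos0.
rewrite (gradL2norm_lensC gsQ gamma0) ?cE//.
by rewrite mulr0 sin0 expr0n mulr0 mul0r add0r /lens_k cE invr1 expr1n mul1r.
Qed.

Lemma gradL2norm_lensC_rate :
  gradL2norm (lensCQ t) / ((delta t)^-1 * gradL2norm (lensCQ 0)) @[t --> T^'-] --> (1 : R).
Proof.
have E0 := energy_gt0 gsQ.
(* The square of the ratio. The moment term carries [delta ^ 2] and disappears in the limit, the
   other is [(delta * k) ^ 2] and tends to 1. *)
pose f t := gamma ^+ 2 * sin (2 * gamma * t) ^+ 2 * moment2 Q * (delta t ^+ 2 / energy Q) + (delta t * k t) ^+ 2.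
have fE : \forall t \near T^'-, Num.sqrt (f t) =
    gradL2norm (lensCQ t) / ((delta t)^-1 * gradL2norm (lensCQ 0)).
  near=> t; have tT : 0 <= t < T by near: t; exact: near_blowup_time.
  have c0 := lens_c_gt0 gamma0 tT.
  have d0 : 0 < delta t.
    by rewrite subr_gt0 -(blowup_phase gamma0) ltr_pM2l ?mulr_gt0//; have /andP[] := tT.
  rewrite (gradL2norm_lensC gsQ gamma0 c0) gradL2norm_ground_state.
  set N := gamma ^+ 2 * _ * _ + _; set d := delta t.
  have N0 : 0 <= N.
    exact: addr_ge0 (mulr_ge0 (mulr_ge0 (sqr_ge0 _) (sqr_ge0 _)) (moment2_ge0 Q)) (mulr_ge0 (sqr_ge0 _) (ltW E0)).
  have -> : f t = N * d ^+ 2 / energy Q by rewrite /f /N -/d; field; rewrite gt_eqF.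
  have ND : 0 <= N * d ^+ 2 by exact: mulr_ge0 N0 (sqr_ge0 _).
  rewrite (sqrtrM _ ND) (sqrtrM _ N0) (sqrtrV (ltW E0)) sqrtr_sqr (gtr0_norm d0).
  by rewrite invfM invrK mulrA.
have dT : delta t @[t --> T^'-] --> (0 : R) by exact: cvg_at_left_filter remaining_phase_cvg0.
have cs : sin (2 * gamma * t) @[t --> T^'-] --> (1 : R).
  apply: cvg_at_left_filter.
  have := cvg_comp _ _ (is_derive_cvg (is_derive_phase2 gamma T)) (@continuous_sin R _).
  by rewrite (blowup_phase gamma0) sin_pihalf.
have fT : f t @[t --> T^'-] --> (1 : R).
  rewrite [X in _ --> X](_ : 1 = gamma ^+ 2 * (1 * 1) * moment2 Q * (0 * 0 / energy Q) + 1 * 1 :> R); last by ring.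
  apply: cvgD; last exact: (cvgM lens_k_rate lens_k_rate).
  apply: cvgM; last by apply: cvgM; [exact: (cvgM dT dT)|exact: cvg_cst].
  apply: cvgM; last exact: cvg_cst.
  by apply: cvgM; [exact: cvg_cst|exact: (cvgM cs cs)].
have H : Num.sqrt (f t) @[t --> T^'-] --> (1 : R).
  rewrite -[X in _ --> X]sqrtr1.
  by apply: (@cvg_comp _ _ _ f Num.sqrt) fT _; exact: sqrt_continuous.
by apply: cvg_trans H; apply: near_eq_cvg.
Unshelve. all: by end_near. Qed.

End BlowUpRate.


Theorem mainTheorem3 (R : realType) (n : nat) (gamma : R) (M : 'M[R]_n)
    (Q : 'cV[R]_n -> R) (u : R -> 'cV[R]_n -> R[i]) :
  (1 <= n)%N -> 0 < gamma -> M^T = - M -> ground_state Q ->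
  let T := pi / (4 * gamma) in
  (forall (t : R) (x : 'cV[R]_n), 0 <= t < T ->
     u t x = ((cos (2 * gamma * t) `^ (n%:R / 2))^-1)%:C
             * expi (- (gamma / 2 * enorm x ^+ 2 * tan (2 * gamma * t)))
             * expi (tan (2 * gamma * t) / (2 * gamma))
             * (Q ((cos (2 * gamma * t))^-1 *: (expmx (t *: M) *m x)))%:C) ->
  [/\ solution gamma M T u,
      forall x, u 0 x = (Q x)%:C,
      L2norm (u 0) = L2norm (fun x => (Q x)%:C),
      blows_up_at gamma M T u &
      gradL2norm (u t)
        / ((pi / 2 - 2 * gamma * t)^-1 * gradL2norm (fun x => (Q x)%:C))
        @[t --> T^'-] --> (1 : R)].
Proof.
case: n M Q u => [//|m] M Q u _ gamma0 skM gsQ T uE.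
have T0 : 0 < T := blowup_time_gt0 gamma0.
have uL t : 0 <= t < T -> u t = lensC Q gamma t.
  by move=> tT; apply/funext => x; rewrite uE//; exact: lensCE.
have I0 : 0 <= (0 : R) < T by rewrite lexx.
have u0 : u 0 = fun x => (Q x)%:C.
  apply/funext => x; rewrite uE// !mulr0 cos0 tan0 powR1 invr1 expmx0 mul1mx scale1r.
  by rewrite mulr0 oppr0 mul0r /expi cos0 sin0 !mul1r.
have sol : solution gamma M T u := lens_solution gsQ gamma0 skM uL.
have uoo : gradL2norm (u t) @[t --> T^'-] --> +oo.
  apply: cvg_trans (gradL2norm_lensC_cvgy gsQ gamma0); apply: near_eq_cvg.
  by apply: filterS (near_blowup_time gamma0) => t tT; rewrite uL.
split => //.
- by move=> x; rewrite u0.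
- by rewrite u0.
- split=> //; split=> // T' v TT' solv.
  by apply: (blowup_not_extendable T0 TT' _ uoo solv); have [] := sol.
- rewrite -u0 (uL 0 I0); apply: cvg_trans (gradL2norm_lensC_rate gsQ gamma0); apply: near_eq_cvg.
  by apply: filterS (near_blowup_time gamma0) => t tT; rewrite uL.
Qed.
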